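(* Let $n\ge1$, $\tau\in\mathbb{C}$ with $\mathrm{Im}(\tau)>0$, and let $J=J_n(1)$ be the Jordan block of size $n\times n$ with eigenvalue one (ones on the diagonal and the first superdiagonal, zeros elsewhere). Then, up to the nonzero constant factor $\frac{\exp(\pi i\tau/4)}{i\,\theta'(0)}$, the tensor $r_J(v,y)$ constructed in the context is given, for $v,y\in\mathbb{C}\setminus\Lambda$, by $$\sum_{\substack{0\le k\le n-1\\0\le l\le n-1}}\nabla_{k,l}\bigl(\sigma(v,y)\bigr)\sum_{\substack{1\le i\le n-l\\1\le j\le n-k}}e_{i,j+k}\otimes e_{j,i+l},$$ where $\sigma$ is the Kronecker function and $\nabla_{k,l}$ acts on the first variable $v$; that is, $r_J(v,y)$ equals $\frac{\exp(\pi i\tau/4)}{i\,\theta'(0)}$ times this expression.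
   Context: $\Lambda=\mathbb{Z}+\tau\mathbb{Z}$. $e_{a,b}$ is the elementary matrix. With $q=\exp(\pi i\tau)$: $\theta(z)=2q^{1/4}\sum_{m=0}^\infty(-1)^mq^{m(m+1)}\sin((2m+1)\pi z)$, $\bar\theta(z)=\sum_{m\in\mathbb{Z}}\exp(\pi im^2\tau+2\pi imz)$, and the Kronecker function is $\sigma(u,x)=\dfrac{\theta'(0)\theta(u+x)}{\theta(u)\theta(x)}$. Construction of $r_J$. For $v\in\mathbb{C}$ let $e(z)=-\exp(-2\pi i(z+v+\tau))$ and let $\mathrm{Sol}_{J,v,\tau}$ be the complex vector space of holomorphic functions $\Phi:\mathbb{C}\to \mathrm{Mat}_{n\times n}(\mathbb{C})$ with $\Phi(z+1)=\Phi(z)$ and $\Phi(z+\tau)J=e(z)J\Phi(z)$. Let $\mathrm{res}_0(\Phi)=\Phi(0)$, which is an isomorphism $\mathrm{Sol}_{J,v,\tau}\to \mathrm{Mat}_{n\times n}(\mathbb{C})$ if $v\notin\Lambda$; for $y\in\mathbb{C}\setminus\Lambda$ let $\mathrm{ev}_y(\Phi)=\frac{1}{\bar\theta(y+\frac{\tau+1}{2})}\Phi(y)$. Put $\tilde r_J(v,y)=\mathrm{ev}_y\circ \mathrm{res}_0^{-1}$, and let $r_J(v,y)\in \mathrm{Mat}_{n\times n}(\mathbb{C})\otimes \mathrm{Mat}_{n\times n}(\mathbb{C})$ be the tensor corresponding to the linear map $\tilde r_J(v,y)$ under $X\otimes Y\mapsto(Z\mapsto \mathrm{Tr}(XZ)Y)$.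 It is a solution of the associative Yang--Baxter equation. Operators $\nabla_{k,l}$: for $1\le k\le n-1$ let $a_k=\frac{(-1)^k}{k}$; let $A_0$ be the strictly lower triangular $n\times n$ Toeplitz matrix with $(p,q)$ entry $a_{p-q}$ for $p>q$ and $0$ otherwise, and $A_k=-a_k\cdot1_{n\times n}$ for $1\le k\le n-1$. Let $N\in \mathrm{Mat}_{n^2\times n^2}(\mathbb{C})$ be the block upper triangular Toeplitz matrix with $(p,q)$ block ($1\le p,q\le n$, blocks of size $n\times n$) equal to $A_{q-p}$ if $q\ge p$ and $0$ if $q<p$. $N$ is nilpotent. With $\nabla=-\frac{1}{2\pi i}\frac{d}{dz}$ acting on meromorphic functions on $\mathbb{C}$ and $e_m$ the standard basis (column) vectors of $\mathbb{C}^{n^2}$, set for $0\le k,l\le n-1$ $$\nabla_{k,l}=e_{n(n-k-1)+l+1}^{t}\exp(\nabla N)\,e_{n(n-1)+1},$$ a polynomial in $\nabla$. *)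

(* Defs.v *)
From HB Require Import structures.
From mathcomp Require Import all_boot all_order all_algebra.
From mathcomp Require Import all_classical all_reals all_analysis.
From mathcomp Require Import complex mxtens.
Set Implicit Arguments.
Unset Strict Implicit.
Unset Printing Implicit Defensive.
Import Order.TTheory GRing.Theory Num.Theory.
Import numFieldNormedType.Exports.
Local Open Scope classical_set_scope.
Local Open Scope ring_scope.

(* R[i] packaged as a numClosedFieldType, so that it receives the topology and
   the normed module structure (over itself) of MathComp-Analysis: [derivable]
   and [derive1] below are complex differentiability and the complex derivative. *)
Definition CC (R : realType) : numClosedFieldType := R[i].

Definition rc {R : realType} (x : R) : CC R := Complex x 0.
Definition ic {R : realType} : CC R := Complex 0 1.
Definition pic {R : realType} : CC R := rc pi.
Definition reC {R : realType} (z : CC R) : R := complex.Re z.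
Definition imC {R : realType} (z : CC R) : R := complex.Im z.

Definition expC {R : realType} (z : CC R) : CC R :=
  rc (expR (reC z)) * Complex (cos (imC z)) (sin (imC z)).

Definition sinC {R : realType} (z : CC R) : CC R :=
  (expC (ic * z) - expC (- (ic * z))) / (2 * ic).

Definition lattice {R : realType} (tau : CC R) : set (CC R) :=
  [set z | exists a b : int, z = a%:~R + b%:~R * tau].

Definition theta {R : realType} (tau z : CC R) : CC R :=
  2 * expC (pic * ic * tau / 4) *
  limn (series (fun m : nat => (-1) ^+ m
                  * expC (pic * ic * tau) ^+ (m * m.+1)
                  * sinC ((2 * m + 1)%:R * pic * z))).

(* [Posz m] is m and [Negz m] is - (m + 1). *)
Definition zseries {R : realType} (u : int -> CC R) : CC R :=
  limn (series (fun m : nat => u (Posz m)))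
  + limn (series (fun m : nat => u (Negz m))).

Definition thetabar {R : realType} (tau z : CC R) : CC R :=
  zseries (fun m : int => expC (pic * ic * m%:~R ^+ 2 * tau
                                + 2 * pic * ic * m%:~R * z)).

Definition kronecker {R : realType} (tau u x : CC R) : CC R :=
  derive1 (theta tau) 0 * theta tau (u + x) / (theta tau u * theta tau x).

Definition efac {R : realType} (tau v z : CC R) : CC R :=
  - expC (- (2 * pic * ic * (z + v + tau))).

Definition Sol {R : realType} {n : nat} (J : 'M[CC R]_n) (v tau : CC R) :
    set (CC R -> 'M[CC R]_n) :=
  [set Phi : CC R -> 'M[CC R]_n | [/\ forall (i j : 'I_n) (z : CC R),
                   derivable (fun w : CC R => Phi w i j) z 1,
                 forall z, Phi (z + 1) = Phi z &
                 forall z, Phi (z + tau) *m J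
                           = efac tau v z *: (J *m Phi z)]].

Definition res0 {R : realType} {n : nat} (Phi : CC R -> 'M[CC R]_n) : 'M[CC R]_n :=
  Phi 0.

Definition ev {R : realType} {n : nat} (tau y : CC R)
    (Phi : CC R -> 'M[CC R]_n) : 'M[CC R]_n :=
  (thetabar tau (y + (tau + 1) / 2))^-1 *: Phi y.

(* The inverse of [res0] restricted to [Sol J v tau]; where [res0] fails to be
   a bijection from this set (possible only if v is in the lattice) the value
   is arbitrary. *)
Definition res0_inv {R : realType} {n : nat} (J : 'M[CC R]_n) (v tau : CC R) :
    'M[CC R]_n -> (CC R -> 'M[CC R]_n) :=
  'pinv_(fun _ _ => 0) (Sol J v tau) res0.

Definition rtilde {R : realType} {n : nat} (J : 'M[CC R]_n) (tau v y : CC R)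
    (Z : 'M[CC R]_n) : 'M[CC R]_n :=
  ev tau y (res0_inv J v tau Z).

(* Mat_n (x) Mat_n is realised by the Kronecker product [*t] in Mat_{n^2}.
   [tensor_of] is the inverse of the isomorphism
     X (x) Y |-> (Z |-> Tr(X Z) Y)
   from Mat_n (x) Mat_n to linear endomorphisms of Mat_n: it is linear in phi,
   and [tensor_ofE] gives its values on the maps Z |-> Tr(X Z) Y. *)
Definition tensor_of {K : fieldType} {n : nat} (phi : 'M[K]_n -> 'M[K]_n) :
    'M[K]_(n * n) :=
  \sum_(i < n) \sum_(j < n) delta_mx i j *t phi (delta_mx j i).

Lemma tensor_ofE (K : fieldType) (n : nat) (X Y : 'M[K]_n) :
  tensor_of (fun Z => \tr (X *m Z) *: Y) = X *t Y.
Proof.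
have trE i j : \tr (X *m delta_mx j i) = X i j.
  rewrite /mxtrace (bigD1 i) //= big1 => [|k /negbTE ki].
    rewrite addr0 mxE (bigD1 j) //= mxE !eqxx mulr1 big1 ?addr0 // => k kj.
    by rewrite mxE (negbTE kj) mulr0.
  by rewrite mxE big1 // => l _; rewrite mxE ki andbF mulr0.
apply/matrixP => a b; rewrite /tensor_of summxE [RHS]mxE.
case: (mxtens_unindex a) (mxtens_unindexK a) => p q <-.
case: (mxtens_unindex b) (mxtens_unindexK b) => r s <-.
rewrite /= (bigD1 p) //= [X in _ + X]big1 ?addr0.
  rewrite summxE (bigD1 r) //= [X in _ + X]big1 ?addr0.
    by rewrite tensmxE !mxE !eqxx mul1r trE.
  by move=> j jr; rewrite tensmxE mxE eqxx /= eq_sym (negbTE jr) mul0r.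
move=> i ip; rewrite summxE big1 // => j _.
by rewrite tensmxE mxE eq_sym (negbTE ip) mul0r.
Qed.

Definition rJ {R : realType} {n : nat} (J : 'M[CC R]_n) (tau v y : CC R) :
    'M[CC R]_(n * n) :=
  tensor_of (rtilde J tau v y).

Definition jordan1 {K : fieldType} (n : nat) : 'M[K]_n :=
  \matrix_(i < n, j < n) ((j == i :> nat) || (j == i.+1 :> nat))%:R.

(* Elementary matrices and standard basis vectors, with indices from 1. *)
Definition elmx {K : fieldType} (n : nat) (a b : nat) : 'M[K]_n :=
  \matrix_(i < n, j < n) ((i.+1 == a) && (j.+1 == b))%:R.
Definition basisv {K : pzRingType} (d : nat) (m : nat) : 'cV[K]_d :=
  \col_(i < d) (i.+1 == m)%:R.

Definition acoef {K : fieldType} (k : nat) : K := (-1) ^+ k / k%:R.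

Definition Ablock {K : fieldType} (n : nat) (k : nat) : 'M[K]_n :=
  if k == 0%N then \matrix_(p < n, q < n) (if (q < p)%N then acoef (p - q)%N else 0)
  else - (acoef k)%:M.

(* The size [\sum_(p < n) n] imposed by [\mxblock] is n * n, and the indices
   run through the blocks one after the other. *)
Definition Nmx {K : fieldType} (n : nat) : 'M[K]_(\sum_(p < n) n) :=
  \mxblock_(p < n, q < n) (if (p <= q)%N then Ablock n (q - p)%N else 0).

Lemma Nmx_nilpotent (K : fieldType) (n : nat) :
  @Nmx K n ^+ (\sum_(p < n) n) = 0.
Proof.
set d := (\sum_(p < n) n)%N.
have dE : d = (n * n)%N by rewrite /d sum_nat_const card_ord.
pose key (s : 'I_d) := (tagnat.sig1 s * n + (n - (tagnat.sig2 s).+1))%N.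
have key_lt s : (key s < n * n)%N.
  rewrite /key; apply: leq_trans (_ : (tagnat.sig1 s).+1 * n <= _)%N.
    by rewrite mulSnr -addnS leq_add2l subnSK ?leq_subr.
  by rewrite leq_mul2r ltn_ord orbT.
have keyN s t : Nmx n s t != 0 :> K -> (key s < key t)%N.
  rewrite mxE /key; case: (ltngtP (tagnat.sig1 s) (tagnat.sig1 t)) => [st _|_|st].
  - apply: leq_trans (_ : (tagnat.sig1 s).+1 * n <= _)%N.
      by rewrite mulSnr -addnS leq_add2l subnSK ?leq_subr.
    by rewrite (leq_trans _ (leq_addr _ _)) // leq_mul2r st orbT.
  - by rewrite mxE eqxx.
  rewrite st subnn /Ablock eqxx mxE; case: ltnP; last by rewrite eqxx.
  by move=> ts _; rewrite ltn_add2l ltn_sub2l // (leq_ltn_trans ts).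
have keyX m s t : (@Nmx K n ^+ m) s t != 0 -> (key s + m <= key t)%N.
  elim: m s t => [|m IHm] s t.
    by rewrite expr0 mxE; case: (s =P t) => [->|]; rewrite ?addn0 ?eqxx.
  apply: contraNT => st; rewrite exprSr mxE big1 // => u _.
  have [->|/IHm su] := eqVneq ((@Nmx K n ^+ m) s u) 0; first by rewrite mul0r.
  have [->|/keyN ut] := eqVneq (@Nmx K n u t) 0; first by rewrite mulr0.
  by case/negP: st; rewrite addnS (leq_ltn_trans su).
apply/matrixP => s t; rewrite [RHS]mxE; apply/eqP/negPn/negP => /keyX.
by rewrite -/d dE leqNgt (leq_trans (key_lt t)) ?leq_addl.
Qed.

(* exp('X N), where 'X stands for the operator nabla. The series stops before
   the exponent d because a nilpotent d x d matrix satisfies N ^+ d = 0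
   (for [Nmx n] this is [Nmx_nilpotent]). *)
Definition exp_nabla {K : fieldType} (d : nat) (N : 'M[K]_d) : 'M[{poly K}]_d :=
  \sum_(m < d) ((m`!%:R)^-1)%:P *: ('X *: map_mx polyC N) ^+ m.

Definition nabla_poly {K : fieldType} (n k l : nat) : {poly K} :=
  ((basisv _ (n * (n - k - 1) + l + 1)%N)^T *m exp_nabla (Nmx n)
   *m basisv _ (n * (n - 1) + 1)%N) 0 0.

Definition nabla {R : realType} (f : CC R -> CC R) : CC R -> CC R :=
  fun z => - (2 * pic * ic)^-1 * derive1 f z.

Definition apply_nabla {R : realType} (P : {poly CC R}) (f : CC R -> CC R) :
    CC R -> CC R :=
  fun z => \sum_(m < size P) P`_m * iter m nabla f z.

(* Main.v *)
Require Import Defs.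
From HB Require Import structures.
From mathcomp Require Import all_boot all_order all_algebra.
From mathcomp Require Import all_classical all_reals all_analysis.
From mathcomp Require Import complex mxtens.
From mathcomp Require Import ring lra zify.
Import Order.TTheory GRing.Theory Num.Theory.
Import numFieldNormedType.Exports.
Local Open Scope classical_set_scope.
Local Open Scope ring_scope.

(** The entries of r_J are the values at [y] of the solutions Phi of
    Phi(z + 1) = Phi(z), Phi(z + tau) J = e(z) J Phi(z) with prescribed Phi(0), so
    the theorem amounts to an explicit formula for these solutions.

    For n = 1 the solution with value 1 at the origin is
    phi_v(z) = exp(- pi i z) theta(z + v) / theta(v), and its multiplier depends on
    [v] through the factor exp(- 2 pi i v). Conjugation by the unipotent matrix J
    has a nilpotent logarithm N', hence multiplies the multiplier by exp(N'), which
    amounts to replacing [v] by v - N' / (2 pi i). Taylor's formula in [v] gives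
    Phi = exp(N' nabla) phi_v Z = J^nabla Z J^(- nabla) phi_v, with nabla acting on
    [v]. Expanding J^X = (1 + E)^X by the binomial series, the coefficient of
    E^k Z E^l is (X choose k) (- X choose l) at X = nabla ([solmx]). Quasi-periodicity
    is Pascal's rule, because multiplication by exp(- 2 pi i v) conjugates nabla into
    nabla + 1 ([apply_nabla_twist], [solmx_addtau]). The operators nabla_(k,l) are the
    same polynomials: the vector exp(X N) e solves V' = N V, and so does the vector of
    the products of binomials, by the derivative of (1 + t)^X ([binp_deriv],
    [nabla_polyE]).

    It remains to see that res_0 is injective. The equation is triangular, which
    reduces the claim to scalar solutions ([Sol_zero]). The mean of a 1-periodic
    entire function over a horizontal period does not depend on the period
    ([period_mean_const]), by Goursat's lemma since the solutions are only assumed to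
    be differentiable. Hence the Fourier coefficients of a scalar solution satisfy a
    recurrence and are determined by one of them; they determine the function
    ([fourier_uniqueness]), so scalar solutions form a line, spanned by phi_v
    ([scalar_sol_zero]).

    All this needs theta(v) to be nonzero off the lattice and theta'(0) to be
    nonzero. Both follow from Jacobi's triple product: its finite form is the
    q-binomial theorem ([finite_triple_product]), and a lower bound for the partial
    products passes to the limit ([theta_half_sub_lower]). *)

Set Implicit Arguments.
Unset Strict Implicit.
Unset Printing Implicit Defensive.

(** * Complex numbers and real moduli *)

Section ComplexBasics.
Context {R : realType}.
Implicit Types (z w : CC R) (x y : R).

(** The norm of [CC R] takes its values in [CC R]; this is the same number as a
    real, so that estimates take place in an ordered field. *)
Definition cabs (z : CC R) : R := Num.sqrt (reC z ^+ 2 + imC z ^+ 2).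

Lemma normCE z : `|z| = rc (cabs z).
Proof. exact: normc_def. Qed.

Lemma rcD x y : rc (x + y) = rc x + rc y :> CC R.
Proof. by apply/eqP; rewrite eq_complex /= addr0 !eqxx. Qed.
Lemma rcN x : rc (- x) = - rc x :> CC R.
Proof. by apply/eqP; rewrite eq_complex /= oppr0 !eqxx. Qed.
Lemma rcB x y : rc (x - y) = rc x - rc y :> CC R.
Proof. by rewrite rcD rcN. Qed.
Lemma rcM x y : rc (x * y) = rc x * rc y :> CC R.
Proof. by apply/eqP; rewrite eq_complex /= !mulr0 mul0r subr0 addr0 !eqxx. Qed.
Lemma rc0 : rc 0 = 0 :> CC R. Proof. by []. Qed.
Lemma rc_nat n : rc (n%:R) = n%:R :> CC R.
Proof. by elim: n => // n IHn; rewrite -!natr1 rcD IHn. Qed.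
Lemma rc_inj : injective (@rc R). Proof. by move=> x y []. Qed.
Lemma rcX x n : rc (x ^+ n) = rc x ^+ n :> CC R.
Proof. by elim: n => // n IHn; rewrite !exprS rcM IHn. Qed.
Lemma rc_eq0 x : (rc x == 0 :> CC R) = (x == 0).
Proof. by rewrite -rc0 (inj_eq rc_inj). Qed.
Lemma rcV x : rc (x^-1) = (rc x)^-1 :> CC R.
Proof.
have [->|x0] := eqVneq x 0; first by rewrite !invr0.
by apply: (mulfI (x := rc x)); rewrite ?rc_eq0 // -rcM !divff // rc_eq0.
Qed.
Lemma ler_rc x y : (rc x <= rc y :> CC R) = (x <= y).
Proof. exact: lecR. Qed.
Lemma ltr_rc x y : (rc x < rc y :> CC R) = (x < y).
Proof. exact: ltcR. Qed.
Lemma rc_gt0 x : (0 < rc x :> CC R) = (0 < x).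
Proof. exact: ltr_rc. Qed.

Lemma CCE z : z = rc (reC z) + ic * rc (imC z).
Proof. by rewrite [LHS]complexE. Qed.
Lemma ComplexE x y : Complex x y = rc x + ic * rc y :> CC R.
Proof. by rewrite [LHS]CCE. Qed.

Lemma reCD z w : reC (z + w) = reC z + reC w. Proof. by case: z w => ? ? [? ?]. Qed.
Lemma imCD z w : imC (z + w) = imC z + imC w. Proof. by case: z w => ? ? [? ?]. Qed.
Lemma reCN z : reC (- z) = - reC z. Proof. by case: z. Qed.
Lemma imCN z : imC (- z) = - imC z. Proof. by case: z. Qed.
Lemma reCB z w : reC (z - w) = reC z - reC w. Proof. by rewrite reCD reCN. Qed.
Lemma imCB z w : imC (z - w) = imC z - imC w. Proof. by rewrite imCD imCN. Qed.
Lemma reCM z w : reC (z * w) = reC z * reC w - imC z * imC w.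
Proof. by case: z w => ? ? [? ?]. Qed.
Lemma imCM z w : imC (z * w) = reC z * imC w + imC z * reC w.
Proof. by case: z w => ? ? [? ?]. Qed.
Lemma CC_eq z w : reC z = reC w -> imC z = imC w -> z = w.
Proof. by case: z w => ? ? [? ?] /= -> ->. Qed.
Lemma ic_neq0 : ic != 0 :> CC R.
Proof. by rewrite eq_complex /= oner_eq0 andbF. Qed.

Lemma cabs_ge0 z : 0 <= cabs z. Proof. exact: sqrtr_ge0. Qed.
Lemma cabs0 : cabs 0 = 0. Proof. by apply: rc_inj; rewrite -normCE normr0. Qed.
Lemma cabs1 : cabs 1 = 1. Proof. by apply: rc_inj; rewrite -normCE normr1. Qed.
Lemma cabs_eq0 z : (cabs z == 0) = (z == 0).
Proof. by rewrite -(inj_eq rc_inj) -normCE normr_eq0. Qed.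
Lemma cabs_gt0 z : (0 < cabs z) = (z != 0).
Proof. by rewrite lt_neqAle cabs_ge0 andbT eq_sym cabs_eq0. Qed.
Lemma cabsM z w : cabs (z * w) = cabs z * cabs w.
Proof. by apply: rc_inj; rewrite rcM -!normCE normrM. Qed.
Lemma cabsN z : cabs (- z) = cabs z.
Proof. by apply: rc_inj; rewrite -!normCE normrN. Qed.
Lemma cabsX z n : cabs (z ^+ n) = cabs z ^+ n.
Proof. by apply: rc_inj; rewrite rcX -!normCE normrX. Qed.
Lemma cabsV z : cabs z^-1 = (cabs z)^-1.
Proof. by apply: rc_inj; rewrite rcV -!normCE normfV. Qed.
Lemma cabsD z w : cabs (z + w) <= cabs z + cabs w.
Proof. by rewrite -ler_rc rcD -!normCE ler_normD. Qed.
Lemma cabsB z w : cabs (z - w) <= cabs z + cabs w.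
Proof. by rewrite -(cabsN w) cabsD. Qed.
Lemma cabsC z w : cabs (z - w) = cabs (w - z).
Proof. by rewrite -cabsN opprB. Qed.
Lemma cabs_rc x : cabs (rc x) = `|x|.
Proof. by rewrite /cabs /= expr0n addr0 sqrtr_sqr. Qed.
Lemma cabs_nat n : cabs (n%:R) = n%:R.
Proof. by rewrite -rc_nat cabs_rc ger0_norm. Qed.
Lemma cabs_ic : cabs ic = 1.
Proof. by rewrite /cabs /= expr0n add0r expr1n sqrtr1. Qed.
Lemma cabs_sum (I : Type) (r : seq I) (P : pred I) (F : I -> CC R) :
  cabs (\sum_(i <- r | P i) F i) <= \sum_(i <- r | P i) cabs (F i).
Proof.
elim/big_rec2: _ => [|i y1 y2 _ h]; first by rewrite cabs0.
by rewrite (le_trans (cabsD _ _)) // lerD2l.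
Qed.
Lemma cabs_distD z w : cabs z - cabs w <= cabs (z + w).
Proof. by rewrite lerBlDr; have := cabsB (z + w) w; rewrite addrK. Qed.
Lemma ler_re_cabs z : `|reC z| <= cabs z.
Proof. by rewrite -sqrtr_sqr ler_sqrt ?addr_ge0 ?sqr_ge0 // lerDl sqr_ge0. Qed.
Lemma ler_im_cabs z : `|imC z| <= cabs z.
Proof. by rewrite -sqrtr_sqr ler_sqrt ?addr_ge0 ?sqr_ge0 // lerDr sqr_ge0. Qed.
Lemma cabs_le_reim z : cabs z <= `|reC z| + `|imC z|.
Proof.
rewrite {1}(CCE z) (le_trans (cabsD _ _)) // cabsM cabs_ic mul1r.
by rewrite !cabs_rc.
Qed.

Lemma gt0_rc (e : CC R) : 0 < e -> e = rc (reC e).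
Proof. case: e => a b; rewrite (@ltcE R) /= => /andP[/eqP b0 _]. by rewrite b0. Qed.

Lemma cvgCP (T : Type) (F : set_system T) {FF : Filter F} (f : T -> CC R) l :
  f @ F --> l <-> forall e : R, 0 < e -> \forall t \near F, cabs (l - f t) < e.
Proof.
split=> [fl e e0|fl].
  have /cvgrPdist_lt/(_ (rc e)) := fl; rewrite rc_gt0 => /(_ e0).
  by apply: filterS => t; rewrite normCE ltr_rc.
apply/cvgrPdist_lt => e e0.
have eE := gt0_rc e0.
move: e0; rewrite eE rc_gt0 => /fl; apply: filterS => t.
by rewrite normCE ltr_rc.
Qed.

Lemma nbhsCP z (A : set (CC R)) :
  nbhs z A <-> exists2 e : R, 0 < e & forall w, cabs (z - w) < e -> A w.
Proof.
split.
  move=> /nbhs_normP[e /= e0 zA].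
  have eE := gt0_rc e0.
  exists (reC e); first by rewrite -rc_gt0 -eE.
  by move=> w we; apply: zA; rewrite /ball_ /= normCE eE ltr_rc.
move=> [e e0 zA]; apply/nbhs_normP; exists (rc e) => /=; first by rewrite rc_gt0.
by move=> w /=; rewrite normCE ltr_rc; exact: zA.
Qed.

Lemma near_cabs z (P : CC R -> Prop) (e : R) : 0 < e ->
  (forall w, cabs (z - w) < e -> P w) -> \forall w \near z, P w.
Proof. by move=> e0 zP; apply/nbhsCP; exists e. Qed.

Lemma continuous_reC : continuous (@reC R).
Proof.
move=> z; apply/(@cvgrPdist_lt _ _ _ (nbhs z)) => e e0.
apply: (near_cabs e0) => w we; apply: le_lt_trans we.
by rewrite -reCB ler_re_cabs.
Qed.
Lemma continuous_imC : continuous (@imC R).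
Proof.
move=> z; apply/(@cvgrPdist_lt _ _ _ (nbhs z)) => e e0.
apply: (near_cabs e0) => w we; apply: le_lt_trans we.
by rewrite -imCB ler_im_cabs.
Qed.
Lemma continuous_cabs : continuous (@cabs).
Proof.
move=> z; apply/(@cvgrPdist_lt _ _ _ (nbhs z)) => e e0.
apply: (near_cabs e0) => w we; apply: le_lt_trans we.
have h1 := cabs_distD w (- z); have h2 := cabs_distD z (- w).
have := cabsC z w; move: h1 h2; rewrite !cabsN ler_norml => h1 h2 h3.
by apply/andP; split; lra.
Qed.

(** Reduces complex differentiability to a real estimate of the first-order
    remainder, the form in which Goursat's lemma uses it and in which it is
    proved for series. *)
Lemma is_deriveCP (f : CC R -> CC R) z (d : CC R) :
  is_derive z 1 f d <->
  forall e : R, 0 < e -> \forall h \near (0 : CC R),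
     cabs (f (z + h) - f z - d * h) <= e * cabs h.
Proof.
have key : (fun h : CC R => h^-1 *: (f (h *: (1:CC R) + z) - f z)) @ 0^' --> d <->
   forall e : R, 0 < e -> \forall h \near (0 : CC R),
     cabs (f (z + h) - f z - d * h) <= e * cabs h.
  split.
    move=> /cvgCP H e e0; have := H e e0.
    rewrite near_withinE; apply: filterS => h hP.
    have [->|h0] := eqVneq h 0.
      by rewrite addr0 subrr mulr0 subr0 cabs0 mulr0.
    have := hP h0; rewrite /= [h *: 1]mulr1 => hlt.
    rewrite -ler_pdivrMr ?cabs_gt0 // -cabsV -cabsM.
    apply: ltW; rewrite cabsC in hlt; apply: le_lt_trans hlt.
    rewrite mulrBl mulfK // [h^-1 *: _]mulrC (addrC z) lexx //.
  move=> H; apply/cvgCP => e e0; have := H (e / 2); rewrite divr_gt0 // => /(_ isT).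
  rewrite near_withinE; apply: filterS => h hP h0.
  rewrite cabsC /= [h *: 1]mulr1.
  have : e / 2 < e by lra.
  apply: le_lt_trans.
  move: hP; rewrite -ler_pdivrMr ?cabs_gt0 // -cabsV -cabsM.
  by rewrite mulrBl mulfK // [h^-1 *: _]mulrC (addrC z).
split=> [[df dE]|H].
  by apply/key; rewrite -dE; exact: df.
have H' := key.2 H; split; last exact: cvg_lim H'.
by apply/cvg_ex; exists d.
Qed.

Lemma is_derive_shiftC (f : CC R -> CC R) z w (d : CC R) :
  is_derive (z + w) 1 f d -> is_derive z 1 (fun t => f (t + w)) d.
Proof.
move=> /is_deriveCP H; apply/is_deriveCP => e e0; near=> h.
by rewrite (addrAC z h w); near: h; exact: H.
Unshelve. all: by end_near. Qed.

Lemma derivable_continuousC (f : CC R -> CC R) z :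
  derivable f z 1 -> {for z, continuous f}.
Proof. by move=> /derivable1_diffP /differentiable_continuous. Qed.

End ComplexBasics.

(** * The complex exponential *)

Section Exponential.
Context {R : realType}.
Implicit Types (z w : CC R) (x y : R).

Lemma expCD z w : expC (z + w) = expC z * expC w.
Proof.
by apply: CC_eq; rewrite /expC !(reCM, imCM) /= reCD imCD expRD cosD sinD; ring.
Qed.

Lemma expC0 : expC 0 = 1 :> CC R.
Proof. by rewrite /expC /= expR0 cos0 sin0 mul1r. Qed.

Lemma expCN_mul z : expC z * expC (- z) = 1.
Proof. by rewrite -expCD subrr expC0. Qed.
Lemma expC_neq0 z : expC z != 0.
Proof.
apply/eqP => e0; have := expCN_mul z; rewrite e0 mul0r => /esym/eqP.
by rewrite oner_eq0.
Qed.
Lemma expCN z : expC (- z) = (expC z)^-1.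
Proof.
by apply: (mulfI (expC_neq0 z)); rewrite expCN_mul divff // expC_neq0.
Qed.
Lemma expCB z w : expC (z - w) = expC z / expC w.
Proof. by rewrite expCD expCN. Qed.
Lemma expCMn z n : expC (n%:R * z) = expC z ^+ n.
Proof.
by elim: n => [|n IHn]; rewrite ?mul0r ?expC0 // exprS -natr1 mulrDl mul1r addrC expCD IHn.
Qed.

Lemma cabs_expC z : cabs (expC z) = expR (reC z).
Proof.
rewrite /expC cabsM cabs_rc ger0_norm ?expR_ge0 //.
by rewrite /cabs /= cos2Dsin2 sqrtr1 mulr1.
Qed.

Lemma sin_le_abs x : `|sin x| <= `|x|.
Proof.
wlog x0 : x / 0 <= x => [H|].
  have [/H //|x0] := leP 0 x.
  by rewrite -normrN -sinN -(normrN x); apply: H; rewrite oppr_ge0 ltW.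
have [c _] := @MVT_segment R sin cos 0 x x0 (fun y _ => is_derive_sin y)
   (continuous_subspaceT (@continuous_sin R)).
rewrite sin0 !subr0 => ->; rewrite normrM ler_piMl // cos_max //.
Qed.

Lemma one_sub_cos_le x : `|1 - cos x| <= `|x| ^+ 2.
Proof.
have cx : cos x = 1 - 2 * sin (x / 2) ^+ 2.
  have -> : cos x = cos ((x / 2) *+ 2) by congr cos; rewrite mulr2n; lra.
  by rewrite cos_mulr2n mulr2n cos2sin2; ring.
rewrite cx opprB addrCA subrr addr0.
have h := sin_le_abs (x / 2); rewrite ger0_norm ?(pmulr_rge0 _ (ltr0n _ 2)) ?sqr_ge0 //.
rewrite -(real_normK (num_real (sin _))).
have -> : `|x| = 2 * `|x / 2| by rewrite normrM [`|2^-1|]ger0_norm; lra.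
have := normr_ge0 (sin (x/2)); nra.
Qed.

Lemma sin_sub_le x : `|sin x - x| <= `|x| ^+ 2.
Proof.
wlog x0 : x / 0 <= x => [H|].
  have [/H //|x0] := leP 0 x.
  have := H (- x); rewrite oppr_ge0 normrN => /(_ (ltW x0)).
  have -> : sin (- x) - - x = - (sin x - x) by rewrite sinN; ring.
  by rewrite normrN.
have dsx (y : R) : is_derive y 1 (fun t => sin t - t) (cos y - 1) by exact: is_deriveB.
have cs : {within `[0, x], continuous (fun t : R => sin t - t)}.
  by apply: continuous_subspaceT => y; apply: differentiable_continuous;
     apply/derivable1_diffP; case: (dsx y).
have [c] := @MVT_segment R (fun t => sin t - t) (fun t => cos t - 1) 0 x x0
   (fun y _ => dsx y) cs.
rewrite in_itv /= => /andP[c0 cx].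
rewrite sin0 !subr0 => ->; rewrite normrM distrC.
have [x1|x1] := leP x 2.
  have h := one_sub_cos_le c.
  have [->|xn0] := eqVneq x 0; first by rewrite normr0 mulr0.
  have hh : `|1 - cos c| <= x.
    have cE : cos c = 1 - 2 * sin (c / 2) ^+ 2.
      have -> : cos c = cos ((c / 2) *+ 2) by congr cos; rewrite mulr2n; lra.
      by rewrite cos_mulr2n mulr2n cos2sin2; ring.
    rewrite cE opprB addrCA subrr addr0.
    have h1 := sin_le_abs (c / 2); rewrite ger0_norm ?(pmulr_rge0 _ (ltr0n _ 2)) ?sqr_ge0 //.
    rewrite -(real_normK (num_real (sin _))).
    have e1 : `|c / 2| = c / 2 by rewrite ger0_norm // divr_ge0.
    rewrite e1 in h1; have := normr_ge0 (sin (c/2)); nra.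
  by rewrite ger0_norm // in hh *; rewrite expr2 ?(ger0_norm x0) ler_pM2r ?lt_def ?xn0 //; rewrite ?ler0_norm //.
rewrite expr2 ler_wpM2r // (ger0_norm x0) (le_trans _ (ltW x1)) //.
rewrite (le_trans (ler_normB _ _)) // normr1; have := cos_max c; lra.
Qed.

Lemma expR_oneB_le1 x : expR x * (1 - x) <= 1.
Proof. by rewrite -[leRHS](expRxMexpNx_1 x) ler_wpM2l ?expR_ge0 // expR_ge1Dx. Qed.

Lemma expR_sub_le x : `|expR x - 1 - x| <= x ^+ 2 * expR `|x|.
Proof.
have h1 := expR_ge1Dx x; rewrite ger0_norm; last by lra.
have h2 := expR_ge1Dx (- x).
have h3 := expR_oneB_le1 x.
have [x0|x0] := leP 0 x.
  rewrite ger0_norm //.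
  have : 0 <= x * (1 - expR x * (1 - x)) by rewrite mulr_ge0 // subr_ge0.
  nra.
rewrite ltr0_norm //.
have e1 : 1 <= expR (- x) by rewrite -expR0 ler_expR; lra.
have : 0 <= x ^+ 2 * (expR (- x) - 1) by rewrite mulr_ge0 ?sqr_ge0 // subr_ge0.
have : 0 <= (- x) * (expR x - (1 + x)) by rewrite mulr_ge0 ?subr_ge0 // oppr_ge0 ltW.
nra.
Qed.

(** In Cartesian coordinates the remainder splits into those of [expR], [cos] and
    [sin], each at most quadratic; the constant 4 collects the four terms. *)
Lemma expC_sub_le z :
  cabs (expC z - 1 - z) <= 4 * cabs z ^+ 2 * expR (cabs z).
Proof.
have [zr zi] := (ler_re_cabs z, ler_im_cabs z).
set r := cabs z in zr zi *; set x := reC z in zr *; set y := imC z in zi *.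
have r0 : 0 <= r by exact: cabs_ge0.
have eE : expC z - 1 - z = rc (expR x - 1 - x) + rc (expR x) * rc (cos y - 1)
     + ic * (rc (expR x - 1) * rc (sin y) + rc (sin y - y)).
  apply: CC_eq; rewrite /expC !(reCM, imCM, reCD, imCD, reCN, imCN) /=; rewrite -/x -/y; ring.
have ex : expR x <= expR r by rewrite ler_expR (le_trans _ zr) // ler_norm.
have e1 : 1 <= expR r by rewrite -expR0 ler_expR.
have ex0 := expR_gt0 x.
have exx : expR `|x| <= expR r by rewrite ler_expR.
have x2 : x ^+ 2 <= r ^+ 2 by rewrite -(real_normK (num_real x)) lerXn2r.
have b1 : `|expR x - 1 - x| <= r ^+ 2 * expR r.
  by rewrite (le_trans (expR_sub_le x)) // ler_pM ?sqr_ge0 ?expR_ge0.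
have y2 : `|y| ^+ 2 <= r ^+ 2 by rewrite lerXn2r.
have b2 : `|cos y - 1| <= r ^+ 2.
  by rewrite distrC (le_trans (one_sub_cos_le y)).
have b3 : `|expR x - 1| <= r * expR r.
  have h1 := expR_ge1Dx x; have h2 := expR_ge1Dx (- x).
  have h3 := expR_oneB_le1 x.
  move: zr; rewrite !ler_norml => /andP[zr1 zr2]; apply/andP; split; nra.
have b4 : `|sin y| <= r by rewrite (le_trans (sin_le_abs y)).
have b5 : `|sin y - y| <= r ^+ 2 by rewrite (le_trans (sin_sub_le y)).
rewrite eE (le_trans (cabsD _ _)) //.
have c1 : cabs (rc (expR x - 1 - x) + rc (expR x) * rc (cos y - 1)) <=
    r ^+ 2 * expR r + expR r * r ^+ 2.
  rewrite (le_trans (cabsD _ _)) // cabsM !cabs_rc lerD // ler_pM //.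
  by rewrite ger0_norm // ltW.
have c2 : cabs (ic * (rc (expR x - 1) * rc (sin y) + rc (sin y - y))) <=
    r * expR r * r + r ^+ 2.
  by rewrite cabsM cabs_ic mul1r (le_trans (cabsD _ _)) // cabsM !cabs_rc lerD // ler_pM.
rewrite (le_trans (lerD c1 c2)) //.
have : r ^+ 2 <= r ^+ 2 * expR r by rewrite ler_peMr ?sqr_ge0.
lra.
Qed.

Lemma near0_cabs (P : CC R -> Prop) (e : R) : 0 < e ->
  (forall w, cabs w < e -> P w) -> \forall w \near (0 : CC R), P w.
Proof. by move=> e0 H; apply: (near_cabs e0) => w; rewrite sub0r cabsN; exact: H. Qed.

(** Avoids an epsilon: the derivatives of exponentials and of series of
    exponentials all come with an explicit quadratic remainder. *)
Lemma is_derive_quad (f : CC R -> CC R) z (d : CC R) (K : R) :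
  (forall h, cabs h <= 1 -> cabs (f (z + h) - f z - d * h) <= K * cabs h ^+ 2) ->
  is_derive z 1 f d.
Proof.
move=> H; apply/is_deriveCP => e e0.
have K1 : 0 < `|K| + 1 by rewrite ltr_wpDl.
apply: (near0_cabs (e := Num.min 1 (e / (`|K| + 1)))).
  by rewrite lt_min ltr01 divr_gt0.
move=> h; rewrite lt_min => /andP[h1 h2].
rewrite (le_trans (H _ (ltW h1))) // expr2 mulrA ler_wpM2r ?cabs_ge0 //.
move: h2; rewrite ltr_pdivlMr // => h2.
have := cabs_ge0 h; have := ler_norm K; nra.
Qed.

Lemma is_derive_expCM (l : CC R) z :
  is_derive z 1 (fun z => expC (l * z)) (l * expC (l * z)).
Proof.
apply: (is_derive_quad (K := cabs (expC (l * z)) * (4 * cabs l ^+ 2 * expR (cabs l)))).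
move=> h h1.
have -> : expC (l * (z + h)) - expC (l * z) - l * expC (l * z) * h =
  expC (l * z) * (expC (l * h) - 1 - l * h) by rewrite mulrDr expCD; ring.
rewrite cabsM -mulrA ler_wpM2l ?cabs_ge0 //.
rewrite (le_trans (expC_sub_le _)) // !cabsM exprMn.
have -> : 4 * (cabs l ^+ 2 * cabs h ^+ 2) * expR (cabs l * cabs h) =
  4 * cabs l ^+ 2 * expR (cabs l * cabs h) * cabs h ^+ 2 by ring.
rewrite ler_wpM2r ?sqr_ge0 // ler_wpM2l //.
  by rewrite mulr_ge0 ?sqr_ge0.
by rewrite ler_expR ler_piMr ?cabs_ge0.
Qed.

Lemma cos_eq1_int x : cos x = 1 -> exists k : int, x = pi * 2 * k%:~R.
Proof.
move=> cx; pose k := Num.floor (x / (pi * 2)).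
have pi0 := pi_gt0 R.
have pi20 : 0 < pi * 2 :> R by rewrite mulr_gt0.
have per (n : int) : cos (x - pi * 2 * n%:~R) = cos x.
  have pos (m : nat) (t : R) : cos (t + pi * 2 * m%:R) = cos t.
    have -> : t + pi * 2 * m%:R = t + (pi *+ 2) *+ m.
      by rewrite -[in RHS]mulr_natr -[pi *+ 2]mulr_natr.
    exact: (periodicn (@cosD2pi R)).
  case: n => m; first by rewrite -(pos m) subrK.
  by rewrite NegzE mulrNz mulrN opprK pos.
(* after reduction to one period, cos r = 1 means sin (r / 2) = 0 *)
exists k; pose r := x - pi * 2 * k%:~R.
have cr : cos r = 1 by rewrite per.
have [r0 r1] : 0 <= r /\ r < pi * 2.
  have := Num.Theory.floor_itv (x / (pi * 2)); rewrite -/k => /andP[k1 k2].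
  rewrite ler_pdivlMr // in k1; rewrite ltr_pdivrMr // intrD in k2.
  by rewrite /r; split; lra.
suff : r = 0 by move/eqP; rewrite subr_eq0 => /eqP.
have cE : cos r = 1 - 2 * sin (r / 2) ^+ 2.
  have -> : cos r = cos ((r / 2) *+ 2) by congr cos; rewrite mulr2n; lra.
  by rewrite cos_mulr2n mulr2n cos2sin2; ring.
apply/eqP; rewrite eq_le r0 andbT leNgt; apply/negP => rp.
have : 0 < sin (r / 2) by apply: sin_gt0_pi; apply/andP; split; lra.
by move=> s0; move: cE; rewrite cr; nra.
Qed.

(** The modulus [expR (reC z)] forces the real part to vanish; the kernel of [cos]
    then locates the imaginary part. It is the only source of lattice points
    among the zeros of theta. *)
Lemma expC_eq1 z : expC z = 1 -> exists k : int, z = 2 * pic * ic * k%:~R.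
Proof.
move=> ez.
have : cabs (expC z) = 1 by rewrite ez cabs1.
rewrite cabs_expC -{1}(@expR0 R) => /expR_inj rz.
move: ez; rewrite /expC rz expR0 mul1r => -[/cos_eq1_int[k kE] _].
exists k; rewrite (CCE z) rz kE add0r !rcM rc_nat.
have -> : rc k%:~R = k%:~R :> CC R.
  by case: k {kE} => m; rewrite ?NegzE ?mulrNz ?rcN rc_nat.
by rewrite /pic; ring.
Qed.

Lemma expC_int (k : int) : expC (2 * pic * ic * k%:~R) = 1 :> CC R.
Proof.
have nat (m : nat) : expC (m%:R * (2 * pic * ic)) = 1 :> CC R.
  have -> : 2 * pic * ic = ic * rc (pi *+ 2) :> CC R.
    by rewrite mulr2n rcD /pic; ring.
  have -> : ic * rc (pi *+ 2) = Complex 0 (pi *+ 2) :> CC R.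
    by rewrite ComplexE rc0 add0r.
  by rewrite expCMn /expC expR0 cos2pi sin2pi mul1r expr1n.
case: k => m; first by rewrite mulrC nat.
by rewrite NegzE mulrNz mulrN expCN mulrC nat invr1.
Qed.

End Exponential.

(** * Integrals of continuous functions *)

Section RealIntegral.
Context {R : realType}.
Implicit Types (f g F G : R -> R) (a b c x y : R).

Lemma is_derive_continuous f (df : R -> R) :
  (forall x, is_derive x 1 f (df x)) -> continuous f.
Proof.
by move=> H x; apply: differentiable_continuous; apply/derivable1_diffP; case: (H x).
Qed.

Lemma is_derive_within_continuous f (df : R -> R) a b :
  (forall x, a <= x -> x <= b -> is_derive x 1 f (df x)) -> {within `[a, b], continuous f}.
Proof.
move=> H; apply: derivable_within_continuous => x; rewrite in_itv => /andP[h1 h2].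
by case: (H x).
Qed.

Lemma same_derive_sub F G f (A : R) x y :
  (forall t : R, A < t -> is_derive t 1 F (f t)) ->
  (forall t : R, A < t -> is_derive t 1 G (f t)) -> A < x -> A < y ->
  F y - F x = G y - G x.
Proof.
move=> dF dG; wlog xy : x y / x <= y => [H Ax Ay|Ax Ay].
  have [/H|/ltW/H] := leP x y; first exact.
  by move=> /(_ Ay Ax) e; rewrite -opprB e opprB.
have dFG t : A < t -> is_derive t 1 (F - G) 0.
  by move=> At; rewrite -(subrr (f t)); apply: is_deriveB; [exact: dF|exact: dG].
have := @MVT_segment R (F - G) (fun=> 0) x y xy.
case.
- by move=> t; rewrite in_itv /= => /andP[xt _]; apply: dFG; exact: lt_trans xt.
- apply: (@is_derive_within_continuous _ (fun=> 0)) => t xt _.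
  by apply: dFG; exact: lt_le_trans xt.
by move=> c _; rewrite mul0r /= !fctE => /eqP; rewrite subr_eq0 => /eqP; lra.
Qed.

(** The integral from a fixed base point is an antiderivative only to the right of
    that point, so the base point moves with the argument; subtracting the value
    at 0 makes the choices agree. *)
Lemma continuous_primitive f : continuous f ->
  exists F, forall x, is_derive x 1 F (f x).
Proof.
move=> cf.
pose P (A x : R) : R := \int[lebesgue_measure]_(t in `[A, x]) f t.
have dP A x : A < x -> is_derive x 1 (P A) (f x).
  move=> Ax.
  have i : (lebesgue_measure : measure _ _).-integrable `[A, x + 1] (EFin \o f).
    apply: continuous_compact_integrable; first exact: segment_compact.
    exact: continuous_subspaceT.
  have xx1 : x < x + 1 by rewrite ltrDl.
  have [d1 d2] := continuous_FTC1_closed xx1 i Ax (cf x).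
  split; first exact: d1.
  by rewrite -d2 derive1E.
pose N (x : R) := - (`|x| + 1).
exists (fun x => P (N x) x - P (N x) 0) => x.
pose A := - (`|x| + 2).
have A0 : A < 0 by rewrite oppr_lt0 ltr_wpDl.
apply: (@near_eq_is_derive _ _ _ (fun y => P A y - P A 0)).
  have : \forall y \near x, `|y - x| < 1.
    by apply/nbhs_normP; exists 1 => //= y; rewrite distrC.
  apply: filterS => y yx.
  have yn : `|y| < `|x| + 1.
    have := ler_normD (y - x) x; rewrite subrK; lra.
  have AN : A < N y by rewrite /A /N; lra.
  apply: (@same_derive_sub (P A) (P (N y)) f (N y)).
  - by move=> t Nt; apply: dP; exact: lt_trans Nt.
  - by rewrite /N oppr_lt0 ltr_wpDl.
  - by rewrite /N; have := lerNnormlW (lexx `|y|); lra.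
rewrite -[f x]subr0; apply: is_deriveB.
by apply: dP; rewrite /A; have := lerNnormlW (lexx `|x|); lra.
Qed.

(** A chosen antiderivative; integrals are its differences, so that splitting an
    interval is trivial and every estimate is the mean value theorem. *)
Definition rprim f : R -> R :=
  xget f [set F | forall x, is_derive x 1 F (f x)].

Lemma is_derive_rprim f x : continuous f -> is_derive x 1 (rprim f) (f x).
Proof.
move=> /continuous_primitive[F dF].
exact: (@xgetI _ f [set F | forall x, is_derive x 1 F (f x)] F dF x).
Qed.

Definition rint a b f := rprim f b - rprim f a.

Lemma rintE F f a b : (forall x, is_derive x 1 F (f x)) -> continuous f ->
  rint a b f = F b - F a.
Proof.
move=> dF cf; apply: (@same_derive_sub _ _ f (Num.min a b - 1)).
- by move=> t _; exact: is_derive_rprim.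
- by rewrite ltrBlDr ltr_pwDr // ge_min lexx.
- by rewrite ltrBlDr ltr_pwDr // ge_min lexx orbT.
Qed.

Lemma rint_split c a b f : rint a b f = rint a c f + rint c b f.
Proof. by rewrite /rint; ring. Qed.

Lemma rintD a b f g : continuous f -> continuous g ->
  rint a b (fun x => f x + g x) = rint a b f + rint a b g.
Proof.
move=> cf cg.
have dfg x : is_derive x 1 (rprim f + rprim g) (f x + g x).
  by apply: is_deriveD; exact: is_derive_rprim.
rewrite (rintE _ _ dfg) /rint /= ?fctE; first by ring.
by move=> x; apply: continuousD; [exact: cf|exact: cg].
Qed.

Lemma rintZ a b k f : continuous f -> rint a b (fun x => k * f x) = k * rint a b f.
Proof.
move=> cf.
have dkf x : is_derive x 1 (k \*: rprim f) (k * f x).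
  by apply: is_deriveZ; exact: is_derive_rprim.
rewrite (rintE _ _ dkf) /rint /= ?mulrBr //.
by move=> x; apply: continuousM; [exact: cst_continuous|exact: cf].
Qed.

Lemma rint_cst a b k : rint a b (fun=> k) = k * (b - a).
Proof.
have dk (x : R) : is_derive x 1 (k \*: (@id R)) k.
  by rewrite -[X in is_derive _ _ _ X](mulr1 k); exact: is_deriveZ.
rewrite (rintE _ _ dk) /= ?mulrBr // => x; exact: cst_continuous.
Qed.

Lemma rint_ge0 a b f : continuous f -> a <= b ->
  (forall x, a <= x -> x <= b -> 0 <= f x) -> 0 <= rint a b f.
Proof.
move=> cf ab f0; have df x := is_derive_rprim x cf.
have := @MVT_segment R (rprim f) f a b ab (fun x _ => df x).
case; first by apply: (@is_derive_within_continuous _ f).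
move=> c; rewrite in_itv /= => /andP[ac cb].
by rewrite /rint => ->; rewrite mulr_ge0 ?subr_ge0 // f0.
Qed.

Lemma continuous_addf f g : continuous f -> continuous g -> continuous (fun x => f x + g x).
Proof. by move=> cf cg x; apply: continuousD; [exact: cf|exact: cg]. Qed.

Lemma continuous_scalef (k : R) f : continuous f -> continuous (fun x => k * f x).
Proof. by move=> cf x; apply: continuousM; [exact: cst_continuous|exact: cf]. Qed.

Lemma rint_le a b f g : continuous f -> continuous g -> a <= b ->
  (forall x, a <= x -> x <= b -> f x <= g x) -> rint a b f <= rint a b g.
Proof.
move=> cf cg ab fg; rewrite -subr_ge0.
have cNf := continuous_scalef (k := -1) cf.
have -> : rint a b g - rint a b f = rint a b (fun x => g x + (-1) * f x).
  by rewrite rintD // rintZ // mulN1r.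
apply: rint_ge0 => // [|x ax xb]; last by rewrite mulN1r subr_ge0 fg.
exact: continuous_addf.
Qed.

Lemma rint_abs_le a b f g : continuous f -> continuous g -> a <= b ->
  (forall x, a <= x -> x <= b -> `|f x| <= g x) -> `|rint a b f| <= rint a b g.
Proof.
move=> cf cg ab fg; rewrite ler_norml; apply/andP; split.
  rewrite lerNl -mulN1r -rintZ // rint_le //; first exact: continuous_scalef.
  by move=> x ax xb; have := fg x ax xb; rewrite ler_norml => /andP[]; lra.
by rewrite rint_le // => x ax xb; have := fg x ax xb; rewrite ler_norml => /andP[].
Qed.

Lemma is_derive_rprim_shift (c : R) f x : continuous f ->
  is_derive x 1 (fun t => rprim f (t + c)) (f (x + c)).
Proof.
move=> cf; have h1 : is_derive x 1 (fun t : R => t + c) 1.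
  by rewrite -[X in is_derive _ _ _ X]addr0; apply: is_deriveD.
have h2 : is_derive (x + c) 1 (rprim f) (f (x + c)) by exact: is_derive_rprim.
have := is_derive1_comp (g := fun t : R => t + c) h2 h1.
by rewrite mulr1.
Qed.

Lemma rint_shift (c a b : R) f : continuous f ->
  rint a b (fun x => f (x + c)) = rint (a + c) (b + c) f.
Proof.
move=> cf; have d1 x := is_derive_rprim_shift c x cf.
apply: (rintE _ _ d1) => x; apply: continuous_comp; last exact: cf.
by apply: continuousD; [exact: cvg_id|exact: cst_continuous].
Qed.

End RealIntegral.

Section ComplexIntegral.
Context {R : realType}.
Implicit Types (p q : R -> CC R) (a b c x y : R).

Definition cint a b p : CC R :=
  Complex (rint a b (fun x => reC (p x))) (rint a b (fun x => imC (p x))).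

Lemma continuous_re_path p : continuous p -> continuous (fun x => reC (p x)).
Proof.
by move=> cp x; apply: continuous_comp; [exact: cp|exact: continuous_reC].
Qed.
Lemma continuous_im_path p : continuous p -> continuous (fun x => imC (p x)).
Proof.
by move=> cp x; apply: continuous_comp; [exact: cp|exact: continuous_imC].
Qed.

Lemma continuous_path p :
  continuous (fun x => reC (p x)) -> continuous (fun x => imC (p x)) -> continuous p.
Proof.
move=> c1 c2 x; apply/(@cvgCP _ _ (nbhs x)) => e e0.
have e2 : 0 < e / 2 by rewrite divr_gt0.
have h1 := (@cvgrPdist_lt _ _ _ (nbhs x) _ _ _).1 (c1 x) _ e2.
have h2 := (@cvgrPdist_lt _ _ _ (nbhs x) _ _ _).1 (c2 x) _ e2.
near=> y; apply: le_lt_trans (cabs_le_reim _) _.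
rewrite reCB imCB [ltRHS]splitr ltrD //.
- by near: y; exact: h1.
- by near: y; exact: h2.
Unshelve. all: by end_near. Qed.

Lemma cint_split c a b p : cint a b p = cint a c p + cint c b p.
Proof. by rewrite /cint !(rint_split c a b). Qed.

Lemma cintD a b p q : continuous p -> continuous q ->
  cint a b (fun x => p x + q x) = cint a b p + cint a b q.
Proof.
move=> cp cq; rewrite /cint.
have -> : (fun x => reC (p x + q x)) = (fun x => reC (p x) + reC (q x)).
  by apply/funext => x; rewrite reCD.
have -> : (fun x => imC (p x + q x)) = (fun x => imC (p x) + imC (q x)).
  by apply/funext => x; rewrite imCD.
by rewrite !rintD //; (exact: continuous_re_path || exact: continuous_im_path).
Qed.

Lemma cintZ a b (k : CC R) p : continuous p -> cint a b (fun x => k * p x) = k * cint a b p.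
Proof.
move=> cp; have c1 := continuous_re_path cp; have c2 := continuous_im_path cp.
have cM (l : R) (f : R -> R) : continuous f -> continuous (fun x => l * f x).
  by move=> cf x; apply: continuousM; [exact: cst_continuous|exact: cf].
apply: CC_eq; rewrite ?reCM ?imCM /=.
  have -> : (fun x => reC (k * p x)) = (fun x => reC k * reC (p x) + (- imC k) * imC (p x)).
    by apply/funext => x; rewrite reCM mulNr.
  by rewrite rintD ?rintZ ?mulNr //; exact: cM.
have -> : (fun x => imC (k * p x)) = (fun x => reC k * imC (p x) + imC k * reC (p x)).
  by apply/funext => x; rewrite imCM.
by rewrite rintD ?rintZ //; exact: cM.
Qed.

(** The factor 2 comes from treating real and imaginary parts separately; it is
    harmless in all the limits below. *)
Lemma cint_abs_le a b p (g : R -> R) : continuous p -> continuous g -> a <= b ->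
  (forall x, a <= x -> x <= b -> cabs (p x) <= g x) ->
  cabs (cint a b p) <= 2 * rint a b g.
Proof.
move=> cp cg ab pg; apply: le_trans (cabs_le_reim _) _.
rewrite mulr2n mulrDl mul1r /= lerD // rint_abs_le //.
- exact: continuous_re_path.
- by move=> x ax xb; rewrite (le_trans (ler_re_cabs _)) // pg.
- exact: continuous_im_path.
- by move=> x ax xb; rewrite (le_trans (ler_im_cabs _)) // pg.
Qed.

Lemma cint_bound a b p (M : R) : continuous p -> a <= b ->
  (forall x, a <= x -> x <= b -> cabs (p x) <= M) ->
  cabs (cint a b p) <= 2 * (M * (b - a)).
Proof.
move=> cp ab pM; rewrite -rint_cst; apply: cint_abs_le => //.
by move=> x; exact: cst_continuous.
Qed.

Lemma continuous_hline (F : CC R -> CC R) y : continuous F ->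
  continuous (fun x => F (Complex x y)).
Proof.
move=> cF x; apply: (@continuous_comp _ _ _ (fun x => Complex x y : CC R) F);
  last exact: cF.
move: x; apply: continuous_path => x /=; [exact: cvg_id|exact: cst_continuous].
Qed.
Lemma continuous_vline (F : CC R -> CC R) x : continuous F ->
  continuous (fun y => F (Complex x y)).
Proof.
move=> cF y; apply: (@continuous_comp _ _ _ (fun y => Complex x y : CC R) F);
  last exact: cF.
move: y; apply: continuous_path => y /=; [exact: cst_continuous|exact: cvg_id].
Qed.

End ComplexIntegral.

(** * Goursat's lemma and means over a period *)

Section Goursat.
Context {R : realType}.
Implicit Types (F K : CC R -> CC R) (a b c d m x y : R).

Definition hint F y a b : CC R := cint a b (fun x => F (Complex x y)).
Definition vint F x c d : CC R := cint c d (fun y => F (Complex x y)).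

(** The integral over the positively oriented boundary of [a, b] x [c, d]. *)
Definition rect F a b c d : CC R :=
  hint F c a b + ic * vint F b c d - hint F d a b - ic * vint F a c d.

Lemma rect_hsplit F m a b c d : rect F a b c d = rect F a m c d + rect F m b c d.
Proof. by rewrite /rect /hint !(cint_split m a b); ring. Qed.

Lemma rect_vsplit F m a b c d : rect F a b c d = rect F a b c m + rect F a b m d.
Proof. by rewrite /rect /vint !(cint_split m c d); ring. Qed.

Lemma rectD F K a b c d : continuous F -> continuous K ->
  rect (fun z => F z + K z) a b c d = rect F a b c d + rect K a b c d.
Proof.
move=> cF cK; rewrite /rect /hint /vint.
by rewrite !cintD; do ?[exact: continuous_hline | exact: continuous_vline]; ring.
Qed.

Lemma rect_bound F a b c d M : continuous F -> a <= b -> c <= d ->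
  (forall x y, a <= x -> x <= b -> c <= y -> y <= d -> cabs (F (Complex x y)) <= M) ->
  cabs (rect F a b c d) <= 4 * M * ((b - a) + (d - c)).
Proof.
move=> cF ab cd FM; rewrite /rect.
have hb y : c <= y -> y <= d -> cabs (hint F y a b) <= 2 * (M * (b - a)).
  by move=> cy yd; apply: cint_bound => //; [exact: continuous_hline|move=> x ax xb; exact: FM].
have vb x : a <= x -> x <= b -> cabs (ic * vint F x c d) <= 2 * (M * (d - c)).
  move=> ax xb; rewrite cabsM cabs_ic mul1r.
  by apply: cint_bound => //; [exact: continuous_vline|move=> y cy yd; exact: FM].
have h1 := hb c (lexx c) cd; have h2 := hb d cd (lexx d).
have h3 := vb a (lexx a) ab; have h4 := vb b ab (lexx b).
apply: le_trans (cabsB _ _) _; apply: le_trans (lerD (cabsB _ _) (lexx _)) _.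
apply: le_trans (lerD (lerD (cabsD _ _) (lexx _)) (lexx _)) _.
lra.
Qed.

Lemma continuous_affineC (al be : CC R) : continuous (fun z : CC R => al + be * z).
Proof.
move=> z; apply: continuousD; first exact: cst_continuous.
by apply: continuousM; [exact: cst_continuous|exact: cvg_id].
Qed.

Lemma rint_affine a b (al be : R) :
  rint a b (fun x => al + be * x) = al * (b - a) + be * ((b ^+ 2 - a ^+ 2) / 2).
Proof.
have d1 (x : R) : is_derive x 1 (fun x => al * x + (be / 2) * (x * x)) (al + be * x).
  have h1 : is_derive x 1 (fun x : R => al * x) (al *: 1) by exact: is_deriveZ.
  have h2 : is_derive x 1 (fun x : R => x * x) (x *: 1 + x *: 1) by exact: is_deriveM.
  have h3 : is_derive x 1 (fun x : R => be / 2 * (x * x)) ((be / 2) *: (x *: 1 + x *: 1)).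
    exact: is_deriveZ.
  have -> : al + be * x = al *: 1 + (be / 2) *: (x *: 1 + x *: 1).
    have sE (u t : R) : u *: t = u * t by [].
    by rewrite !sE; field.
  exact: is_deriveD.
rewrite (rintE _ _ d1); first by field.
apply: continuous_addf; first by move=> x; exact: cst_continuous.
by apply: continuous_scalef => x; exact: cvg_id.
Qed.

Lemma cint_affine a b (p : R -> CC R) (al be : CC R) :
  (forall x, p x = al + be * rc x) ->
  cint a b p = al * rc (b - a) + be * rc ((b ^+ 2 - a ^+ 2) / 2).
Proof.
move=> pE; rewrite /cint.
have -> : (fun x => reC (p x)) = (fun x => reC al + reC be * x).
  by apply/funext => x; rewrite pE reCD reCM /=; ring.
have -> : (fun x => imC (p x)) = (fun x => imC al + imC be * x).
  by apply/funext => x; rewrite pE imCD imCM /=; ring.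
by rewrite !rint_affine; apply: CC_eq; rewrite !(reCD, imCD, reCM, imCM) /=; ring.
Qed.

Lemma rect_affine (al be : CC R) a b c d : rect (fun z => al + be * z) a b c d = 0.
Proof.
have h y : hint (fun z => al + be * z) y a b =
    (al + be * (ic * rc y)) * rc (b - a) + be * rc ((b ^+ 2 - a ^+ 2) / 2).
  by apply: cint_affine => x; rewrite ComplexE; ring.
have v x : vint (fun z => al + be * z) x c d =
    (al + be * rc x) * rc (d - c) + (be * ic) * rc ((d ^+ 2 - c ^+ 2) / 2).
  by apply: cint_affine => y; rewrite ComplexE; ring.
rewrite /rect !h !v !rcM !rcB !rcX.
have -> : ic * ((al + be * rc b) * (rc d - rc c) +
   be * ic * ((rc d ^+ 2 - rc c ^+ 2) * rc 2^-1)) =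
   ic * ((al + be * rc b) * (rc d - rc c)) +
   be * (ic * ic) * ((rc d ^+ 2 - rc c ^+ 2) * rc 2^-1) by ring.
by ring.
Qed.

(** Near a point the function is affine up to [o (z - p)], and affine functions
    have antiderivatives, so the integral over a small rectangle around [p] is
    negligible against the square of its size. *)
Lemma rect_local F (p : CC R) (e : R) : continuous F -> derivable F p 1 -> 0 < e ->
  exists2 dl : R, 0 < dl & forall a b c d, a <= reC p -> reC p <= b ->
    c <= imC p -> imC p <= d -> (b - a) + (d - c) < dl ->
    cabs (rect F a b c d) <= e * ((b - a) + (d - c)) ^+ 2.
Proof.
move=> cF dF e0.
have /is_deriveCP/(_ (e / 4)) := derivableP dF.
rewrite divr_gt0 // => /(_ isT) /nbhsCP[dl dl0 H].
exists dl => // a b c d ap pb cp pd small.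
set L := (b - a) + (d - c) in small *.
set D := 'D_1 F p in H.
have [A [cA rA AE]] : exists A, [/\ continuous A, rect A a b c d = 0 &
    forall z, F z + (-1) * A z = F z - F p - D * (z - p)].
  exists (fun z => (F p - D * p) + D * z); split.
  - exact: continuous_affineC.
  - exact: rect_affine.
  - by move=> z; ring.
have [K cK KE] : exists2 K, continuous K & forall z, K z = F z + (-1) * A z.
  exists (fun z => F z + (-1) * A z); last by move=> z; reflexivity.
  move=> z.
  apply: (@continuousD _ _ _ F (fun z => -1 * A z)); first exact: cF.
  by apply: continuousM; [exact: cst_continuous|exact: cA].
have -> : F = (fun z => A z + K z).
  by apply/funext => z; rewrite KE; ring.
rewrite (rectD _ _ _ _ cA cK) rA add0r.
have bK : cabs (rect K a b c d) <= 4 * (e / 4 * L) * L.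
  apply: rect_bound => //; [lra|lra|] => x y ax xb cy yd.
  set z := Complex x y.
  have zp : cabs (z - p) <= L.
    apply: le_trans (cabs_le_reim _) _; rewrite reCB imCB /=.
    by rewrite lerD // ler_norml; apply/andP; split; lra.
  have := H (z - p); rewrite sub0r cabsN => /(_ (le_lt_trans zp small)).
  rewrite (addrC p) subrK => h.
  rewrite KE AE.
  by apply: le_trans h _; rewrite ler_wpM2l // divr_ge0 // ltW.
by have -> : e * L ^+ 2 = 4 * (e / 4 * L) * L by field.
Qed.

Section Bisection.
Variables (F : CC R -> CC R) (a0 c0 w h : R).
Hypotheses (w0 : 0 <= w) (h0 : 0 <= h).

Let sz (s : R) (n : nat) := s / 2 ^+ n.

Let szS s n : sz s n = sz s n.+1 + sz s n.+1.
Proof. by rewrite /sz exprS; field; rewrite expf_neq0. Qed.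

Let sz_ge0 s n : 0 <= s -> 0 <= sz s n.
Proof. by move=> s0; rewrite /sz divr_ge0 // exprn_ge0. Qed.

Let area (n : nat) (q : R * R) :=
  rect F q.1 (q.1 + sz w n) q.2 (q.2 + sz h n).

(* lower left corner of a quarter that carries at least a quarter of the integral *)
Let step (n : nat) (q : R * R) : R * R :=
  let e := cabs (area n q) / 4 in
  let q1 := (q.1, q.2 + sz h n.+1) in
  let q2 := (q.1 + sz w n.+1, q.2) in
  let q3 := (q.1 + sz w n.+1, q.2 + sz h n.+1) in
  if e <= cabs (area n.+1 q) then q else
  if e <= cabs (area n.+1 q1) then q1 else
  if e <= cabs (area n.+1 q2) then q2 else q3.

Let stepP n q : cabs (area n q) / 4 <= cabs (area n.+1 (step n q)).
Proof.
rewrite /step; case: ifPn => // n0; case: ifPn => // n1; case: ifPn => // n2.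
move: n0 n1 n2; rewrite -!ltNge => n0 n1 n2; rewrite leNgt; apply/negP => n3.
have : cabs (area n q) <= cabs (area n.+1 q) +
  cabs (area n.+1 (q.1, q.2 + sz h n.+1)) +
  cabs (area n.+1 (q.1 + sz w n.+1, q.2)) +
  cabs (area n.+1 (q.1 + sz w n.+1, q.2 + sz h n.+1)).
  rewrite /area /= (szS w n) (szS h n) !addrA.
  set u := sz w n.+1; set v := sz h n.+1.
  rewrite (rect_hsplit F (q.1 + u) q.1).
  rewrite (rect_vsplit F (q.2 + v) q.1) (rect_vsplit F (q.2 + v) (q.1 + u)).
  apply: le_trans (cabsD _ _) _; apply: le_trans (lerD (cabsD _ _) (cabsD _ _)) _.
  by rewrite [leLHS]addrA.
by rewrite leNgt => /negP; apply; lra.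
Qed.

Let stepb n q : [/\ q.1 <= (step n q).1, (step n q).1 + sz w n.+1 <= q.1 + sz w n,
   q.2 <= (step n q).2 & (step n q).2 + sz h n.+1 <= q.2 + sz h n].
Proof.
have := sz_ge0 n.+1 w0; have := sz_ge0 n.+1 h0.
have := szS w n; have := szS h n.
by rewrite /step => *; do 3?[case: ifP => _]; split => /=; lra.
Qed.

Let q (n : nat) : R * R := (fix f n := if n is k.+1 then step k (f k) else (a0, c0)) n.

(** Halving repeatedly, one quarter always carries at least a quarter of the
    integral; the corners increase and stay bounded, and their suprema give a point
    common to all the nested rectangles. *)
Lemma bisection_point : exists p : R * R, forall n, exists a c,
  [/\ a <= p.1 <= a + w / 2 ^+ n, c <= p.2 <= c + h / 2 ^+ n &
   cabs (rect F a0 (a0 + w) c0 (c0 + h)) / 4 ^+ n <=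
   cabs (rect F a (a + w / 2 ^+ n) c (c + h / 2 ^+ n))].
Proof.
have nested (f : nat -> R) (s : R) : 0 <= s -> (forall n, f n <= f n.+1) ->
    (forall n, f n.+1 + sz s n.+1 <= f n + sz s n) ->
    exists t, forall n, f n <= t <= f n + sz s n.
  move=> s0 f1 f2.
  have up (m n : nat) : (m <= n)%N -> f m <= f n.
    by move=> /subnK <-; elim: (n - m)%N => [|k IH] //=; rewrite addSn (le_trans IH).
  have dn (m n : nat) : (m <= n)%N -> f n + sz s n <= f m + sz s m.
    by move=> /subnK <-; elim: (n - m)%N => [|k IH] //=; rewrite addSn (le_trans (f2 _)).
  have all (m n : nat) : f m <= f n + sz s n.
    have [mn|/ltnW nm] := leqP m n.
      by rewrite (le_trans (up _ _ mn)) // lerDl sz_ge0.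
    by apply: le_trans (dn _ _ nm); rewrite lerDl sz_ge0.
  exists (sup (range f)) => n; apply/andP; split.
    apply: sup_upper_bound; last by exists n.
    split; first by exists (f 0%N), 0%N.
    by exists (f 0%N + sz s 0) => _ [m _ <-].
  by apply: ge_sup; [exists (f 0%N), 0%N|move=> _ [m _ <-]].
have [x xP] : exists x, forall n, (q n).1 <= x <= (q n).1 + sz w n.
  by apply: nested => // n; have [] := stepb n (q n).
have [y yP] : exists y, forall n, (q n).2 <= y <= (q n).2 + sz h n.
  by apply: nested => // n; have [] := stepb n (q n).
exists (x, y) => n; exists (q n).1, (q n).2; split; [exact: xP|exact: yP|].
rewrite -/(area n (q n)).
elim: n => [|n IH].
  by rewrite expr0 divr1 /area /= /sz expr0 !divr1.
apply: le_trans (stepP n (q n)); rewrite exprSr invfM mulrA.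
by rewrite ler_wpM2r.
Qed.

End Bisection.

(** At depth [n] the integral is at least [4^-n] times the original one, but by
    differentiability at the common point it is at most [e * 4^-n]. Bisection
    replaces differentiation under the integral sign because the derivative of a
    solution is not known to be continuous. *)
Lemma goursat F a b c d : (forall z, derivable F z 1) -> a <= b -> c <= d ->
  rect F a b c d = 0.
Proof.
move=> dF ab cd.
have cF : continuous F by move=> z; exact: derivable_continuousC.
have w0 : 0 <= b - a by rewrite subr_ge0.
have h0 : 0 <= d - c by rewrite subr_ge0.
have [[x y] P] := bisection_point F a c w0 h0.
move: P; rewrite ![_ + (_ - _)]addrC !subrK => P.
set L := (b - a) + (d - c); have L0 : 0 <= L by exact: addr_ge0.
apply/eqP; rewrite -cabs_eq0 eq_le cabs_ge0 andbT; apply/ler_addgt0Pr => e e0.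
rewrite add0r.
have e1 : 0 < e / (L ^+ 2 + 1) by rewrite divr_gt0 // ltr_wpDl ?sqr_ge0.
have [dl dl0 H] := rect_local (p := Complex x y) cF (dF _) e1.
have [n nP] : exists n : nat, L / 2 ^+ n < dl.
  exists (Num.truncn (L / dl)).
  rewrite ltr_pdivrMr ?exprn_gt0 // mulrC -ltr_pdivrMr //.
  apply: lt_le_trans (truncnS_gt _) _.
  by rewrite -natrX ler_nat; exact: ltn_expl.
have [u [v [/andP[ux xu] /andP[vy yv] big]]] := P n.
have szE : (u + (b - a) / 2 ^+ n - u) + (v + (d - c) / 2 ^+ n - v) = L / 2 ^+ n.
  by rewrite /L; ring.
have := H _ _ _ _ ux xu vy yv; rewrite szE => /(_ nP) => small.
have := le_trans big small; rewrite ler_pdivrMr ?exprn_gt0 //.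
move=> /le_trans; apply.
have -> : e / (L ^+ 2 + 1) * (L / 2 ^+ n) ^+ 2 * 4 ^+ n = e / (L ^+ 2 + 1) * L ^+ 2.
  have e4 : 4 ^+ n = (2 ^+ n) ^+ 2 :> R.
    by rewrite -exprM mulnC exprM; congr (_ ^+ n); rewrite expr2; lra.
  have X0 : (2 : R) ^+ n != 0 by rewrite expf_neq0.
  have L1 : L ^+ 2 + 1 != 0 by rewrite gt_eqF // ltr_wpDl ?sqr_ge0.
  by rewrite e4; field; rewrite X0 L1.
rewrite mulrAC ler_pdivrMr ?ltr_wpDl ?sqr_ge0 // ler_wpM2l ?lerDl //.
exact: ltW.
Qed.

(** Moving the period vertically changes the integral by the boundary of a
    rectangle whose vertical sides cancel by periodicity; moving it horizontally
    changes nothing since the integrand is periodic. *)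
Lemma period_mean_const F y a y' a' : (forall z, derivable F z 1) ->
  (forall z, F (z + 1) = F z) -> hint F y a (a + 1) = hint F y' a' (a' + 1).
Proof.
move=> dF perF.
have cF : continuous F by move=> z; exact: derivable_continuousC.
have vert : forall t t', t <= t' -> hint F t a (a + 1) = hint F t' a (a + 1).
  move=> t t' tt'; have := goursat (a := a) (b := a + 1) dF _ tt'.
  rewrite lerDl ler01 => /(_ isT); rewrite /rect.
  have -> : vint F (a + 1) t t' = vint F a t t'.
    congr (cint _ _ _); apply/funext => u.
    have -> : Complex (a + 1) u = Complex a u + 1 :> CC R.
      by apply: CC_eq; rewrite ?reCD ?imCD /= ?addr0.
    exact: perF.
  by move=> e; apply/eqP; rewrite -subr_eq0 -[X in _ == X]e; apply/eqP; ring.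
have -> : hint F y a (a + 1) = hint F y' a (a + 1).
  by have [/vert|/ltW/vert] := leP y y'.
have hor (f : R -> R) : continuous f -> (forall x, f (x + 1) = f x) ->
    rint a (a + 1) f = rint a' (a' + 1) f.
  move=> cf perf.
  have d1 (x : R) : is_derive x 1 (fun t => rprim f (t + 1) - rprim f t) 0.
    rewrite -(subrr (f x)); apply: is_deriveB; last exact: is_derive_rprim.
    by rewrite -[X in is_derive _ _ _ X]perf; exact: is_derive_rprim_shift.
  exact: (is_derive_0_is_cst a a' d1).
have per x : F (Complex (x + 1) y') = F (Complex x y').
  rewrite -(perF (Complex x y')); congr F.
  by apply: CC_eq; rewrite ?reCD ?imCD /= ?addr0.
rewrite /hint /cint; congr (Complex _ _); apply: hor.
- by apply: continuous_re_path; exact: continuous_hline.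
- by move=> x; rewrite per.
- by apply: continuous_im_path; exact: continuous_hline.
- by move=> x; rewrite per.
Qed.

Lemma hint_shift F (w : CC R) y a b : continuous F ->
  hint (fun z => F (z + w)) y a b = hint F (y + imC w) (a + reC w) (b + reC w).
Proof.
move=> cf; rewrite /hint /cint.
have cl := continuous_hline (y := y + imC w) cf.
rewrite -!rint_shift; [|exact: continuous_im_path|exact: continuous_re_path].
have E x : Complex x y + w = Complex (x + reC w) (y + imC w) :> CC R.
  by apply: CC_eq; rewrite ?reCD ?imCD.
by congr (Complex (rint _ _ _) (rint _ _ _)); apply/funext => x; rewrite E.
Qed.

End Goursat.

(** * Uniqueness of Fourier coefficients *)

Section FourierUniqueness.
Context {R : realType}.
Implicit Types (F : CC R -> CC R) (x y : R) (z w : CC R) (m : int).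

(** The characters of C / Z. *)
Definition echar (m : int) (z : CC R) : CC R := expC (2 * pic * ic * m%:~R * z).

Lemma echarD m n z : echar (m + n) z = echar m z * echar n z.
Proof. by rewrite /echar -expCD intrD; congr expC; ring. Qed.
Lemma echarDr m z w : echar m (z + w) = echar m z * echar m w.
Proof. by rewrite /echar -expCD mulrDr. Qed.
Lemma echar0 z : echar 0 z = 1.
Proof. by rewrite /echar mulr0 mul0r expC0. Qed.
Lemma echar_period m z : echar m (z + 1) = echar m z.
Proof. by rewrite echarDr /echar mulr1 expC_int mulr1. Qed.
Lemma is_derive_echar m z : is_derive z 1 (echar m) (2 * pic * ic * m%:~R * echar m z).
Proof. exact: is_derive_expCM. Qed.
Lemma derivable_echar m z : derivable (echar m) z 1.
Proof. by case: (is_derive_echar m z). Qed.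

(** A nonnegative trigonometric polynomial that concentrates at [x0] when [M]
    grows: it plays the role of an approximate identity. *)
Definition cosker (x0 : R) (M : nat) x : R := cos (pi * (x - x0)) ^+ (2 * M).

Lemma is_derive_pi x0 x : is_derive x 1 (fun x : R => pi * (x - x0)) (pi : R).
Proof.
have h1 : is_derive x 1 (fun x : R => x - x0) (1 - 0) by exact: is_deriveB.
rewrite -[X in is_derive _ _ _ X]mulr1 -[X in _ * X](subr0 (1 : R)).
exact: is_deriveZ.
Qed.

Lemma is_derive_cospi x0 x :
  is_derive x 1 (fun x : R => cos (pi * (x - x0))) (- sin (pi * (x - x0)) * pi).
Proof.
exact: (is_derive1_comp (g := fun x : R => pi * (x - x0)) _ (is_derive_pi x0 x)).
Qed.
Lemma is_derive_sinpi x0 x :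
  is_derive x 1 (fun x : R => sin (pi * (x - x0))) (cos (pi * (x - x0)) * pi).
Proof.
exact: (is_derive1_comp (g := fun x : R => pi * (x - x0)) _ (is_derive_pi x0 x)).
Qed.

Lemma continuous_mulf (f g : R -> R) :
  continuous f -> continuous g -> continuous (fun x => f x * g x).
Proof. by move=> cf cg x; apply: (@continuousM _ _ f g); [exact: cf|exact: cg]. Qed.

Lemma continuous_cosker x0 M : continuous (cosker x0 M).
Proof.
have cc : continuous (fun x : R => cos (pi * (x - x0))).
  exact: is_derive_continuous (is_derive_cospi x0).
rewrite /cosker; elim: (2 * M)%N => [|k IH]; first by move=> x; exact: cst_continuous.
have -> : (fun x => cos (pi * (x - x0)) ^+ k.+1) =
   (fun x => cos (pi * (x - x0)) * cos (pi * (x - x0)) ^+ k).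
  by apply/funext => t; rewrite exprS.
exact: continuous_mulf.
Qed.

Lemma cosker_ge0 x0 M x : 0 <= cosker x0 M x.
Proof. by rewrite /cosker exprM exprn_ge0 // sqr_ge0. Qed.

Lemma coskerS x0 M x :
  cosker x0 M.+1 x = cosker x0 M x * (1 - sin (pi * (x - x0)) ^+ 2).
Proof. by rewrite /cosker mulnS addnC exprD cos2sin2. Qed.

Definition coskerI x0 M := rint (x0 - 1/2) (x0 - 1/2 + 1) (cosker x0 M).

(** The derivative of [sin cos^(2M+1)] integrates to zero over a period. *)
Lemma coskerI_rec x0 M :
  (2 * M + 2)%:R * coskerI x0 M.+1 = (2 * M + 1)%:R * coskerI x0 M.
Proof.
pose s x := sin (pi * (x - x0)); pose c x := cos (pi * (x - x0)).
have dX (x : R) : is_derive x 1 (fun t => c t ^+ (2 * M).+1)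
    ((2 * M + 1)%:R * c x ^+ (2 * M) * (- s x * pi)).
  rewrite addn1; have := is_deriveX (2 * M).+1 (is_derive_cospi x0 x).
  rewrite exprfctE /c /s /=; exact.
have dP (x : R) : is_derive x 1 (fun t => s t * c t ^+ (2 * M).+1)
   (pi * ((2 * M + 2)%:R * cosker x0 M.+1 x + - (2 * M + 1)%:R * cosker x0 M x)).
  apply: (is_derive_eq (is_deriveM (is_derive_sinpi x0 x) (dX x))); rewrite -/(s x) -/(c x).
  have sE (u t : R) : u *: t = u * t by [].
  rewrite !sE coskerS /cosker -/(s x) -/(c x) exprSr.
  have c2 : c x ^+ 2 = 1 - s x ^+ 2 by exact: cos2sin2.
  have -> : c x ^+ (2 * M) * c x * (c x * pi) = c x ^+ (2 * M) * c x ^+ 2 * pi by ring.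
  by rewrite c2 !natrD; ring.
have cc := fun M => @continuous_cosker x0 M.
have cD : continuous (fun x => pi * ((2 * M + 2)%:R * cosker x0 M.+1 x +
    - (2 * M + 1)%:R * cosker x0 M x)).
  by apply/continuous_scalef/continuous_addf; apply: continuous_scalef; exact: cc.
have := rintE (x0 - 1/2) (x0 - 1/2 + 1) dP cD.
rewrite rintZ; last by apply/continuous_addf; apply: continuous_scalef; exact: cc.
rewrite rintD; [|by apply: continuous_scalef; exact: cc..].
rewrite !rintZ; [|exact: cc..].
have -> : c (x0 - 1/2) = 0.
  by rewrite /c -cosN -cos_pihalf; congr cos; field.
have -> : c (x0 - 1/2 + 1) = 0.
  by rewrite /c -cos_pihalf; congr cos; field.
rewrite !expr0n /= !mulr0 subrr => /eqP; rewrite mulf_eq0 gt_eqF ?pi_gt0 //=.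
by rewrite mulNr subr_eq0 => /eqP.
Qed.

Lemma coskerI_gt0 x0 M : 0 < coskerI x0 M.
Proof.
elim: M => [|M IH].
  have -> : coskerI x0 0 = rint (x0 - 1/2) (x0 - 1/2 + 1) (fun=> 1) by [].
  by rewrite rint_cst addrAC subrr add0r mulr1.
have h : 0 < (2 * M + 1)%:R * coskerI x0 M by rewrite mulr_gt0 // ltr0n addn1.
by move: h; rewrite -coskerI_rec pmulr_rgt0 // ltr0n addn2.
Qed.

(** By the recurrence, weighting with [sin^2] costs a factor [1 / (2M + 2)]: this
    is the concentration of the kernel. *)
Lemma coskerI_sin x0 M :
  rint (x0 - 1/2) (x0 - 1/2 + 1) (fun x => sin (pi * (x - x0)) ^+ 2 * cosker x0 M x) =
  coskerI x0 M / (2 * M + 2)%:R.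
Proof.
have -> : (fun x => sin (pi * (x - x0)) ^+ 2 * cosker x0 M x) =
   (fun x => cosker x0 M x + (-1) * cosker x0 M.+1 x).
  by apply/funext => x; rewrite coskerS; ring.
have cc := fun M => @continuous_cosker x0 M.
rewrite rintD ?rintZ //; last by apply: continuous_scalef; exact: cc.
have n0 : (2 * M + 2)%:R != 0 :> R by rewrite pnatr_eq0 addn2.
rewrite -/(coskerI x0 M) -/(coskerI x0 M.+1).
apply: (mulfI n0); rewrite mulrCA divff // mulr1 mulrDr mulN1r mulrN coskerI_rec.
by rewrite !natrD; ring.
Qed.

Lemma cos_sqr_echar (w : CC R) x :
  rc (cos (pi * (x - reC w)) ^+ 2) = 2^-1 +
   4^-1 * (echar 1 (- w) * echar 1 (Complex x (imC w))) +
   4^-1 * (echar (-1) (- w) * echar (-1) (Complex x (imC w))).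
Proof.
have xw : - w + Complex x (imC w) = rc (x - reC w).
  by apply: CC_eq; rewrite ?reCD ?imCD ?reCN ?imCN /=; ring.
rewrite -!echarDr xw /echar.
set t := x - reC w.
have e1 (u : R) : expC (ic * rc u) = Complex (cos u) (sin u).
  by rewrite /expC !reCM !imCM /= !mul0r !mul1r subr0 add0r expR0 mul1r.
have -> : 2 * pic * ic * 1%:~R * rc t = ic * rc (2 * (pi * t)).
  by rewrite !rcM rc_nat /pic; ring.
have -> : 2 * pic * ic * (-1)%:~R * rc t = ic * rc (- (2 * (pi * t))).
  by rewrite rcN !rcM rc_nat /pic; ring.
rewrite !e1 cosN sinN.
have -> : 2 * (pi * t) = (pi * t) *+ 2 by rewrite mulr2n; ring.
have h2 : 2^-1 = rc (2^-1) :> CC R by rewrite rcV rc_nat.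
have h4 : 4^-1 = rc (4^-1) :> CC R by rewrite rcV rc_nat.
rewrite h2 h4 cos_mulr2n mulr2n; apply: CC_eq; rewrite !(reCD, imCD, reCM, imCM) /=; field; done.
Qed.

Lemma sin_sqr_away (dl : R) : 0 < dl -> exists2 s : R, 0 < s &
  forall t : R, dl <= `|t| -> `|t| <= 1/2 -> s <= sin (pi * t) ^+ 2.
Proof.
move=> dl0; pose d := Num.min dl (1/2).
have pi0 := pi_gt0 R.
have d0 : 0 < d by rewrite lt_min dl0 divr_gt0.
have d1 : d <= 1/2 by rewrite ge_min lexx orbT.
have sd : 0 < sin (pi * d).
  apply: sin_gt0_pi; apply/andP; split; first exact: mulr_gt0.
  by rewrite -[ltRHS]mulr1 ltr_pM2l //; lra.
exists (sin (pi * d) ^+ 2); first exact: exprn_gt0.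
move=> t; rewrite -/d => h1 h2.
have dt : d <= `|t| by rewrite (le_trans _ h1) // ge_min lexx.
have -> : sin (pi * t) ^+ 2 = sin (pi * `|t|) ^+ 2.
  by have [//|_] := ger0P t; rewrite mulrN sinN sqrrN.
have mono : sin (pi * d) <= sin (pi * `|t|).
  have t2 : pi * `|t| <= pi * (1/2) by rewrite ler_pM2l.
  have d2 : pi * d <= pi * (1/2) by rewrite ler_pM2l.
  have t3 : pi * d <= pi * `|t| by rewrite ler_pM2l.
  have pd : 0 < pi * d by rewrite mulr_gt0.
  rewrite leNgt ltr_sin ?in_itv /= -?leNgt //; apply/andP; split; lra.
by rewrite lerXn2r // nnegrE ltW // (lt_le_trans sd).
Qed.

(** Continuity controls the oscillation close to [x0] and boundedness controls it
    away from [x0], where [sin^2] is bounded below. *)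
Lemma continuity_sin_bound (p : R -> CC R) x0 (e : R) : continuous p -> 0 < e ->
  exists2 C : R, 0 <= C & forall x, x0 - 1/2 <= x -> x <= x0 - 1/2 + 1 ->
    cabs (p x - p x0) <= e + C * sin (pi * (x - x0)) ^+ 2.
Proof.
move=> cp e0.
have /(@cvgCP _ _ (nbhs x0))/(_ _ e0)/nbhs_normP[dl /= dl0 H] := cp x0.
have [s s0 sP] := sin_sqr_away dl0.
pose g x := cabs (p x - p x0).
have cg : continuous g.
  move=> x; apply: (@continuous_comp _ _ _ (fun x => p x - p x0) (@cabs R)).
    by apply: continuousB; [exact: cp|exact: cst_continuous].
  exact: continuous_cabs.
have ab : x0 - 1/2 <= x0 - 1/2 + 1 by rewrite lerDl.
have [c _ cmax] := EVT_max ab (continuous_subspaceT cg).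
exists (g c / s); first by rewrite divr_ge0 ?cabs_ge0 // ltW.
move=> x ax xb; have [near|far] := ltP `|x - x0| dl.
  rewrite cabsC ler_wpDr //; first by rewrite mulr_ge0 ?sqr_ge0 // divr_ge0 ?cabs_ge0 // ltW.
  by apply/ltW/H => /=; rewrite distrC.
rewrite ler_wpDl ?(ltW e0) //.
have h1 : g x <= g c by apply: cmax; rewrite in_itv /= ax.
have h2 : s <= sin (pi * (x - x0)) ^+ 2.
  by apply: sP => //; rewrite ler_norml; apply/andP; split; lra.
apply: le_trans h1 _; rewrite -mulrA ler_peMr ?cabs_ge0 //.
by rewrite mulrC ler_pdivlMr // mul1r.
Qed.

(** If all Fourier coefficients vanish, so does the integral of [F] against every
    translate of the kernel, along the horizontal line through [w]. Replacing [F] by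
    [F w] there costs at most [e + C / (2M + 2)] times the mass of the kernel, so
    [F w] is arbitrarily small. *)
Lemma fourier_uniqueness F : (forall z : CC R, derivable F z 1) ->
  (forall z, F (z + 1) = F z) ->
  (forall m, hint (fun z => F z * echar m z) 0 0 (0 + 1) = 0) -> forall w, F w = 0.
Proof.
move=> dF perF F0 w.
have cF : continuous F by move=> z; exact: derivable_continuousC.
set y := imC w; set x0 := reC w; set a := x0 - 1/2.
pose p x := F (Complex x y); pose em m x := echar m (Complex x y).
have cp : continuous p by exact: continuous_hline.
have cem m : continuous (em m).
  by apply: (@continuous_hline _ (echar m)) => z; apply: derivable_continuousC; exact: derivable_echar.
have cMC (u v : R -> CC R) : continuous u -> continuous v -> continuous (fun x => u x * v x).
  by move=> cu cv x; apply: (@continuousM _ _ u v); [exact: cu|exact: cv].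
have crc (f : R -> R) : continuous f -> continuous (fun x => rc (f x) : CC R).
  by move=> cf; apply: continuous_path => //= x; exact: cst_continuous.
have line m : cint a (a + 1) (fun x => p x * em m x) = 0.
  have dFe (z : CC R) : derivable (fun z => F z * echar m z) z 1.
    by apply: derivableM; [exact: dF|exact: derivable_echar].
  rewrite -(F0 m) -[LHS]/(hint (fun z => F z * echar m z) y a (a + 1)).
  by apply: period_mean_const => // z; rewrite perF echar_period.
have weighted M m : cint a (a + 1) (fun x => rc (cosker x0 M x) * (p x * em m x)) = 0.
  elim: M m => [|M IH] m.
    by rewrite -(line m); congr cint; apply/funext => x; rewrite /cosker muln0 expr0 mul1r.
  have cK : continuous (fun x => rc (cosker x0 M x) : CC R).
    by apply: crc; exact: continuous_cosker.
  have cm k : continuous (fun x => rc (cosker x0 M x) * (p x * em k x)).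
    exact: (cMC (fun x => rc (cosker x0 M x)) (fun x => p x * em k x) cK
      (cMC p (em k) cp (cem k))).
  have -> : (fun x => rc (cosker x0 M.+1 x) * (p x * em m x)) =
    (fun x => 2^-1 * (rc (cosker x0 M x) * (p x * em m x)) +
      (4^-1 * echar 1 (- w) * (rc (cosker x0 M x) * (p x * em (1 + m)%R x)) +
       4^-1 * echar (-1) (- w) * (rc (cosker x0 M x) * (p x * em (-1 + m)%R x)))).
    apply/funext => x; rewrite coskerS -cos2sin2 rcM cos_sqr_echar.
    by rewrite /em !echarD -/y; ring.
  have cZ k l : continuous (fun x => k * (rc (cosker x0 M x) * (p x * em l x))).
    apply: (cMC (fun=> k) _ _ (cm l)); first by move=> x; exact: cst_continuous.
  have cDC (u v : R -> CC R) : continuous u -> continuous v -> continuous (fun x => u x + v x).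
    by move=> cu cv x; apply: (@continuousD _ _ _ u v); [exact: cu|exact: cv].
  rewrite (cintD _ _ (cZ _ _) (cDC _ _ (cZ _ _) (cZ _ _))).
  rewrite (cintD _ _ (cZ _ _) (cZ _ _)) !(cintZ _ _ _ (cm _)) !IH.
  by rewrite !mulr0 !addr0.
have px0 : p x0 = F w by rewrite /p /y /x0; congr F; apply: CC_eq.
apply/eqP; rewrite -cabs_eq0 eq_le cabs_ge0 andbT; apply/ler_addgt0Pr => e e0.
rewrite add0r.
have e4 : 0 < e / 4 by rewrite divr_gt0.
have [C C0 HC] := continuity_sin_bound x0 cp e4.
have [M MP] : exists M : nat, 4 * C < (2 * M + 2)%:R * e.
  exists (Num.truncn (4 * C / e)).
  rewrite -ltr_pdivrMr //; apply: lt_le_trans (truncnS_gt _) _.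
  by rewrite ler_nat; move: (Num.truncn _) => k; rewrite mul2n -addnn; lia.
pose T x := cosker x0 M x.
have cT : continuous T by exact: continuous_cosker.
have I0 := coskerI_gt0 x0 M; set I := coskerI x0 M in I0.
have ab : a <= a + 1 by rewrite lerDl.
have split0 : F w * rc I = - cint a (a + 1) (fun x => rc (T x) * (p x - F w)).
  have -> : F w * rc I = cint a (a + 1) (fun x => F w * rc (T x)).
    rewrite (cintZ _ _ (F w) (crc T cT)).
    congr (_ * _); apply: CC_eq => //=.
    by rewrite rint_cst mul0r.
  have c1 : continuous (fun x => F w * rc (T x)).
    apply: (cMC (fun=> F w) _ _ (crc T cT)).
    by move=> x; exact: cst_continuous.
  have c2 : continuous (fun x => rc (T x) * (p x - F w)).
    apply: (cMC (fun x => rc (T x)) (fun x => p x - F w) (crc T cT)).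
    by move=> x; apply: continuousB; [exact: cp|exact: cst_continuous].
  apply/eqP; rewrite -addr_eq0 -(cintD _ _ c1 c2).
  have := weighted M 0; have -> : (fun x => rc (cosker x0 M x) * (p x * em 0 x)) =
      (fun x => F w * rc (T x) + rc (T x) * (p x - F w)).
    by apply/funext => x; rewrite /em echar0 /T; ring.
  by move=> ->.
have cS : continuous (fun x : R => sin (pi * (x - x0)) ^+ 2 * T x).
  have cs : continuous (fun x : R => sin (pi * (x - x0))).
    exact: is_derive_continuous (is_derive_sinpi x0).
  move=> x; apply: (@continuousM _ _ (fun x : R => sin (pi * (x - x0)) ^+ 2) T);
    last exact: cT.
  by apply: (@continuousM _ _ (fun x : R => sin (pi * (x - x0)))); exact: cs.
have bound : cabs (F w) * I <= 2 * (e / 4 * I + C * (I / (2 * M + 2)%:R)).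
  have -> : cabs (F w) * I = cabs (F w * rc I).
    by rewrite cabsM cabs_rc (gtr0_norm I0).
  rewrite split0 cabsN -coskerI_sin -!rintZ // -rintD.
  - apply: cint_abs_le; [| |exact: ab|].
    + apply: (cMC (fun x => rc (T x)) (fun x => p x - F w) (crc T cT)).
      by move=> x; apply: continuousB; [exact: cp|exact: cst_continuous].
    + by apply: continuous_addf; exact: continuous_scalef.
    + move=> x ax xb; rewrite cabsM cabs_rc ger0_norm ?cosker_ge0 // -px0.
      have := HC x ax xb; have := cosker_ge0 x0 M x; rewrite -/(T x).
      set k := cabs _; set q := sin _ ^+ 2 => T0 hk.
      have -> : e / 4 * T x + C * (q * T x) = T x * (e / 4 + C * q) by ring.
      exact: ler_wpM2l.
  - exact: continuous_scalef.
  - exact: continuous_scalef.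
have {bound} : cabs (F w) * I <= (e / 2 + 2 * C / (2 * M + 2)%:R) * I.
  have N0 : (2 * M + 2)%:R != 0 :> R by rewrite pnatr_eq0 addn2.
  move: bound N0; set N := (2 * M + 2)%:R => bound N0.
  apply: le_trans bound _; rewrite le_eqVlt; apply/orP; left; apply/eqP.
  by field.
rewrite ler_pM2r // => /le_trans; apply.
have h : 2 * C / (2 * M + 2)%:R <= e / 2.
  have : 0 < (2 * M + 2)%:R :> R by rewrite ltr0n addn2.
  by move: MP; set N := (2 * M + 2)%:R => MP N0; rewrite ler_pdivrMr //; nra.
lra.
Qed.

End FourierUniqueness.

(** * Series of exponentials *)

Section ComplexSeries.
Context {R : realType}.
Implicit Types (u v : nat -> CC R) (b : nat -> R).

Definition csum u : CC R := limn (series u).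
Definition csummable u := cvgn (series (fun n => cabs (u n))).

Lemma seriesC_re u n : reC (series u n) = series (fun n => reC (u n)) n.
Proof.
rewrite /series /=; elim: n => [|n IH]; first by rewrite !big_geq.
by rewrite !big_nat_recr //= reCD IH.
Qed.
Lemma seriesC_im u n : imC (series u n) = series (fun n => imC (u n)) n.
Proof.
rewrite /series /=; elim: n => [|n IH]; first by rewrite !big_geq.
by rewrite !big_nat_recr //= imCD IH.
Qed.

Lemma csummable_le u b : (forall n, cabs (u n) <= b n) -> cvgn (series b) -> csummable u.
Proof.
move=> ub cb; apply: series_le_cvg cb => // n; first exact: cabs_ge0.
exact: le_trans (cabs_ge0 _) (ub n).
Qed.

Lemma csummable_cvg u : csummable u -> series u @ \oo --> csum u.
Proof.
move=> su.
have cre : cvgn (series (fun n => reC (u n))).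
  apply: normed_cvg; apply: (series_le_cvg _ _ _ su) => n; [exact: normr_ge0|exact: cabs_ge0|exact: ler_re_cabs].
have cim : cvgn (series (fun n => imC (u n))).
  apply: normed_cvg; apply: (series_le_cvg _ _ _ su) => n;
    [exact: normr_ge0|exact: cabs_ge0|exact: ler_im_cabs].
have c : series u @ \oo --> (Complex (limn (series (fun n => reC (u n))))
     (limn (series (fun n => imC (u n)))) : CC R).
  apply/cvgCP => e e0.
  have e2 : 0 < e / 2 by rewrite divr_gt0.
  have h1 := (@cvgrPdist_lt _ _ _ \oo _ _ _).1 cre _ e2.
  have h2 := (@cvgrPdist_lt _ _ _ \oo _ _ _).1 cim _ e2.
  near=> n; apply: le_lt_trans (cabs_le_reim _) _.
  rewrite reCB imCB [ltRHS]splitr seriesC_re seriesC_im ltrD //.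
  - by near: n; exact: h1.
  - by near: n; exact: h2.
have := cvg_lim (@norm_hausdorff _ _) c.
by rewrite /csum => ->.
Unshelve. all: by end_near. Qed.

Lemma csumE u l : series u @ \oo --> l -> csum u = l.
Proof. by move=> c; exact: (cvg_lim (@norm_hausdorff _ _) c). Qed.

Lemma csum_abs_le u b : (forall n, cabs (u n) <= b n) -> cvgn (series b) ->
  cabs (csum u) <= limn (series b).
Proof.
move=> ub cb; have cu := csummable_cvg (csummable_le ub cb).
have cc : (fun n => cabs (series u n)) @ \oo --> cabs (csum u).
  by apply: continuous_cvg cu; exact: continuous_cabs.
rewrite -(cvg_lim _ cc) //; apply: limr_le; first by apply/cvg_ex; exists (cabs (csum u)).
near=> n; apply: le_trans (cabs_sum _ _ _) _.
apply: le_trans (nondecreasing_cvgn_le _ cb n).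
  by apply: ler_sum => i _; exact: ub.
by apply: nondecreasing_series => k _ _; exact: le_trans (cabs_ge0 _) (ub k).
Unshelve. all: by end_near. Qed.

Lemma csummableD u v : csummable u -> csummable v -> csummable (fun n => u n + v n).
Proof.
move=> su sv; apply: (@csummable_le _ (fun n => cabs (u n) + cabs (v n))).
  by move=> n; exact: cabsD.
have -> : series (fun n => cabs (u n) + cabs (v n)) =
  series (fun n => cabs (u n)) + series (fun n => cabs (v n)).
  by apply/funext => n; rewrite /series /= big_split.
exact: is_cvgD.
Qed.

Lemma csummableZ (k : CC R) u : csummable u -> csummable (fun n => k * u n).
Proof.
move=> su; rewrite /csummable.
have -> : (fun n => cabs (k * u n)) = cabs k \*: (fun n => cabs (u n)).
  by apply/funext => n; rewrite cabsM.
exact: is_cvg_seriesZ.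
Qed.

Lemma csumD u v : csummable u -> csummable v ->
  csum (fun n => u n + v n) = csum u + csum v.
Proof.
move=> su sv; apply: csumE.
have -> : series (fun n => u n + v n) = series u + series v.
  by apply/funext => n; rewrite /series /= big_split.
by apply: cvgD; exact: csummable_cvg.
Qed.

Lemma csumZ (k : CC R) u : csummable u -> csum (fun n => k * u n) = k * csum u.
Proof.
move=> su; apply: csumE.
have -> : series (fun n => k * u n) = (fun n => k * series u n).
  by apply/funext => n; rewrite /series /= mulr_sumr.
by apply: cvgMr; exact: csummable_cvg.
Qed.

Lemma csum_recl u : csummable u -> csum u = u 0%N + csum (fun n => u n.+1).
Proof.
move=> su; suff -> : csum (fun n => u n.+1) = csum u - u 0%N by rewrite addrC subrK.
apply: csumE.
have -> : series (fun n => u n.+1) = (fun n => series u n.+1 - u 0%N).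
  apply/funext => n; rewrite /series /= big_nat_recl // [u 0%N + _]addrC addrK //.
apply: cvgB; last exact: cvg_cst.
by have := csummable_cvg su; rewrite -(cvg_shiftS (series u)).
Qed.

Lemma cvg_scaled_series (k : R) b : cvgn (series b) ->
  series (fun n => k * b n) @ \oo --> k * limn (series b).
Proof.
move=> cb; have -> : series (fun n => k * b n) = (fun n => k * series b n).
  by apply/funext => n; rewrite /series /= mulr_sumr.
exact: cvgMr.
Qed.

Lemma lim_scaled_series (k : R) b : cvgn (series b) ->
  limn (series (fun n => k * b n)) = k * limn (series b).
Proof. by move=> cb; apply: cvg_lim => //; exact: cvg_scaled_series. Qed.

Lemma is_cvg_scaled_series (k : R) b : cvgn (series b) ->
  cvgn (series (fun n => k * b n)).
Proof.
move=> h; apply/cvg_ex; exists (k * limn (series b)); exact: cvg_scaled_series.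
Qed.

Lemma eq_csum u v : u =1 v -> csum u = csum v.
Proof. by move=> /funext ->. Qed.

End ComplexSeries.

Section ExponentialSeries.
Context {R : realType}.
Implicit Types (c l : nat -> CC R) (z : CC R).

Definition eser c l z : CC R := csum (fun n => c n * expC (l n * z)).

(** Coefficients that decay faster than any exponential in the frequencies: the
    condition is stable under termwise differentiation. *)
Definition fast_decay c l :=
  forall B : R, cvgn (series (fun n => cabs (c n) * expR (B * cabs (l n)))).

Lemma ler_expR_id (x : R) : x <= expR x.
Proof. by have := expR_ge1Dx x; lra. Qed.

Lemma fast_mul c l : fast_decay c l -> fast_decay (fun n => c n * l n) l.
Proof.
move=> f B; apply: series_le_cvg (f (B + 1)) => n.
- by rewrite mulr_ge0 ?cabs_ge0 ?expR_ge0.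
- by rewrite mulr_ge0 ?cabs_ge0 ?expR_ge0.
rewrite cabsM -mulrA ler_wpM2l ?cabs_ge0 // mulrDl mul1r expRD mulrC.
by rewrite ler_wpM2l ?expR_ge0 // ler_expR_id.
Qed.

Lemma fast_opp c l : fast_decay c l -> fast_decay c (fun n => - l n).
Proof.
move=> f B.
have -> : (fun n => cabs (c n) * expR (B * cabs (- l n))) =
          (fun n => cabs (c n) * expR (B * cabs (l n))).
  by apply/funext => n; rewrite cabsN.
exact: f.
Qed.

Lemma cabs_expC_le z w : cabs (expC (z * w)) <= expR (cabs w * cabs z).
Proof.
by rewrite cabs_expC ler_expR -cabsM [w * z]mulrC (le_trans (ler_norm _)) // ler_re_cabs.
Qed.

Lemma fast_csummable c l z : fast_decay c l -> csummable (fun n => c n * expC (l n * z)).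
Proof.
move=> f; apply: csummable_le (f (cabs z)) => n.
by rewrite cabsM ler_wpM2l ?cabs_ge0 // cabs_expC_le.
Qed.

(** Termwise differentiation: the remainders of the exponentials are quadratic in
    [h] and their sum still converges thanks to the decay. *)
Lemma is_derive_eser c l z : fast_decay c l ->
  is_derive z 1 (eser c l) (eser (fun n => c n * l n) l z).
Proof.
move=> f; have f1 := fast_mul f; have f2 := fast_mul f1.
pose B := cabs z + 1; set b := fun n => cabs (c n * l n * l n) * expR (B * cabs (l n)).
have cb : cvgn (series b) by exact: f2.
apply: (is_derive_quad (K := 4 * limn (series b))) => h h1.
have -> : eser c l (z + h) - eser c l z - eser (fun n => c n * l n) l z * h =
   csum (fun n => c n * expC (l n * z) * (expC (l n * h) - 1 - l n * h)).
  have s1 := fast_csummable (z := z + h) f; have s2 := fast_csummable (z := z) f.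
  have s3 := fast_csummable (z := z) f1.
  rewrite mulrC -mulNr -csumZ // -[- csum _]mulN1r -csumZ // -csumD //;
    last exact: csummableZ.
  rewrite -csumD; [|by apply: csummableD => //; exact: csummableZ|exact: csummableZ].
  by apply: eq_csum => n; rewrite mulrDr expCD; ring.
have -> : 4 * limn (series b) * cabs h ^+ 2 = limn (series (fun n => 4 * cabs h ^+ 2 * b n)).
  by rewrite (lim_scaled_series _ cb) mulrAC.
apply: csum_abs_le; last exact: is_cvg_scaled_series.
move=> n; rewrite (cabsM (c n * _)) (cabsM (c n)).
have ce0 : 0 <= cabs (c n) * cabs (expC (l n * z)) by apply: mulr_ge0; exact: cabs_ge0.
apply: le_trans (ler_wpM2l ce0 (expC_sub_le _)) _.
rewrite /b (cabsM (l n)) (cabsM (c n * l n)) (cabsM (c n)) /B [(cabs z + 1) * _]mulrDl [1 * cabs (l n)]mul1r [expR (_ + _)]expRD.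
set C := cabs (c n); set L := cabs (l n); set H := cabs h.
have e1 : cabs (expC (l n * z)) <= expR (cabs z * L) by exact: cabs_expC_le.
have e2 : expR (L * H) <= expR L by rewrite ler_expR ler_piMr ?cabs_ge0.
have C0 : 0 <= C by exact: cabs_ge0.
have -> : 4 * H ^+ 2 * (C * L * L * (expR (cabs z * L) * expR L)) =
   C * expR (cabs z * L) * (4 * (L * H) ^+ 2 * expR L) by ring.
have q0 : 0 <= 4 * (L * H) ^+ 2 by rewrite mulr_ge0 // sqr_ge0.
apply: ler_pM.
- by rewrite mulr_ge0 // cabs_ge0.
- by rewrite mulr_ge0 // expR_ge0.
- exact: ler_wpM2l.
- exact: ler_wpM2l.
Qed.

End ExponentialSeries.

Section GaussianDecay.
Context {R : realType}.

Lemma exists_expn_lt (r B : R) : 0 <= r -> r < 1 -> 0 < B -> exists K, r ^+ K < B.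
Proof.
move=> r0 r1 B0; have rn : `|r| < 1 by rewrite ger0_norm.
have /(@cvgrPdist_lt _ _ _ \oo)/(_ _ B0)[K _ H] := cvg_expr rn.
exists K; have := H K (leqnn K); rewrite sub0r normrN ger0_norm // exprn_ge0 //.
Qed.

(** As soon as [r^m B <= 1 / 2], the general term [(r^(m+1) B)^m] is dominated by a
    geometric one; the finitely many earlier terms go into the constant. *)
Lemma gauss_cvg (r B : R) : 0 <= r -> r < 1 -> 0 <= B ->
  cvgn (series (fun m => r ^+ (m * m.+1) * B ^+ m)).
Proof.
move=> r0 r1 B0.
have [K KP] : exists K, r ^+ K < 1 / (2 * (B + 1)).
  by apply: exists_expn_lt => //; rewrite divr_gt0 // mulr_gt0 // ltr_wpDl.
pose C := (2 * (B + 1)) ^+ K.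
have C1 : 1 <= C by rewrite exprn_ege1 //; lra.
have half : `|1/2 : R| < 1 by rewrite ger0_norm; lra.
apply: series_le_cvg (is_cvg_geometric_series (a := C) half) => m.
- by rewrite mulr_ge0 ?exprn_ge0.
- by rewrite /geometric /= mulr_ge0 ?exprn_ge0 //; lra.
rewrite /geometric /=.
have rB : r ^+ (m * m.+1) * B ^+ m = (r ^+ m.+1 * B) ^+ m.
  by rewrite exprMn -exprM mulnC.
have [mK|Km] := ltnP m K.
  have -> : C * (1/2) ^+ m = (2 * (B + 1)) ^+ (K - m) * (B + 1) ^+ m.
    rewrite /C -[in LHS](subnK (ltnW mK)) exprD -mulrA -exprMn; congr (_ * _ ^+ _).
    by field.
  apply: (@le_trans _ _ (1 * (B + 1) ^+ m)); last first.
    by rewrite ler_wpM2r ?exprn_ge0 ?exprn_ege1 //; lra.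
  rewrite ler_pM ?exprn_ge0 ?exprn_ile1 //; first by rewrite ltW.
  by rewrite lerXn2r ?nnegrE //; lra.
rewrite rB; apply: (@le_trans _ _ ((1/2) ^+ m)); last first.
  by rewrite ler_peMl ?exprn_ge0 //; lra.
have h : r ^+ m.+1 <= r ^+ K by rewrite ler_wiXn2l // ?ltW // leqW.
have h1 : r ^+ K * (B + 1) < 1 / 2.
  by move: KP; rewrite ltr_pdivlMr ?mulr_gt0 ?ltr_wpDl //; lra.
have h2 : r ^+ m.+1 * B <= r ^+ K * (B + 1).
  by rewrite ler_pM ?exprn_ge0 //; lra.
have h0 : 0 <= r ^+ m.+1 * B by rewrite mulr_ge0 ?exprn_ge0.
by apply: lerXn2r; rewrite ?nnegrE //; lra.
Qed.

End GaussianDecay.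

(** * Quasi-periodicity of theta *)

Section Theta.
Context {R : realType} (tau : CC R).
Hypothesis im_tau : 0 < imC tau.
Implicit Types (z : CC R) (m : nat).

Definition nome : CC R := expC (pic * ic * tau).
Local Notation q := nome.

Definition theta_coef m : CC R := (-1) ^+ m * q ^+ (m * m.+1).
Definition theta_freq m : CC R := (2 * m + 1)%:R * (pic * ic).

(** The half of the theta series with positive frequencies: the series is indexed
    by natural numbers, and theta is the odd part of this function. *)
Definition theta_half z : CC R := eser theta_coef theta_freq z.

Lemma nome_neq0 : q != 0. Proof. exact: expC_neq0. Qed.
Lemma cabs_nome_lt1 : cabs q < 1.
Proof.
rewrite cabs_expC -(@expR0 R) ltr_expR.
have -> : reC (pic * ic * tau) = - (pi * imC tau) by rewrite !reCM !imCM /=; ring.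
by rewrite oppr_lt0 mulr_gt0 // pi_gt0.
Qed.
Lemma cabs_nome_gt0 : 0 < cabs q. Proof. by rewrite cabs_gt0 nome_neq0. Qed.

Lemma cabs_sign m : cabs ((-1) ^+ m) = 1 :> R.
Proof. by rewrite cabsX cabsN cabs1 expr1n. Qed.

Lemma fast_theta : fast_decay theta_coef theta_freq.
Proof.
move=> B0; wlog Bge : B0 / 0 <= B0 => [H|].
  apply: series_le_cvg (H `|B0| (normr_ge0 _)) => n.
  - by rewrite mulr_ge0 ?cabs_ge0 ?expR_ge0.
  - by rewrite mulr_ge0 ?cabs_ge0 ?expR_ge0.
  by rewrite ler_wpM2l ?cabs_ge0 // ler_expR ler_wpM2r ?cabs_ge0 // ler_norm.
have -> : (fun n => cabs (theta_coef n) * expR (B0 * cabs (theta_freq n))) =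
  (fun n => expR (B0 * cabs (pic * ic : CC R)) *
     (cabs q ^+ (n * n.+1) * expR (2 * (B0 * cabs (pic * ic : CC R))) ^+ n)).
  apply/funext => n; rewrite (cabsM ((-1) ^+ n)) cabs_sign mul1r (cabsX q).
  rewrite (cabsM (2 * n + 1)%:R) cabs_nat [RHS]mulrCA; congr (_ * _).
  rewrite -expRM_natl -expRD; congr expR; rewrite natrD natrM; ring.
apply: is_cvg_scaled_series; apply: gauss_cvg; rewrite ?cabs_ge0 ?expR_ge0 //.
exact: cabs_nome_lt1.
Qed.

Lemma sinC_half z : sinC z = (expC (ic * z) - expC (- (ic * z))) / (2 * ic).
Proof. by []. Qed.

Lemma theta_halfE z : theta tau z = expC (pic * ic * tau / 4) / ic *
  (theta_half z - theta_half (- z)).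
Proof.
rewrite /theta -/(csum _).
have s1 := fast_csummable (z := z) fast_theta.
have s2 := fast_csummable (z := - z) fast_theta.
have -> : csum (fun m => (-1) ^+ m * q ^+ (m * m.+1) * sinC ((2 * m + 1)%:R * pic * z)) =
   (2 * ic)^-1 * (theta_half z - theta_half (- z)).
  rewrite /theta_half /eser -[- csum _]mulN1r -csumZ // -csumD //; last exact: csummableZ.
  rewrite -(csumZ _ (csummableD s1 (csummableZ (k := -1) s2))).
  apply: eq_csum => m; rewrite sinC_half -/(theta_coef m).
  have -> : ic * ((2 * m + 1)%:R * pic * z) = theta_freq m * z by rewrite /theta_freq; ring.
  by rewrite mulrN; ring.
by field; rewrite ic_neq0.
Qed.

Lemma expC_freq m z : expC (theta_freq m * z) = expC (pic * ic * z) * expC (2 * (pic * ic * z)) ^+ m.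
Proof.
rewrite -expCMn -expCD; congr expC; rewrite /theta_freq natrD natrM; ring.
Qed.

Lemma expC_pi : expC (pic * ic) = -1 :> CC R.
Proof.
have -> : pic * ic = Complex 0 pi :> CC R by rewrite ComplexE rc0 add0r mulrC.
by rewrite /expC /= expR0 cospi sinpi mul1r; apply: CC_eq; rewrite ?reCN ?imCN /= ?oppr0.
Qed.

Lemma expC_2pi : expC (2 * (pic * ic)) = 1 :> CC R.
Proof. by rewrite expCMn expC_pi expr2 mulrNN mulr1. Qed.

Lemma expC_theta_freq m : expC (theta_freq m) = -1.
Proof.
by rewrite -[theta_freq m]mulr1 expC_freq mulr1 expC_pi expC_2pi expr1n mulr1.
Qed.

Lemma theta_half_add1 z : theta_half (z + 1) = - theta_half z.
Proof.
rewrite /theta_half /eser -mulN1r -csumZ; last exact: fast_csummable fast_theta.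
apply: eq_csum => m; rewrite mulrDr mulr1 expCD.
rewrite expC_theta_freq; ring.
Qed.

(** Removing the first term shifts the index, which completes the square in the
    Gaussian exponents. The inhomogeneous term [expC (pic * ic * z)] disappears in
    the odd part. *)
Lemma theta_half_addtau z :
  theta_half z = expC (pic * ic * z) - q * expC (2 * (pic * ic * z)) * theta_half (z + tau).
Proof.
rewrite {1}/theta_half /eser csum_recl; last exact: fast_csummable fast_theta.
rewrite [theta_coef 0]mulr1 expr0 mul1r.
rewrite expC_freq expr0 mulr1; congr (_ + _).
rewrite -mulNr -csumZ; last exact: fast_csummable fast_theta.
apply: eq_csum => m; rewrite !expC_freq mulrDr mulrDr !expCD -/q.
have -> : expC (2 * (pic * ic * tau)) = q ^+ 2 by rewrite expCMn.
rewrite /theta_coef; have -> : (m.+1 * m.+2 = m * m.+1 + 2 * m + 2)%N by lia.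
set X := expC (2 * (pic * ic * z)).
rewrite (exprS (-1)) (exprS X) 2!(exprD q) (exprMn m X) -(exprM q); ring.
Qed.

Lemma theta_half_odd_addtau z :
  theta_half (z + tau) - theta_half (- (z + tau)) =
  - (q * expC (2 * (pic * ic * z)))^-1 * (theta_half z - theta_half (- z)).
Proof.
have e1 := theta_half_addtau z; have e2 := theta_half_addtau (- (z + tau)).
have E : - (z + tau) + tau = - z by ring.
rewrite E in e2.
set s := expC (pic * ic * z) in e1 *.
have s0 : s != 0 by exact: expC_neq0.
have q0 := nome_neq0.
have s2 (w : CC R) : expC (2 * w) = expC w ^+ 2 by exact: expCMn.
have sN : expC (pic * ic * - (z + tau)) = (s * q)^-1.
  by rewrite mulrN expCN mulrDr expCD.
rewrite !s2 -/s in e1 *; rewrite s2 sN in e2.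
rewrite e2 e1; field; by rewrite q0 s0.
Qed.

Lemma theta_add1 z : theta tau (z + 1) = - theta tau z.
Proof.
rewrite !theta_halfE theta_half_add1.
have -> : - (z + 1) = - z - 1 by ring.
have -> : theta_half (- z - 1) = - theta_half (- z).
  by rewrite -[in RHS](subrK 1 (- z)) theta_half_add1 opprK.
by ring.
Qed.

Lemma theta_addtau z :
  theta tau (z + tau) = - (q * expC (2 * (pic * ic * z)))^-1 * theta tau z.
Proof. by rewrite !theta_halfE theta_half_odd_addtau; ring. Qed.

Lemma theta0 : theta tau 0 = 0.
Proof. by rewrite theta_halfE oppr0 subrr mulr0. Qed.

(** The shift by [(tau + 1) / 2] turns the even series with integer exponents into
    the odd one with half-integer exponents. *)
Lemma thetabarE z : thetabar tau (z + (tau + 1) / 2) =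
  expC (- (pic * ic * z)) * (theta_half z - theta_half (- z)).
Proof.
rewrite /thetabar /zseries -!/(csum _).
have s1 := fast_csummable (z := z) fast_theta.
have s2 := fast_csummable (z := - z) fast_theta.
rewrite mulrBr /theta_half /eser -!csumZ // -mulN1r -csumZ //; last exact: csummableZ.
have sgn m : expC (m%:R * (pic * ic)) = (-1) ^+ m :> CC R by rewrite expCMn expC_pi.
congr (_ + _); apply: eq_csum => m; rewrite /theta_coef -sgn /q -expCMn.
  rewrite -!expCD; congr expC; rewrite /theta_freq -[_%:~R]/(m%:R).
  by rewrite !natrD !natrM -natr1; field.
have -> : -1 = expC (- theta_freq m) :> CC R by rewrite expCN expC_theta_freq invrN1.
rewrite -!expCD; congr expC.
rewrite /theta_freq NegzE mulrNz -[(m.+1)%:~R]/(m.+1%:R) -natr1.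
by rewrite !natrD !natrM -natr1; field.
Qed.

Lemma thetabar_theta z : thetabar tau (z + (tau + 1) / 2) =
  expC (- (pic * ic * z)) * (ic / expC (pic * ic * tau / 4)) * theta tau z.
Proof.
by rewrite thetabarE theta_halfE; field; rewrite ic_neq0 expC_neq0.
Qed.

(** Holomorphy of theta together with all its derivatives, in a form that can be
    iterated. *)
Lemma theta_smooth : exists T : nat -> CC R -> CC R, T 0%N = theta tau /\
  forall d z, is_derive z 1 (T d) (T d.+1 z).
Proof.
pose k := expC (pic * ic * tau / 4) / ic.
pose cp := fix cp d n := if d is e.+1 then cp e n * theta_freq n else theta_coef n.
pose cm := fix cm d n := if d is e.+1 then cm e n * (- theta_freq n) else theta_coef n.
exists (fun d z => k * (eser (cp d) theta_freq z - eser (cm d) (fun n => - theta_freq n) z)).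
split.
  apply/funext => z; rewrite theta_halfE /=; congr (_ * (_ - _)).
  by apply: eq_csum => n; rewrite mulrN mulNr.
have fp d : fast_decay (cp d) theta_freq by elim: d => [|d IH]; [exact: fast_theta|exact: fast_mul].
have fm d : fast_decay (cm d) (fun n => - theta_freq n).
  by elim: d => [|d IH]; [exact: fast_opp fast_theta|exact: fast_mul].
move=> d z.
have h := is_deriveB (is_derive_eser z (fp d)) (is_derive_eser z (fm d)).
exact: (is_deriveZ k h).
Qed.

End Theta.

(** * The finite triple product *)

Section QBinomial.
Variables (F : fieldType) (q : F).
Implicit Types (M N j k : nat).

(** The q-Pochhammer symbol (p; p)_k for p = q^2. The base is written as a square
    because the exponents [m (m + 1) / 2] of p are then natural powers of q. *)
Definition qpoch k : F := \prod_(i < k) (1 - (q ^+ 2) ^+ i.+1).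

Definition gaussbin M j : F :=
  if (j <= M)%N then qpoch M / (qpoch j * qpoch (M - j)) else 0.

Lemma qpochS k : qpoch k.+1 = qpoch k * (1 - (q ^+ 2) ^+ k.+1).
Proof. by rewrite /qpoch big_ord_recr. Qed.
Lemma qpoch0 : qpoch 0 = 1. Proof. by rewrite /qpoch big_ord0. Qed.

Hypothesis p_neq1 : forall k, 1 - (q ^+ 2) ^+ k.+1 != 0.

Lemma qpoch_neq0 k : qpoch k != 0.
Proof. by elim: k => [|k IH]; rewrite ?qpoch0 ?oner_neq0 // qpochS mulf_neq0. Qed.

Lemma gaussbin0 M : gaussbin M 0 = 1.
Proof. by rewrite /gaussbin leq0n subn0 qpoch0 mul1r divff // qpoch_neq0. Qed.

Lemma gaussbin_pascal M j : (j <= M)%N ->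
  gaussbin M.+1 j.+1 = gaussbin M j.+1 + (q ^+ 2) ^+ (M - j) * gaussbin M j.
Proof.
move=> jM; rewrite /gaussbin ltnS jM subSS.
have [jM1|Mj] := ltnP j M; last first.
  have -> : j = M by apply/eqP; rewrite eqn_leq jM.
  by rewrite subnn qpoch0 !mulr1 !divff ?qpoch_neq0 // add0r expr0 mulr1.
have [d ->] : exists d, M = (j + d.+1)%N by exists (M - j.+1)%N; lia.
have -> : (j + d.+1 - j = d.+1)%N by lia.
have -> : (j + d.+1 - j.+1 = d)%N by lia.
rewrite !qpochS.
have -> : ((j + d.+1).+1 = j.+1 + d.+1)%N by lia.
rewrite exprD.
have h1 := p_neq1 j; have h2 := p_neq1 d.
have := qpoch_neq0 j; have := qpoch_neq0 d.
set a := qpoch j; set b := qpoch d; set P := qpoch _.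
set x := (q ^+ 2) ^+ j.+1 in h1 *; set y := (q ^+ 2) ^+ d.+1 in h2 *.
by move=> b0 a0; field; rewrite ?a0 ?b0 ?h1 ?h2.
Qed.

(** The q-binomial theorem, homogeneous in [X] and [Y] so that the Laurent
    polynomials of the triple product arise without negative powers of [q]. *)
Lemma qbinomial (X Y : F) M : \prod_(k < M) (X + (q ^+ 2) ^+ k * Y) =
  \sum_(j < M.+1) q ^+ (j * j.-1) * gaussbin M j * X ^+ (M - j) * Y ^+ j.
Proof.
elim: M => [|M IH].
  by rewrite big_ord0 big_ord1 gaussbin0 mul0n !expr0 !mulr1.
rewrite big_ord_recr /= IH mulrDr.
have -> : (\sum_(j < M.+1) q ^+ (j * j.-1) * gaussbin M j * X ^+ (M - j) * Y ^+ j) * X =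
   \sum_(j < M.+2) q ^+ (j * j.-1) * gaussbin M j * X ^+ (M.+1 - j) * Y ^+ j.
  have g0 : gaussbin M M.+1 = 0 by rewrite /gaussbin ltnn.
  rewrite [RHS]big_ord_recr /= g0 mulr0 !mul0r addr0 mulr_suml.
  apply: eq_bigr => i _; rewrite subSn; last by rewrite -ltnS.
  by rewrite exprS; ring.
rewrite mulr_suml big_ord_recl [in RHS]big_ord_recl /= !gaussbin0.
rewrite -addrA; congr (_ + _); rewrite -big_split; apply: eq_bigr => i _ /=.
have iM : (i <= M)%N by rewrite -ltnS.
rewrite /bump /= !add1n subSS gaussbin_pascal //=.
have -> : q ^+ (i * i.-1) * gaussbin M i * X ^+ (M - i) * Y ^+ i * ((q ^+ 2) ^+ M * Y) =
  q ^+ (i * i.-1) * (q ^+ 2) ^+ M * gaussbin M i * X ^+ (M - i) * Y ^+ i.+1.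
  by rewrite (exprS Y); ring.
have -> : q ^+ (i * i.-1) * (q ^+ 2) ^+ M = q ^+ (i.+1 * i) * (q ^+ 2) ^+ (M - i).
  rewrite -!exprM -!exprD; congr (q ^+ _).
  by case: (nat_of_ord i) iM => [|k] kM /=; nia.
by ring.
Qed.

Lemma gaussbin_center N m : (m <= N)%N -> gaussbin (N + N.+1) (N - m) = gaussbin (N + N.+1) (N.+1 + m).
Proof.
move=> mN; rewrite /gaussbin.
have -> : (N - m <= N + N.+1)%N by lia.
have -> : (N.+1 + m <= N + N.+1)%N by lia.
have -> : (N + N.+1 - (N - m) = N.+1 + m)%N by lia.
have -> : (N + N.+1 - (N.+1 + m) = N - m)%N by lia.
by rewrite [qpoch (N - m) * _]mulrC.
Qed.

(** The q-binomial theorem for [2N + 1] factors, [X = p^N / s] and [Y = - s]: the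
    factors pair up around the central one, which is [p^N (1 / s - s)], and the
    terms pair up by the symmetry of the Gaussian binomials. *)
Lemma finite_triple_product (s : F) N : q != 0 -> s != 0 ->
  \sum_(m < N.+1) (-1) ^+ m * q ^+ (m * m.+1) * gaussbin (N + N.+1) (N.+1 + m) *
     (s ^+ (2 * m + 1) - s^-1 ^+ (2 * m + 1)) =
  (s - s^-1) * \prod_(k < N) ((1 - (q ^+ 2) ^+ k.+1 * s ^+ 2) * (1 - (q ^+ 2) ^+ k.+1 * s^-1 ^+ 2)).
Proof.
move=> q0 s0; pose E := (3 * (N * N) + N)%N.
have qE : q ^+ E * (-1) ^+ N.+1 != 0 by rewrite mulf_neq0 ?expf_neq0 // oppr_eq0 oner_neq0.
have sV : s * s^-1 = 1 by rewrite divff.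
(* common power of q in all terms and in the product *)
apply: (mulfI qE).
have H := qbinomial ((q ^+ 2) ^+ N * s^-1) (- s) (N + N.+1).
transitivity (\prod_(k < N + N.+1) ((q ^+ 2) ^+ N * s^-1 + (q ^+ 2) ^+ k * - s)).
  rewrite H {H} -[(N + N.+1).+1]/(N.+1 + N.+1)%N big_split_ord /=.
  rewrite [in X in _ = X + _](reindex_inj rev_ord_inj) /=.
  rewrite -big_split /= mulr_sumr; apply: eq_bigr => i _.
  have iN : (i <= N)%N by rewrite -ltnS.
  move: (nat_of_ord i) iN => {}i iN.
  rewrite subSS gaussbin_center //.
  set g := gaussbin _ _.
  have -> : (N + N.+1 - (N - i) = N.+1 + i)%N by lia.
  have -> : (N + N.+1 - (N.+1 + i) = N - i)%N by lia.
  have sg k : (- s) ^+ k = (-1) ^+ k * s ^+ k by rewrite -exprMn mulN1r.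
  rewrite !sg !(exprMn _ _ s^-1).
  have e1 : s^-1 ^+ (N.+1 + i) * s ^+ (N - i) = s^-1 ^+ (2 * i + 1).
    have -> : (N.+1 + i = (2 * i + 1) + (N - i))%N by lia.
    by rewrite exprD -mulrA -exprMn mulVf // expr1n mulr1.
  have e2 : s^-1 ^+ (N - i) * s ^+ (N.+1 + i) = s ^+ (2 * i + 1).
    have -> : (N.+1 + i = (N - i) + (2 * i + 1))%N by lia.
    by rewrite exprD mulrA -exprMn mulVf // expr1n mul1r.
  have f1 : q ^+ ((N - i) * (N - i).-1) * (q ^+ 2) ^+ N ^+ (N.+1 + i) = q ^+ E * q ^+ (i * i.+1).
    rewrite -!exprM -!exprD; congr (q ^+ _); rewrite /E.
    have [k ->] : exists k, N = (i + k)%N by exists (N - i)%N; lia.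
    have -> : (i + k - i = k)%N by lia.
    by case: k => [|k] /=; nia.
  have f2 : q ^+ ((N.+1 + i) * (N.+1 + i).-1) * (q ^+ 2) ^+ N ^+ (N - i) = q ^+ E * q ^+ (i * i.+1).
    rewrite -!exprM -!exprD; congr (q ^+ _); rewrite /E.
    have [k ->] : exists k, N = (i + k)%N by exists (N - i)%N; lia.
    have -> : (i + k - i = k)%N by lia.
    by rewrite addSn /=; nia.
  have g1 : (-1) ^+ (N - i) = - (-1) ^+ N.+1 * (-1) ^+ i :> F.
    have bb : (-1) ^+ i * (-1) ^+ i = 1 :> F by rewrite -exprMn mulrNN mulr1 expr1n.
    have E1 : (-1) ^+ N = (-1) ^+ (N - i) * (-1) ^+ i :> F by rewrite -exprD subnK.
    transitivity ((-1) ^+ (N - i) * ((-1) ^+ i * (-1) ^+ i) : F); first by rewrite bb mulr1.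
    by rewrite exprS E1; ring.
  have g2 : (-1) ^+ (N.+1 + i) = (-1) ^+ N.+1 * (-1) ^+ i :> F by rewrite exprD.
  transitivity ((q ^+ ((N - i) * (N - i).-1) * (q ^+ 2) ^+ N ^+ (N.+1 + i)) *
       (s^-1 ^+ (N.+1 + i) * s ^+ (N - i)) * (-1) ^+ (N - i) * g +
     (q ^+ ((N.+1 + i) * (N.+1 + i).-1) * (q ^+ 2) ^+ N ^+ (N - i)) *
       (s^-1 ^+ (N - i) * s ^+ (N.+1 + i)) * (-1) ^+ (N.+1 + i) * g); last by ring.
  by rewrite f1 f2 e1 e2 g1 g2; ring.
rewrite big_split_ord /= big_ord_recl /= addn0.
have -> : \prod_(i < N) ((q ^+ 2) ^+ N * s^-1 + (q ^+ 2) ^+ i * - s) =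
   \prod_(i < N) (- (q ^+ 2) ^+ i * s) *
   \prod_(i < N) (1 - (q ^+ 2) ^+ i.+1 * s^-1 ^+ 2).
  rewrite [in X in _ = _ * X](reindex_inj rev_ord_inj) -big_split /=.
  apply: eq_bigr => i _.
  have -> : (q ^+ 2) ^+ N = (q ^+ 2) ^+ i * (q ^+ 2) ^+ (N - i.+1).+1.
    by rewrite -exprD; congr (_ ^+ _); have := ltn_ord i; lia.
  set a := (q ^+ 2) ^+ i; set b := (q ^+ 2) ^+ _.+1.
  have -> : - a * s * (1 - b * s^-1 ^+ 2) = - a * s + a * b * s^-1 * (s * s^-1) by ring.
  by rewrite sV; ring.
have -> : \prod_(i < N) ((q ^+ 2) ^+ N * s^-1 + (q ^+ 2) ^+ (N + bump 0 i) * - s) =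
   \prod_(i < N) ((q ^+ 2) ^+ N * s^-1) * \prod_(i < N) (1 - (q ^+ 2) ^+ i.+1 * s ^+ 2).
  rewrite -big_split; apply: eq_bigr => i _ /=.
  rewrite /bump /= add1n exprD; set a := (q ^+ 2) ^+ N; set b := (q ^+ 2) ^+ _.+1.
  have -> : a * s^-1 * (1 - b * s ^+ 2) = a * s^-1 - a * b * s * (s * s^-1) by ring.
  by rewrite sV; ring.
rewrite [in RHS]big_split /=; set P1 := \prod_(i < N) (1 - _ * s ^+ 2); set P2 := \prod_(i < N) (1 - _).
have -> : \prod_(i < N) (- (q ^+ 2) ^+ i * s) = (-1) ^+ N * q ^+ (N * N.-1) * s ^+ N.
  elim: (N) => [|k IHk]; first by rewrite big_ord0 mul0n !expr0 !mulr1.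
  rewrite big_ord_recr /= IHk (exprS (-1)) (exprS s).
  have -> : q ^+ (k.+1 * k) = q ^+ (k * k.-1) * (q ^+ 2) ^+ k.
    by rewrite -exprM -exprD; congr (q ^+ _); case: (k) => [|?] /=; nia.
  by ring.
rewrite prodr_const card_ord (exprMn _ _ s^-1).
have -> : q ^+ E = q ^+ (N * N.-1) * (q ^+ 2) ^+ N ^+ N * (q ^+ 2) ^+ N.
  by rewrite -!exprM -!exprD; congr (q ^+ _); rewrite /E; case: (N) => [|?] /=; nia.
have sN : s ^+ N * s^-1 ^+ N = 1 by rewrite -exprMn sV expr1n.
rewrite (exprS (-1) N); set a := q ^+ (N * N.-1); set b := (q ^+ 2) ^+ N ^+ N; set cc := (q ^+ 2) ^+ N.
transitivity ((s ^+ N * s^-1 ^+ N) * (a * b * cc * (-1) ^+ N) * ((s^-1 - s) * (P1 * P2))); first by ring.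
by rewrite sN; ring.
Qed.

End QBinomial.

Section ProductBound.
Context {R : realType}.

(** Past an index [K] the product is at least one minus a geometric tail, hence at
    least 1 / 2; the first [K] factors contribute a positive constant. *)
Lemma prod_lower_bound (d : nat -> R) (C r : R) : 0 <= r -> r < 1 -> 0 <= C ->
  (forall k, 0 < d k) -> (forall k, 1 - C * r ^+ k <= d k) ->
  exists2 c : R, 0 < c & forall N, c <= \prod_(k < N) d k.
Proof.
move=> r0 r1 C0 d0 dC.
have [K KP] : exists K, r ^+ K < (1 - r) / (2 * (C + 1)).
  by apply: exists_expn_lt => //; rewrite divr_gt0 ?subr_gt0 // mulr_gt0 // ltr_wpDl.
(* factors at most one make the products decreasing in the number of factors *)
pose d' k := Num.min 1 (d k).
have d'0 k : 0 < d' k by rewrite lt_min ltr01 d0.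
have d'1 k : d' k <= 1 by rewrite ge_min lexx.
have d'C k : 1 - C * r ^+ k <= d' k.
  by rewrite le_min dC andbT gerBl mulr_ge0 ?exprn_ge0.
pose e := C * r ^+ K / (1 - r).
have rn : 1 - r != 0 by rewrite subr_eq0 gt_eqF.
have eK : C * r ^+ K = e * (1 - r) by rewrite /e; field.
have e0 : 0 <= e by rewrite /e divr_ge0 ?mulr_ge0 ?exprn_ge0 // subr_ge0 ltW.
have e2 : e <= 1 / 2.
  have C2 : 0 < 2 * (C + 1) by lra.
  move: KP; rewrite ltr_pdivlMr // => KP.
  rewrite /e ler_pdivrMr ?subr_gt0 //.
  have : 0 <= r ^+ K by rewrite exprn_ge0.
  by nra.
have tail N : 1 - e * (1 - r ^+ N) <= \prod_(i < N) d' (K + i)%N.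
  elim: N => [|N IH]; first by rewrite big_ord0 expr0 subrr mulr0 subr0.
  rewrite big_ord_recr /=; set x := \prod_(i < N) _ in IH *.
  have x0 : 0 <= x by apply: prodr_ge0 => i _; exact: ltW.
  have x1 : x <= 1 by apply: prodr_ile1 => i _; rewrite d'1 ltW.
  have := d'C (K + N)%N; rewrite exprD mulrA eK => h.
  have rN : 0 <= r ^+ N by rewrite exprn_ge0.
  have rN1 : r ^+ N.+1 = r * r ^+ N by rewrite exprS.
  have : x * (1 - e * (1 - r) * r ^+ N) <= x * d' (K + N)%N by rewrite ler_wpM2l.
  have : 0 <= (1 - x) * (e * (1 - r) * r ^+ N).
    apply: mulr_ge0; first by rewrite subr_ge0.
    by apply: mulr_ge0 => //; apply: mulr_ge0; rewrite // subr_ge0 ltW.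
  rewrite rN1; nra.
have PK : 0 < \prod_(i < K) d' i by apply: prodr_gt0.
exists ((\prod_(i < K) d' i) / 2); first by rewrite divr_gt0.
move=> N; apply: (@le_trans _ _ (\prod_(i < N) d' i)); last first.
  by apply: ler_prod => i _; rewrite ltW //= ge_min lexx orbT.
apply: (@le_trans _ _ (\prod_(i < K + N) d' i)).
  rewrite big_split_ord /=; apply: ler_wpM2l; first exact: ltW.
  apply: le_trans (tail N).
  have : e * (1 - r ^+ N) <= e * 1 by rewrite ler_wpM2l // gerBl exprn_ge0.
  lra.
rewrite addnC big_split_ord /= ler_piMr //.
  by apply: prodr_ge0 => i _; exact: ltW.
by apply: prodr_ile1 => i _; rewrite d'1 ltW.
Qed.

End ProductBound.

(** * The zeros of theta *)

Section ThetaZeros.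
Context {R : realType} (tau : CC R).
Hypothesis im_tau : 0 < imC tau.
Implicit Types (z : CC R) (m k N : nat).

Local Notation q := (nome tau).
Let r : R := cabs q ^+ 2.

Let r_ge0 : 0 <= r. Proof. exact: sqr_ge0. Qed.
Let r_gt0 : 0 < r. Proof. by rewrite exprn_gt0 // cabs_nome_gt0. Qed.
Let r_lt1 : r < 1.
Proof. by rewrite expr_lt1 ?cabs_ge0 // cabs_nome_lt1. Qed.

Let cabs_pX k : cabs ((q ^+ 2) ^+ k) = r ^+ k.
Proof. by rewrite !cabsX. Qed.

Let rS_lt1 k : r ^+ k.+1 < 1.
Proof. by rewrite exprn_ilt1. Qed.

Let rS_le k : r ^+ k.+1 <= r.
Proof. by rewrite exprS ler_piMr // exprn_ile1 // ltW. Qed.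

Lemma cabs_one_sub_ge (w : CC R) : 1 - cabs w <= cabs (1 - w).
Proof. by have := cabs_distD 1 (- w); rewrite cabs1 cabsN. Qed.

Lemma p_neq1 k : 1 - (q ^+ 2) ^+ k.+1 != 0.
Proof.
rewrite -cabs_gt0; apply: lt_le_trans (cabs_one_sub_ge _).
by rewrite cabs_pX subr_gt0.
Qed.

Lemma qpoch_bounds : exists cC : R * R, [/\ 0 < cC.1, 0 < cC.2 &
  forall k, cC.1 <= cabs (qpoch q k) <= cC.2].
Proof.
have [c c0 cP] : exists2 c : R, 0 < c & forall N, c <= \prod_(k < N) (1 - r ^+ k.+1).
  apply: (@prod_lower_bound _ (fun k => 1 - r ^+ k.+1) r r) => // k.
    by rewrite subr_gt0.
  by rewrite exprS.
exists (c, c^-1); split => //=; first by rewrite invr_gt0.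
move=> k; apply/andP; split.
  apply: le_trans (cP k) _; rewrite /qpoch.
  elim: k => [|k IH]; first by rewrite !big_ord0 cabs1.
  rewrite !big_ord_recr /= cabsM ler_pM ?prodr_ge0 ?subr_ge0 //.
  - by move=> i _; rewrite subr_ge0 ltW.
  - by rewrite ltW.
  by rewrite -(cabs_pX k.+1) cabs_one_sub_ge.
rewrite -[leRHS]mul1r ler_pdivlMr //.
apply: le_trans (ler_wpM2l (cabs_ge0 _) (cP k)) _.
elim: k => [|k IH]; first by rewrite big_ord0 mulr1 qpoch0 cabs1.
rewrite qpochS big_ord_recr /= cabsM mulrACA mulr_ile1 //.
- by rewrite mulr_ge0 ?cabs_ge0 // prodr_ge0 // => i _; rewrite subr_ge0 ltW.
- by rewrite mulr_ge0 ?cabs_ge0 // subr_ge0 ltW.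
have h1 : cabs (1 - (q ^+ 2) ^+ k.+1) <= 1 + r ^+ k.+1.
  by apply: le_trans (cabsB _ _) _; rewrite cabs1 cabs_pX.
have x0 : 0 <= r ^+ k.+1 by rewrite exprn_ge0.
have x1 := rS_lt1 k.
have : cabs (1 - (q ^+ 2) ^+ k.+1) * (1 - r ^+ k.+1) <= (1 + r ^+ k.+1) * (1 - r ^+ k.+1).
  by rewrite ler_wpM2r // subr_ge0 ltW.
nra.
Qed.

(** The ratio of a Gaussian binomial coefficient to the central one, which tends
    to 1 when [N] grows. Dividing by the central coefficient avoids the limit
    of the Pochhammer symbols. *)
Definition gauss_ratio N m : CC R :=
  qpoch q N * qpoch q N.+1 / (qpoch q (N - m) * qpoch q (N.+1 + m)).

Lemma gauss_ratioE N m : (m <= N)%N -> gauss_ratio N m =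
  qpoch q N * qpoch q N.+1 / qpoch q (N + N.+1) * gaussbin q (N + N.+1) (N.+1 + m).
Proof.
move=> mN; rewrite /gauss_ratio /gaussbin.
have -> : (N.+1 + m <= N + N.+1)%N by lia.
have -> : (N + N.+1 - (N.+1 + m) = N - m)%N by lia.
have n0 k : qpoch q k != 0 by apply: qpoch_neq0; exact: p_neq1.
have := n0 (N - m)%N; have := n0 (N.+1 + m)%N; have := n0 (N + N.+1)%N.
by move=> a b c; field; rewrite a b c.
Qed.

(** Consecutive ratios differ by [O(r^(N - m - 1))]; the bound is exponential in
    [N], and its growth in [m] is absorbed by the Gaussian decay of the
    coefficients of theta. *)
Lemma gauss_ratio_near1 : exists2 K : R, 0 <= K & forall N m, (m <= N)%N ->
  cabs (gauss_ratio N m - 1) <= K * m%:R * r ^+ (N - m).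
Proof.
have [[c C] /= [c0 C0 cC]] := qpoch_bounds.
have n0 k : qpoch q k != 0 by apply: qpoch_neq0; exact: p_neq1.
pose H := C * C / (c * c).
have H0 : 0 <= H by rewrite divr_ge0 ?mulr_ge0 // ltW.
have hH N m : cabs (gauss_ratio N m) <= H.
  rewrite /gauss_ratio !cabsM cabsV cabsM /H.
  have [/andP[a1 a2] /andP[b1 b2]] := (cC N, cC N.+1).
  have [/andP[d1 _] /andP[e1 _]] := (cC (N - m)%N, cC (N.+1 + m)%N).
  rewrite ler_pM ?mulr_ge0 ?invr_ge0 ?mulr_ge0 ?cabs_ge0 //.
    by rewrite ler_pM ?cabs_ge0.
  rewrite lef_pV2 ?posrE ?mulr_gt0 //; try by rewrite cabs_gt0 n0.
  by rewrite ler_pM // ltW.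
have r1' : 0 < 1 - r by rewrite subr_gt0.
pose K := H * 2 / (1 - r).
have K0 : 0 <= K by apply: divr_ge0; [exact: mulr_ge0|exact: ltW].
exists K => //.
move=> N; elim=> [|m IH] mN.
  rewrite /gauss_ratio subn0 addn0 divff ?subrr ?cabs0 ?mulr0 ?mul0r //.
  by rewrite mulf_neq0.
have {}IH := IH (ltnW mN).
have [d dE' dE] : exists2 d, (N - m.+1 = d)%N & (N - m = d.+1)%N.
  by exists (N - m.+1)%N; rewrite ?subnSK.
have rec : gauss_ratio N m.+1 - gauss_ratio N m = gauss_ratio N m *
   (((q ^+ 2) ^+ (N.+1 + m).+1 - (q ^+ 2) ^+ d.+1) / (1 - (q ^+ 2) ^+ (N.+1 + m).+1)).
  rewrite /gauss_ratio dE dE' addnS (qpochS q d) (qpochS q (N.+1 + m)).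
  have := n0 d; have := n0 (N.+1 + m)%N; have := p_neq1 (N.+1 + m); have := p_neq1 d.
  set x := (q ^+ 2) ^+ d.+1; set y := (q ^+ 2) ^+ (N.+1 + m).+1 => a1 a2 a3 a4.
  by set w := qpoch q N * _; field; rewrite a1 a2 a3 a4.
have step : cabs (gauss_ratio N m.+1 - gauss_ratio N m) <= K * r ^+ d.
  rewrite rec cabsM.
  have -> : K * r ^+ d = H * ((2 * r ^+ d) / (1 - r)) by rewrite /K; ring.
  rewrite ler_pM ?cabs_ge0 // cabsM cabsV.
  rewrite ler_pM ?invr_ge0 ?cabs_ge0 //.
    apply: le_trans (cabsB _ _) _; rewrite !cabs_pX mulr2n mulrDl mul1r lerD //.
      rewrite ler_wiXn2l // ?ltW // -dE' -addnS.
      by rewrite (leq_trans (leq_subr _ _)) // addSnnS leq_addr.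
    by rewrite ler_wiXn2l // ltW.
  rewrite lef_pV2 ?posrE // ?cabs_gt0 ?p_neq1 //.
  apply: le_trans (cabs_one_sub_ge _); rewrite cabs_pX lerD2l lerN2; exact: rS_le.
have -> : gauss_ratio N m.+1 - 1 = (gauss_ratio N m - 1) + (gauss_ratio N m.+1 - gauss_ratio N m).
  by ring.
apply: le_trans (cabsD _ _) _; apply: le_trans (lerD IH step) _.
rewrite dE' dE -natr1 mulrDr mulr1 mulrDl lerD2r.
apply: ler_wpM2l; first by rewrite mulr_ge0.
by rewrite ler_wiXn2l // ltW.
Qed.

(** The contribution of a frequency and its opposite, with [s = expC (pic * ic * z)]. *)
Definition theta_pair (s : CC R) m : CC R := s ^+ (2 * m + 1) - s^-1 ^+ (2 * m + 1).

Lemma theta_half_sub_cvg z :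
  series (fun m => theta_coef tau m * theta_pair (expC (pic * ic * z)) m) @ \oo -->
  theta_half tau z - theta_half tau (- z).
Proof.
have s1 := fast_csummable (z := z) (fast_theta im_tau).
have s2 := fast_csummable (z := - z) (fast_theta im_tau).
have -> : series (fun m => theta_coef tau m * theta_pair (expC (pic * ic * z)) m) =
   (series (fun m => theta_coef tau m * expC (theta_freq m * z)) -
    series (fun m => theta_coef tau m * expC (theta_freq m * - z))).
  apply/funext => n; rewrite /series /= fctE /= -sumrB; apply: eq_bigr => m _.
  rewrite -mulrBr /theta_pair -expCN -!expCMn; congr (_ * (expC _ - expC _));
    by rewrite /theta_freq; ring.
by apply: cvgB; exact: csummable_cvg.
Qed.

(** The limit of the finite triple product, kept as an inequality: a lower bound
    for all the partial products passes to theta without taking the limit of the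
    product. The constant [c] does not depend on
    [z], which makes the bound usable near the zero at the origin. *)
Lemma theta_half_sub_lower : exists2 c : R, 0 < c & forall (z : CC R) (d : R), 0 <= d ->
  let s := expC (pic * ic * z) in
  (forall N, d <= cabs (\prod_(k < N) ((1 - (q ^+ 2) ^+ k.+1 * s ^+ 2) *
                                       (1 - (q ^+ 2) ^+ k.+1 * s^-1 ^+ 2)))) ->
  c * d * cabs (s - s^-1) <= cabs (theta_half tau z - theta_half tau (- z)).
Proof.
have [[c C] /= [c0 C0 cC]] := qpoch_bounds.
have n0 k : qpoch q k != 0 by apply: qpoch_neq0; exact: p_neq1.
have [K K0 KP] := gauss_ratio_near1.
exists (c * c / C); first by rewrite divr_gt0 // mulr_gt0.
move=> z d d0; set s := expC (pic * ic * z) => dP; set T := theta_half _ _ - _.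
have s0 : s != 0 by exact: expC_neq0.
pose U N := series (fun m => theta_coef tau m * theta_pair s m) N.+1.
pose S N := \sum_(m < N.+1) gauss_ratio N m * (theta_coef tau m * theta_pair s m).
have lowS N : c * c / C * d * cabs (s - s^-1) <= cabs (S N).
  have -> : S N = qpoch q N * qpoch q N.+1 / qpoch q (N + N.+1) *
     ((s - s^-1) * \prod_(k < N) ((1 - (q ^+ 2) ^+ k.+1 * s ^+ 2) * (1 - (q ^+ 2) ^+ k.+1 * s^-1 ^+ 2))).
    rewrite -finite_triple_product //; [|exact: p_neq1|exact: nome_neq0].
    rewrite mulr_sumr; apply: eq_bigr => i _.
    rewrite gauss_ratioE; last by rewrite -ltnS.
    by rewrite /theta_coef /theta_pair; ring.
  rewrite cabsM (cabsM (s - s^-1)) [cabs (s - s^-1) * _]mulrC mulrA.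
  have c1 : 0 <= c * c / C by rewrite ltW // divr_gt0 // mulr_gt0.
  apply: ler_wpM2r; first exact: cabs_ge0.
  apply: ler_pM => //; last exact: dP.
  rewrite (cabsM (qpoch q N * _)) cabsV (cabsM (qpoch q N)).
  have [/andP[a1 a2] /andP[b1 b2]] := (cC N, cC N.+1).
  have /andP[d1 d2] := cC (N + N.+1)%N.
  apply: ler_pM; [by rewrite ltW // mulr_gt0|by rewrite invr_ge0 ltW| |].
    by apply: ler_pM; rewrite // ltW.
  by rewrite lef_pV2 ?posrE // cabs_gt0 n0.
have [L [L0 LP]] : exists L : R, 0 <= L /\ forall N, cabs (S N - U N) <= L * r ^+ N.
  (* r^(N - m) = r^N r^-m, and r^-m is beaten by the coefficient q^(m (m + 1)) *)
  pose B := cabs s + cabs s^-1.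
  have B0 : 0 <= B by rewrite addr_ge0 ?cabs_ge0.
  pose D := 2 * (r^-1 * B ^+ 2).
  have D0 : 0 <= D by rewrite !mulr_ge0 ?sqr_ge0 ?invr_ge0.
  pose g m := cabs q ^+ (m * m.+1) * D ^+ m.
  have cg : cvgn (series g) by apply: gauss_cvg; rewrite ?cabs_ge0 // cabs_nome_lt1.
  have g0 m : 0 <= g m by rewrite mulr_ge0 ?exprn_ge0 ?cabs_ge0.
  have sg N : series g N <= limn (series g).
    by apply: nondecreasing_cvgn_le cg N; apply: nondecreasing_series => k _ _.
  have KB0 : 0 <= 2 * K * B by rewrite mulr_ge0 // mulr_ge0.
  exists (2 * K * B * limn (series g)); split.
    apply: mulr_ge0 => //.
    apply: le_trans (sg 0%N).
    by rewrite /series /= big_geq.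
  move=> N; rewrite /S /U /series /= big_mkord -sumrB.
  apply: le_trans (cabs_sum _ _ _) _.
  apply: (@le_trans _ _ (\sum_(i < N.+1) 2 * K * B * r ^+ N * g i)); last first.
    rewrite -mulr_sumr.
    have -> : 2 * K * B * limn (series g) * r ^+ N = 2 * K * B * r ^+ N * limn (series g) by ring.
    apply: ler_wpM2l; first by apply: mulr_ge0 => //; exact: exprn_ge0.
    by have := sg N.+1; rewrite /series /= big_mkord.
  apply: ler_sum => i _; have iN : (i <= N)%N by rewrite -ltnS.
  move: (nat_of_ord i) iN => {}i iN.
  have -> : gauss_ratio N i * (theta_coef tau i * theta_pair s i) -
     theta_coef tau i * theta_pair s i = (gauss_ratio N i - 1) * (theta_coef tau i * theta_pair s i).
    by ring.
  rewrite cabsM (cabsM (theta_coef tau i)) (cabsM ((-1) ^+ i)) cabs_sign mul1r (cabsX q).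
  have hb : cabs (theta_pair s i) <= 2 * B ^+ (2 * i + 1).
    apply: le_trans (cabsB _ _) _; rewrite !cabsX mulr2n mulrDl mul1r lerD //.
      by apply: lerXn2r; rewrite ?nnegrE ?cabs_ge0 // lerDl cabs_ge0.
    by apply: lerXn2r; rewrite ?nnegrE ?cabs_ge0 // lerDr cabs_ge0.
  have ii : i%:R <= 2 ^+ i :> R by rewrite -natrX ler_nat ltnW // ltn_expl.
  have hk : cabs (gauss_ratio N i - 1) <= K * 2 ^+ i * (r ^+ N * r^-1 ^+ i).
    apply: le_trans (KP N i iN) _.
    have -> : r ^+ N * r^-1 ^+ i = r ^+ (N - i).
      by rewrite -[in LHS](subnK iN) exprD -mulrA -exprMn divff ?gt_eqF // expr1n mulr1.
    by apply: ler_wpM2r; [exact: exprn_ge0|exact: ler_wpM2l].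
  set A := cabs q ^+ (i * i.+1).
  have A0 : 0 <= A by rewrite exprn_ge0 ?cabs_ge0.
  apply: le_trans (ler_pM (cabs_ge0 _) (mulr_ge0 A0 (cabs_ge0 _)) hk (ler_wpM2l A0 hb)) _.
  have E1 : D ^+ i = 2 ^+ i * (r^-1 ^+ i * B ^+ (2 * i)).
    by rewrite /D (exprMn _ 2) (exprMn _ r^-1) -exprM.
  have E2 : B ^+ (2 * i + 1) = B ^+ (2 * i) * B by rewrite exprD expr1.
  rewrite /g -/A E1 E2.
  move: (r ^+ N) (r^-1 ^+ i) (B ^+ (2 * i)) (2 ^+ i : R) => x1 x2 x3 x4.
  by rewrite le_eqVlt; apply/orP; left; apply/eqP; ring.
apply/ler_addgt0Pr => e e0.
have e2 : 0 < e / 2 by rewrite divr_gt0.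
have /(@cvgCP _ _ \oo)/(_ _ e2)[n0' _ nP] := @theta_half_sub_cvg z.
have [k kP] : exists k, r ^+ k < (e / 2) / (L + 1).
  by apply: exists_expn_lt => //; rewrite divr_gt0 // ltr_wpDl.
pose N := maxn n0' k.
have u1 : cabs (T - U N) < e / 2.
  by apply: nP => /=; rewrite /N; apply: leqW; exact: leq_maxl.
have u2 : cabs (S N - U N) <= e / 2.
  apply: le_trans (LP N) _.
  have rN : r ^+ N <= r ^+ k by rewrite ler_wiXn2l ?ltW // leq_maxr.
  have L1 : 0 < L + 1 by rewrite ltr_wpDl.
  move: kP; rewrite ltr_pdivlMr // => kP.
  have rN0 : 0 <= r ^+ N by rewrite exprn_ge0.
  have rk0 : 0 <= r ^+ k by rewrite exprn_ge0.
  nra.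
apply: le_trans (lowS N) _.
have -> : S N = T + ((S N - U N) - (T - U N)) by ring.
apply: le_trans (cabsD _ _) _; rewrite lerD2l.
by apply: le_trans (cabsB _ _) _; lra.
Qed.

End ThetaZeros.

Section ThetaZeroSet.
Context {R : realType} (tau : CC R).
Hypothesis im_tau : 0 < imC tau.
Implicit Types (z h : CC R) (m k N : nat).

Local Notation q := (nome tau).
Let r : R := cabs q ^+ 2.
Let r_gt0 : 0 < r. Proof. by rewrite exprn_gt0 // cabs_nome_gt0. Qed.
Let r_lt1 : r < 1. Proof. by rewrite expr_lt1 ?cabs_ge0 // cabs_nome_lt1. Qed.

Let cabs_pX k : cabs ((q ^+ 2) ^+ k) = r ^+ k.
Proof. by rewrite !cabsX. Qed.

Lemma expC_lattice z k : expC (2 * (pic * ic * (z + k%:R * tau))) =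
  (q ^+ 2) ^+ k * expC (pic * ic * z) ^+ 2.
Proof.
rewrite -exprM -!expCMn -expCD; congr expC; rewrite natrM; ring.
Qed.

Lemma two_pi_i_neq0 : 2 * (pic * ic) != 0 :> CC R.
Proof.
by rewrite !mulf_neq0 ?ic_neq0 // ?rc_eq0 ?gt_eqF ?pi_gt0 // pnatr_eq0.
Qed.

Lemma expC_2pi_eq1 z : expC (2 * (pic * ic * z)) = 1 -> exists k : int, z = k%:~R.
Proof.
move=> /expC_eq1[k kE]; exists k; apply: (mulfI two_pi_i_neq0).
by rewrite -mulrA kE; ring.
Qed.

Lemma triple_factor_neq0 z k : ~ lattice tau z ->
  (1 - (q ^+ 2) ^+ k.+1 * expC (pic * ic * z) ^+ 2) *
  (1 - (q ^+ 2) ^+ k.+1 * (expC (pic * ic * z))^-1 ^+ 2) != 0.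
Proof.
move=> zL; apply: mulf_neq0; rewrite subr_eq0 eq_sym; apply/eqP.
  rewrite -expC_lattice => /expC_2pi_eq1[j jE]; apply: zL.
  exists j, (- (k.+1)%:Z); rewrite mulrNz mulNr.
  by rewrite -jE addrK.
have -> : (expC (pic * ic * z))^-1 = expC (pic * ic * - z) by rewrite mulrN expCN.
rewrite -expC_lattice => /expC_2pi_eq1[j jE]; apply: zL.
exists (- j), (k.+1)%:Z; rewrite mulrNz -jE.
by rewrite -[_%:~R]/(k.+1%:R); ring.
Qed.

(** Off the lattice no factor of the triple product vanishes, nor does [s - 1 / s],
    and the factors tend to 1 geometrically. *)
Lemma theta_neq0 z : ~ lattice tau z -> theta tau z != 0.
Proof.
move=> zL; set s := expC (pic * ic * z).
have s0 : s != 0 by exact: expC_neq0.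
have k0 : expC (pic * ic * tau / 4) / ic != 0.
  by rewrite mulf_neq0 ?invr_eq0 ?ic_neq0 // expC_neq0.
rewrite theta_halfE // mulf_neq0 // -cabs_gt0.
have [c c0 H] := theta_half_sub_lower im_tau.
pose x k := (q ^+ 2) ^+ k.+1 * s ^+ 2; pose y k := (q ^+ 2) ^+ k.+1 * s^-1 ^+ 2.
pose b1 := cabs s ^+ 2; pose b2 := cabs s^-1 ^+ 2.
have b10 : 0 <= b1 by exact: sqr_ge0.
have b20 : 0 <= b2 by exact: sqr_ge0.
have [d d0 dP] : exists2 d : R, 0 < d & forall N, d <= \prod_(k < N) cabs ((1 - x k) * (1 - y k)).
  apply: (@prod_lower_bound _ (fun k => cabs ((1 - x k) * (1 - y k))) (b1 + b2 + b1 * b2) r).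
  - exact: ltW.
  - exact: r_lt1.
  - by apply: addr_ge0; [exact: addr_ge0|exact: mulr_ge0].
  - by move=> k; rewrite cabs_gt0; exact: triple_factor_neq0.
  move=> k.
  have -> : (1 - x k) * (1 - y k) = 1 - (x k + y k - x k * y k) by ring.
  apply: le_trans (cabs_one_sub_ge _); rewrite lerD2l lerN2.
  apply: le_trans (cabsB _ _) _; apply: le_trans (lerD (cabsD _ _) (lexx _)) _.
  rewrite (cabsM (x k)) /x /y !(cabsM ((q ^+ 2) ^+ k.+1)) cabs_pX !(cabsX _ 2) -/b1 -/b2.
  have rk0 : 0 <= r ^+ k by rewrite exprn_ge0 ?ltW.
  have rk1 : r ^+ k.+1 <= r ^+ k by rewrite ler_wiXn2l // ltW.
  have rk2 : r ^+ k.+1 <= 1 by rewrite exprn_ile1 // ltW.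
  have rk3 : 0 <= r ^+ k.+1 by rewrite exprn_ge0 ?ltW.
  rewrite !mulrDl; apply: lerD; first apply: lerD.
  - by rewrite [leRHS]mulrC ler_wpM2r.
  - by rewrite [leRHS]mulrC ler_wpM2r.
  have -> : r ^+ k.+1 * b1 * (r ^+ k.+1 * b2) = (r ^+ k.+1 * r ^+ k.+1) * (b1 * b2) by ring.
  rewrite [leRHS]mulrC ler_wpM2r ?(mulr_ge0 b10 b20) //.
  by apply: (le_trans _ rk1); rewrite ler_piMr.
have prodE N : cabs (\prod_(k < N) ((1 - x k) * (1 - y k))) = \prod_(k < N) cabs ((1 - x k) * (1 - y k)).
  by elim: N => [|N IH]; rewrite ?big_ord0 ?cabs1 // !big_ord_recr /= cabsM IH.
apply: lt_le_trans (H z d (ltW d0) _); last by move=> N; rewrite -/s prodE.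
rewrite mulr_gt0 ?mulr_gt0 // cabs_gt0 -/s subr_eq0; apply/eqP => ss.
have : expC (2 * (pic * ic * z)) = 1.
  by rewrite expCMn expr2 -/s {2}ss divff.
move=> /expC_2pi_eq1[k kE]; apply: zL; exists k, 0; by rewrite mul0r addr0.
Qed.

Lemma is_derive_theta z : is_derive z 1 (theta tau) (derive1 (theta tau) z).
Proof.
have [T [<- dT]] := theta_smooth im_tau.
by rewrite derive1E; apply: derivableP; case: (dT 0%N z).
Qed.

Lemma derivable_theta z : derivable (theta tau) z 1.
Proof. by case: (is_derive_theta z). Qed.

(** Near the origin the triple product is bounded below uniformly, so theta is at
    least a multiple of [s - 1 / s], which vanishes only to first order. *)
Lemma theta_deriv0_neq0 : derive1 (theta tau) 0 != 0.
Proof.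
apply/eqP => D0.
have [c c0 H] := theta_half_sub_lower im_tau.
(* any b with 1 < b < 1 / r works: b bounds |s|^2 and |s|^-2 near the origin *)
pose b := (1 + r^-1) / 2.
have rV1 : 1 < r^-1 by rewrite invf_gt1.
have b1 : 1 < b by rewrite /b; lra.
have br : b * r < 1.
  have e : r^-1 * r = 1 by rewrite mulVf // gt_eqF.
  by rewrite /b; nra.
have bk k : b * r ^+ k.+1 < 1.
  apply: le_lt_trans br; rewrite ler_pM2l; last by lra.
  by rewrite -[leRHS]expr1 ler_wiXn2l // ltW.
have [d d0 dP] : exists2 d : R, 0 < d & forall N, d <= \prod_(k < N) (1 - b * r ^+ k.+1) ^+ 2.
  apply: (@prod_lower_bound _ (fun k => (1 - b * r ^+ k.+1) ^+ 2) (2 * b) r).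
  - exact: ltW.
  - exact: r_lt1.
  - lra.
  - by move=> k; rewrite exprn_gt0 // subr_gt0.
  move=> k.
  have : r ^+ k.+1 <= r ^+ k by rewrite ler_wiXn2l // ltW.
  nra.
have low h : cabs (expC (pic * ic * h)) ^+ 2 <= b -> cabs (expC (pic * ic * h))^-1 ^+ 2 <= b ->
   c * d * cabs (expC (pic * ic * h) - (expC (pic * ic * h))^-1) <=
   cabs (theta_half tau h - theta_half tau (- h)).
  move=> h1 h2; apply: H (ltW d0) _ => N; apply: le_trans (dP N) _.
  have f k (w : CC R) : cabs w ^+ 2 <= b -> 1 - b * r ^+ k.+1 <= cabs (1 - (q ^+ 2) ^+ k.+1 * w ^+ 2).
    move=> wb; apply: le_trans (cabs_one_sub_ge _); rewrite lerD2l lerN2.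
    by rewrite cabsM cabs_pX (cabsX w) mulrC ler_wpM2r // exprn_ge0 // ltW.
  elim: N => [|N IH]; first by rewrite !big_ord0 cabs1.
  rewrite !big_ord_recr /= cabsM; apply: ler_pM => //.
  - by apply: prodr_ge0 => i _; exact: sqr_ge0.
  - exact: sqr_ge0.
  by rewrite cabsM expr2; apply: ler_pM; rewrite ?f // subr_ge0 ltW.
pose k0 := expC (pic * ic * tau / 4) / ic.
have k00 : 0 < cabs k0.
  by rewrite cabs_gt0 mulf_neq0 ?invr_eq0 ?ic_neq0 // expC_neq0.
have cd0 : 0 < c * d by rewrite mulr_gt0.
have e0 : 0 < cabs k0 * (c * d) / 2 by rewrite divr_gt0 // mulr_gt0.
have small := (is_deriveCP _ _ _).1 (is_derive_theta 0) _ e0.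
have dw : is_derive (0 : CC R) 1 (fun h => expC (pic * ic * h) - expC (- (pic * ic) * h)) (2 * (pic * ic)).
  apply: (is_derive_eq (is_deriveB (is_derive_expCM (pic * ic) 0)
    (is_derive_expCM (- (pic * ic)) 0))); rewrite !mulr0 expC0; ring.
have near1 := (is_deriveCP _ _ _).1 dw _ (@ltr01 R).
have bb : 0 < b - 1 by lra.
have cont (l : CC R) : \forall h \near (0 : CC R), cabs (expC (l * h)) <= b.
  have cl : {for (0 : CC R), continuous (fun h => expC (l * h))}.
    by apply: derivable_continuousC; case: (is_derive_expCM l 0).
  have hc := (@cvgCP _ _ (nbhs (0 : CC R)) _ _ _).1 cl _ bb.
  near=> h.
  have : cabs (expC (l * 0) - expC (l * h)) < b - 1 by near: h; exact: hc.
  rewrite mulr0 expC0 cabsC => hb.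
  have := cabsD (expC (l * h) - 1) 1; rewrite subrK cabs1; lra.
have c1 := cont (2 * (pic * ic)); have c2 := cont (- (2 * (pic * ic))).
have [e e1 E] : exists2 e : R, 0 < e & forall h, cabs h < e ->
   [/\ cabs (theta tau h) <= cabs k0 * (c * d) / 2 * cabs h,
     cabs (expC (pic * ic * h) - expC (- (pic * ic) * h) - 2 * (pic * ic) * h) <= cabs h,
     cabs (expC (2 * (pic * ic) * h)) <= b & cabs (expC (- (2 * (pic * ic)) * h)) <= b].
  have : \forall h \near (0 : CC R), [/\ cabs (theta tau h) <= cabs k0 * (c * d) / 2 * cabs h,
     cabs (expC (pic * ic * h) - expC (- (pic * ic) * h) - 2 * (pic * ic) * h) <= cabs h,
     cabs (expC (2 * (pic * ic) * h)) <= b & cabs (expC (- (2 * (pic * ic)) * h)) <= b].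
    near=> h; split.
    - have : cabs (theta tau (0 + h) - theta tau 0 - derive1 (theta tau) 0 * h) <=
         cabs k0 * (c * d) / 2 * cabs h by near: h; exact: small.
      by rewrite D0 mul0r theta0 // !subr0 add0r.
    - have : cabs (expC (pic * ic * (0 + h)) - expC (- (pic * ic) * (0 + h)) -
       (expC (pic * ic * 0) - expC (- (pic * ic) * 0)) - 2 * (pic * ic) * h) <= 1 * cabs h.
        by near: h; exact: near1.
      by rewrite !mulr0 expC0 subrr subr0 add0r mul1r.
    - by near: h; exact: c1.
    - by near: h; exact: c2.
  by move=> /nbhsCP[e e1 E]; exists e => // h he; apply: E; rewrite sub0r cabsN.
pose h : CC R := rc (e / 2).
have hn : cabs h = e / 2 by rewrite cabs_rc gtr0_norm // divr_gt0.
have h0 : 0 < cabs h by rewrite hn divr_gt0.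
have he : cabs h < e by rewrite hn; lra.
have [E1 E2 E3 E4] := E h he.
have sE : expC (- (pic * ic) * h) = (expC (pic * ic * h))^-1 by rewrite mulNr expCN.
have l1 : cabs h <= cabs (expC (pic * ic * h) - (expC (pic * ic * h))^-1).
  rewrite sE in E2; set w := expC (pic * ic * h) - (expC (pic * ic * h))^-1 in E2 *.
  have := cabsB w (w - 2 * (pic * ic) * h); rewrite opprB addrCA subrr addr0 => E5.
  have E6 : cabs (2 * (pic * ic) * h) = 2 * pi * cabs h.
    by rewrite !cabsM cabs_nat cabs_ic mulr1 cabs_rc ger0_norm // pi_ge0.
  rewrite E6 in E5.
  have : 4 * cabs h <= 2 * pi * cabs h by rewrite ler_pM2r //; have := pi_ge2 R; lra.
  move=> E7; lra.
have l2 : c * d * cabs (expC (pic * ic * h) - (expC (pic * ic * h))^-1) <=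
   cabs (theta_half tau h - theta_half tau (- h)).
  apply: low.
    by rewrite -cabsX -expCMn mulrA.
  by rewrite -sE -cabsX -expCMn mulrA mulrN.
have tE : cabs (theta tau h) = cabs k0 * cabs (theta_half tau h - theta_half tau (- h)).
  by rewrite theta_halfE // cabsM.
rewrite tE in E1.
have : cabs k0 * (c * d * cabs h) <= cabs k0 * (c * d) / 2 * cabs h.
  apply: le_trans E1; rewrite ler_pM2l //; apply: le_trans l2.
  by rewrite ler_pM2l.
have : 0 < cabs k0 * (c * d) * cabs h by rewrite !mulr_gt0.
have -> : cabs k0 * (c * d) / 2 * cabs h = cabs k0 * (c * d) * cabs h / 2 by field.
rewrite mulrA; lra.
Unshelve. all: by end_near. Qed.

End ThetaZeroSet.

(** * Scalar solutions *)

Section ScalarSolutions.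
Context {R : realType} (tau : CC R).
Hypothesis im_tau : 0 < imC tau.
Implicit Types (z v : CC R) (f : CC R -> CC R).

(** The case n = 1 of [Sol]. *)
Definition scalar_sol v f := [/\ forall z, derivable f z 1,
  forall z, f (z + 1) = f z & forall z, f (z + tau) = efac tau v z * f z].

Definition mean f : CC R := hint f 0 0 (0 + 1).

Lemma scalar_sol_continuous v f : scalar_sol v f -> continuous f.
Proof. by move=> [df _ _] z; exact: derivable_continuousC. Qed.

(** Translating the path of integration by [tau] does not change the mean, and the
    multiplier shifts the character by one. *)
Lemma scalar_sol_mean_rec v f (m : int) : scalar_sol v f ->
  mean (fun z => f z * echar (m + 1) z) =
  - expC (- (2 * pic * ic * (v + tau))) * echar (m + 1) tau * mean (fun z => f z * echar m z).
Proof.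
move=> fs; have [df f1 ft] := fs.
have dG k z : derivable (fun z => f z * echar k z) z 1.
  by apply: derivableM; [exact: df|exact: derivable_echar].
have cG k : continuous (fun z => f z * echar k z).
  by move=> z; apply: derivable_continuousC; exact: dG.
have pG k z : f (z + 1) * echar k (z + 1) = f z * echar k z by rewrite f1 echar_period.
transitivity (mean (fun z => f (z + tau) * echar (m + 1) (z + tau))).
  rewrite [RHS](hint_shift tau 0 0 (0 + 1) (cG (m + 1))).
  have -> : 0 + 1 + reC tau = (0 + reC tau) + 1 by rewrite !add0r addrC.
  exact: period_mean_const (dG _) (pG _).
rewrite /mean /hint -cintZ; last exact: continuous_hline (cG m).
congr cint; apply/funext => x; set z := Complex x 0.
rewrite ft echarDr echarD /efac.
have -> : - (2 * pic * ic * (z + v + tau)) = - (2 * pic * ic * (v + tau)) - (2 * pic * ic * z).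
  by ring.
rewrite expCB /echar mulr1; field; exact: expC_neq0.
Qed.

Lemma scalar_sol_mean0 v f : scalar_sol v f -> mean f = 0 -> forall z, f z = 0.
Proof.
move=> fs m0; have [df f1 ft] := fs.
have nz (m : int) : - expC (- (2 * pic * ic * (v + tau))) * echar (m + 1) tau != 0.
  by rewrite mulf_neq0 ?oppr_eq0 ?expC_neq0.
have base : mean (fun z => f z * echar 0 z) = 0.
  by rewrite -m0; congr mean; apply/funext => z; rewrite echar0 mulr1.
apply: fourier_uniqueness => // m; rewrite -/(mean _).
elim: m => [//|m IH|m IH].
  by rewrite -addn1 PoszD (scalar_sol_mean_rec _ fs) IH mulr0.
have := scalar_sol_mean_rec (- (m.+1)%:Z) fs.
have -> : - m.+1%:Z + 1 = - m%:Z by rewrite -addn1 PoszD opprD subrK.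
rewrite IH => /esym/eqP; rewrite mulf_eq0.
have := nz (- m.+1%:Z).
have -> : - m.+1%:Z + 1 = - m%:Z by rewrite -addn1 PoszD opprD subrK.
by move=> /negbTE -> /= /eqP.
Qed.

Lemma scalar_sol_lincomb v f g (k : CC R) : scalar_sol v f -> scalar_sol v g ->
  scalar_sol v (fun z => f z + k * g z).
Proof.
move=> [df f1 ft] [dg g1 gt]; split.
- move=> z; apply: derivableD; first exact: df.
  by apply: derivableM; [exact: derivable_cst|exact: dg].
- by move=> z; rewrite f1 g1.
- by move=> z; rewrite ft gt; ring.
Qed.

(** The scalar solution with value 1 at the origin; up to an exponential and a
    constant it is the Kronecker function, with [v] in the place of the variable
    on which nabla acts. *)
Definition phi v z : CC R := expC (- (pic * ic * z)) * theta tau (z + v) / theta tau v.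

Lemma phi_add1 v z : phi v (z + 1) = phi v z.
Proof.
rewrite /phi.
have -> : z + 1 + v = z + v + 1 by ring.
rewrite theta_add1 // mulrDr opprD expCD mulr1 [expC (- (pic * ic))]expCN expC_pi invrN1.
by ring.
Qed.

Lemma phi_addtau v z : phi v (z + tau) = efac tau v z * phi v z.
Proof.
rewrite /phi /efac.
have -> : z + tau + v = z + v + tau by ring.
rewrite theta_addtau // /nome.
have -> : - (2 * pic * ic * (z + v + tau)) = - (2 * (pic * ic * (z + v))) - 2 * (pic * ic * tau) by ring.
rewrite expCB [expC (- (2 * _))]expCN.
have -> : - (pic * ic * (z + tau)) = - (pic * ic * z) - (pic * ic * tau) by ring.
rewrite expCB (expCMn (pic * ic * tau) 2).
set Q := expC (pic * ic * tau); set S := expC (2 * _); set T := expC (- _).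
have Q0 : Q != 0 by exact: expC_neq0.
have S0 : S != 0 by exact: expC_neq0.
have [->|t0] := eqVneq (theta tau v) 0; first by rewrite invr0 !mulr0.
by field; rewrite Q0 S0 t0.
Qed.

Lemma phi0 v : theta tau v != 0 -> phi v 0 = 1.
Proof. by move=> t0; rewrite /phi mulr0 oppr0 expC0 mul1r add0r divff. Qed.

Lemma derivable_phi v z : derivable (phi v) z 1.
Proof.
rewrite /phi; apply: derivableM; last exact: derivable_cst.
apply: derivableM; last by case: (is_derive_shiftC (is_derive_theta im_tau (z + v))).
have -> : (fun z => expC (- (pic * ic * z))) = (fun z => expC (- (pic * ic) * z)).
  by apply/funext => w; rewrite mulNr.
by case: (is_derive_expCM (- (pic * ic)) z).
Qed.

Lemma phi_sol v : scalar_sol v (phi v).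
Proof. by split; [exact: derivable_phi|exact: phi_add1|exact: phi_addtau]. Qed.

Lemma meanD f g (k : CC R) : continuous f -> continuous g ->
  mean (fun z => f z + k * g z) = mean f + k * mean g.
Proof.
move=> cf cg; rewrite /mean /hint.
have c1 := continuous_hline (y := 0) cf; have c2 := continuous_hline (y := 0) cg.
have c3 : continuous (fun x => k * g (Complex x 0)).
  move=> x; apply: (@continuousM _ _ (fun=> k) (fun x => g (Complex x 0))).
    exact: cst_continuous.
  exact: c2.
by rewrite (cintD _ _ c1 c3) (cintZ _ _ k c2).
Qed.

(** A solution is determined by its mean, so it is a multiple of [phi v], whose mean
    is nonzero because [phi v] is not; the value at the origin gives the multiple. *)
Lemma scalar_sol_zero v f : ~ lattice tau v -> scalar_sol v f -> f 0 = 0 ->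
  forall z, f z = 0.
Proof.
move=> vL fs f0.
have tv : theta tau v != 0 by exact: theta_neq0.
have ps := phi_sol v.
have m0 : mean (phi v) != 0.
  apply/eqP => /(scalar_sol_mean0 ps)/(_ 0); rewrite phi0 // => /eqP.
  by rewrite oner_eq0.
have gs := scalar_sol_lincomb (- (mean f / mean (phi v))) fs ps.
have g0 : forall z, f z + - (mean f / mean (phi v)) * phi v z = 0.
  apply: (scalar_sol_mean0 gs).
  rewrite meanD; [|exact: scalar_sol_continuous fs|exact: scalar_sol_continuous ps].
  by rewrite mulNr divfK // subrr.
have := g0 0; rewrite f0 add0r phi0 // mulr1 => k0.
by move=> z; have := g0 z; rewrite k0 mul0r addr0.
Qed.

End ScalarSolutions.

(** * Polynomials in nabla *)

Section NablaCalculus.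
Context {R : realType}.
Implicit Types (f g : CC R -> CC R) (P Q : {poly CC R}) (u z : CC R).

Let kap : CC R := - (2 * pic * ic)^-1.

Lemma nablaE f u (d : CC R) : is_derive u 1 f d -> nabla f u = kap * d.
Proof. by move=> [_ dE]; rewrite /nabla derive1E dE. Qed.

(** Makes [apply_nabla] linear in the polynomial: the sum may run up to any common
    bound. *)
Lemma apply_nabla_wide N P f u : (size P <= N)%N ->
  apply_nabla P f u = \sum_(m < N) P`_m * iter m nabla f u.
Proof.
move=> sN; rewrite /apply_nabla.
rewrite -(big_mkord xpredT (fun m => P`_m * iter m nabla f u)).
rewrite -(big_mkord xpredT (fun m => P`_m * iter m nabla f u)).
rewrite [RHS](big_cat_nat (n := size P)) //= [X in _ + X]big1_seq ?addr0 //.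
by move=> m; rewrite mem_index_iota => /andP[_ /andP[sm _]]; rewrite nth_default ?mul0r.
Qed.

Lemma apply_nablaDp P Q f u : apply_nabla (P + Q) f u = apply_nabla P f u + apply_nabla Q f u.
Proof.
pose N := maxn (size P) (size Q).
rewrite (@apply_nabla_wide N (P + Q)) ?size_polyD //.
rewrite (@apply_nabla_wide N P) ?leq_maxl // (@apply_nabla_wide N Q) ?leq_maxr //.
by rewrite -big_split; apply: eq_bigr => i _; rewrite coefD mulrDl.
Qed.

Lemma apply_nablaZp (k : CC R) P f u : apply_nabla (k *: P) f u = k * apply_nabla P f u.
Proof.
rewrite (@apply_nabla_wide (size P) (k *: P)) ?size_scale_leq // mulr_sumr.
by apply: eq_bigr => i _; rewrite coefZ mulrA.
Qed.

Lemma apply_nabla0p f u : apply_nabla 0 f u = 0.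
Proof. by rewrite /apply_nabla size_poly0 big_ord0. Qed.

Lemma apply_nabla_sump (I : Type) (r : seq I) (F : I -> {poly CC R}) f u :
  apply_nabla (\sum_(i <- r) F i) f u = \sum_(i <- r) apply_nabla (F i) f u.
Proof.
elim: r => [|i r IH]; first by rewrite !big_nil apply_nabla0p.
by rewrite !big_cons apply_nablaDp IH.
Qed.

Lemma apply_nablaMX P f u : apply_nabla (P * 'X) f u = apply_nabla P (nabla f) u.
Proof.
rewrite (@apply_nabla_wide (size P).+1 (P * 'X)); last first.
  by apply: leq_trans (size_polyMleq _ _) _; rewrite size_polyX addn2.
rewrite big_ord_recl /= coefMX mul0r add0r; apply: eq_bigr => i _.
by rewrite coefMX /= -iterS iterSr.
Qed.

Lemma apply_nabla1p f u : apply_nabla 1 f u = f u.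
Proof. by rewrite /apply_nabla size_poly1 big_ord1 coef1 /= mul1r. Qed.

Variable A : set (CC R).
Hypothesis openA : open A.

(** Differentiability to order [n] on [A]. The induction peels off the first
    derivative, which makes products and inverses immediate. *)
Fixpoint Ck n f : Prop :=
  if n is m.+1 then (forall u, A u -> derivable f u 1) /\ Ck m (nabla f) else True.
Definition smooth f := forall n, Ck n f.

Lemma smooth_derivable f u : smooth f -> A u -> derivable f u 1.
Proof. by move=> /(_ 1%N)[df _]; exact: df. Qed.
Lemma smooth_nabla f : smooth f -> smooth (nabla f).
Proof. by move=> sf n; have [] := sf n.+1. Qed.
Lemma near_eq_on f g u : {in A, f =1 g} -> A u -> \forall w \near u, f w = g w.
Proof.
move=> fg Au; apply: filterS (open_nbhs_nbhs (conj openA Au)) => w Aw.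
by apply: fg; rewrite inE.
Qed.

Lemma nabla_eq_on f g : {in A, f =1 g} -> {in A, nabla f =1 nabla g}.
Proof.
move=> fg u; rewrite inE => Au; rewrite /nabla (derive1E f) (derive1E g).
by rewrite (@near_eq_derive _ _ _ f g u 1 (near_eq_on fg Au)).
Qed.

Lemma iter_nabla_eq_on n f g : {in A, f =1 g} -> {in A, iter n nabla f =1 iter n nabla g}.
Proof. by move=> fg; elim: n => [|n IH]; [exact: fg|exact: nabla_eq_on IH]. Qed.

Lemma apply_nabla_eq_on P f g : {in A, f =1 g} -> {in A, apply_nabla P f =1 apply_nabla P g}.
Proof.
by move=> fg u Au; apply: eq_bigr => i _; rewrite (iter_nabla_eq_on i fg Au).
Qed.

Lemma derivable_eq_on f g u : {in A, f =1 g} -> A u -> derivable f u 1 -> derivable g u 1.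
Proof.
by move=> fg Au; exact: (@near_eq_derivable _ _ _ f g u 1 (near_eq_on fg Au)).
Qed.

Lemma Ck_eq_on n f g : {in A, f =1 g} -> Ck n f -> Ck n g.
Proof.
elim: n f g => [//|n IH] f g fg [df cf]; split.
  by move=> u Au; exact: (derivable_eq_on fg Au (df u Au)).
by apply: IH cf; exact: nabla_eq_on.
Qed.

Lemma CkW n f : Ck n.+1 f -> Ck n f.
Proof.
elim: n f => [//|n IH] f [df cf]; split => //; exact: IH.
Qed.

Lemma nablaD f g u : derivable f u 1 -> derivable g u 1 ->
  nabla (fun w => f w + g w) u = nabla f u + nabla g u.
Proof.
move=> /derivableP df /derivableP dg.
by rewrite (nablaE (is_deriveD df dg)) (nablaE df) (nablaE dg) mulrDr.
Qed.

Lemma nablaZ (k : CC R) f u : derivable f u 1 -> nabla (fun w => k * f w) u = k * nabla f u.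
Proof.
move=> /derivableP df.
have E : nabla (fun w => k * f w) u = kap * (k * 'D_1 f u) by exact: nablaE (is_deriveZ k df).
by rewrite E (nablaE df) mulrCA.
Qed.

Lemma nablaM f g u : derivable f u 1 -> derivable g u 1 ->
  nabla (fun w => f w * g w) u = nabla f u * g u + f u * nabla g u.
Proof.
move=> /derivableP df /derivableP dg.
have E : nabla (fun w => f w * g w) u = kap * (f u * 'D_1 g u + g u * 'D_1 f u).
  exact: nablaE (is_deriveM df dg).
rewrite E (nablaE df) (nablaE dg).
move: ('D_1 f u) ('D_1 g u) (f u) (g u) kap => a b c d k.
by ring.
Qed.

Lemma Ck_derivable n f u : Ck n.+1 f -> A u -> derivable f u 1.
Proof. by move=> [df _]; exact: df. Qed.

Lemma CkD n f g : Ck n f -> Ck n g -> Ck n (fun w => f w + g w).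
Proof.
elim: n f g => [//|n IH] f g [df cf] [dg cg]; split.
  by move=> u Au; apply: derivableD; [exact: df|exact: dg].
apply: (Ck_eq_on _ (IH _ _ cf cg)) => u; rewrite inE => Au.
by rewrite nablaD //; [exact: df|exact: dg].
Qed.

Lemma CkM n f g : Ck n f -> Ck n g -> Ck n (fun w => f w * g w).
Proof.
elim: n f g => [//|n IH] f g cf cg; split.
  by move=> u Au; apply: derivableM; [exact: Ck_derivable cf Au|exact: Ck_derivable cg Au].
have h := CkD (IH _ _ cf.2 (CkW cg)) (IH _ _ (CkW cf) cg.2).
apply: (Ck_eq_on _ h) => u; rewrite inE => Au.
by rewrite nablaM; [|exact: Ck_derivable cf Au|exact: Ck_derivable cg Au].
Qed.

Lemma nabla_cst (k : CC R) : nabla (fun=> k) = fun=> 0.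
Proof. by apply/funext => u; rewrite (nablaE (is_derive_cst k u 1)) mulr0. Qed.

Lemma Ck_cst n (k : CC R) : Ck n (fun=> k).
Proof.
elim: n k => [//|n IH] k; split; first by move=> u _; exact: derivable_cst.
by rewrite nabla_cst; exact: IH.
Qed.

Lemma is_deriveVC f u (d : CC R) : f u != 0 -> is_derive u 1 f d ->
  is_derive u 1 (fun w => (f w)^-1) (- (f u)^-1 * (f u)^-1 * d).
Proof.
move=> fu [df dE]; split; first exact: derivableV.
have -> : - (f u)^-1 * (f u)^-1 * d = - (f u) ^- 2 * d by rewrite expr2 invfM mulNr.
rewrite -dE; exact: (deriveV fu df).
Qed.

Lemma CkV n f : (forall u, A u -> f u != 0) -> Ck n f -> Ck n (fun w => (f w)^-1).
Proof.
move=> f0; elim: n => [//|n IH] cf.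
have dV u : A u -> is_derive u 1 (fun w => (f w)^-1) (- (f u)^-1 * (f u)^-1 * 'D_1 f u).
  by move=> Au; exact: (is_deriveVC (f0 u Au) (derivableP (Ck_derivable cf Au))).
split; first by move=> u /dV[].
have iV := IH (CkW cf).
have h := CkM (CkM (Ck_cst n (-1)) (CkM iV iV)) cf.2.
apply: (Ck_eq_on _ h) => u; rewrite inE => Au.
rewrite (nablaE (dV u Au)) /nabla derive1E -/kap.
move: ('D_1 f u) ((f u)^-1) kap => a b k.
by ring.
Qed.

Lemma smoothD f g : smooth f -> smooth g -> smooth (fun w => f w + g w).
Proof. by move=> sf sg n; exact: CkD. Qed.
Lemma smoothM f g : smooth f -> smooth g -> smooth (fun w => f w * g w).
Proof. by move=> sf sg n; exact: CkM. Qed.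
Lemma smoothV f : (forall u, A u -> f u != 0) -> smooth f -> smooth (fun w => (f w)^-1).
Proof. by move=> f0 sf n; exact: CkV. Qed.
Lemma smoothZ (k : CC R) f : smooth f -> smooth (fun w => k * f w).
Proof. by move=> sf; apply: smoothM => // n; exact: Ck_cst. Qed.

Lemma iter_nablaD n f g : smooth f -> smooth g ->
  {in A, iter n nabla (fun w => f w + g w) =1 (fun w => iter n nabla f w + iter n nabla g w)}.
Proof.
elim: n f g => [//|n IH] f g sf sg u Au; rewrite !iterSr.
have Au' : A u by move: Au; rewrite inE.
rewrite -(IH _ _ (smooth_nabla sf) (smooth_nabla sg) u Au).
apply: iter_nabla_eq_on Au => w; rewrite inE => Aw.
by rewrite nablaD; [|exact: smooth_derivable sf Aw|exact: smooth_derivable sg Aw].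
Qed.

Lemma iter_nablaZ n (k : CC R) f : smooth f ->
  {in A, iter n nabla (fun w => k * f w) =1 (fun w => k * iter n nabla f w)}.
Proof.
elim: n f => [//|n IH] f sf u Au; rewrite !iterSr.
rewrite -(IH _ (smooth_nabla sf) u Au).
apply: iter_nabla_eq_on Au => w; rewrite inE => Aw.
by rewrite nablaZ; last exact: smooth_derivable sf Aw.
Qed.

Lemma apply_nablaDf P f g : smooth f -> smooth g ->
  {in A, apply_nabla P (fun w => f w + g w) =1 (fun w => apply_nabla P f w + apply_nabla P g w)}.
Proof.
move=> sf sg u Au; rewrite /apply_nabla -big_split; apply: eq_bigr => i _.
by rewrite iter_nablaD // mulrDr.
Qed.

Lemma apply_nablaZf P (k : CC R) f : smooth f ->
  {in A, apply_nabla P (fun w => k * f w) =1 (fun w => k * apply_nabla P f w)}.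
Proof.
move=> sf u Au; rewrite /apply_nabla mulr_sumr; apply: eq_bigr => i _.
by rewrite iter_nablaZ // mulrCA.
Qed.

(** With [nabla E = E], the operator [nabla] conjugated by [E] is [nabla + 1]. This
    is how the factor [expC (- 2 pi i v)] of the multiplier becomes a shift of the
    polynomial. *)
Lemma apply_nabla_twist (E : CC R -> CC R) P f : smooth E -> smooth f ->
  {in A, nabla E =1 E} ->
  {in A, apply_nabla P (fun w => E w * f w) =1 (fun w => E w * apply_nabla (P \Po ('X + 1)) f w)}.
Proof.
move=> sE sf nE u Au.
have mono m g : smooth g -> iter m nabla (fun w => E w * g w) u = E u * apply_nabla (('X + 1) ^+ m) g u.
  elim: m g => [|m IH] g sg; first by rewrite expr0 apply_nabla1p.
  rewrite iterSr exprSr mulrDr mulr1 apply_nablaDp apply_nablaMX.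
  have -> : iter m nabla (nabla (fun w => E w * g w)) u =
     iter m nabla (fun w => E w * (g w + nabla g w)) u.
    apply: iter_nabla_eq_on Au => w wA; have Aw : A w by move: wA; rewrite inE.
    rewrite nablaM; [|exact: smooth_derivable sE Aw|exact: smooth_derivable sg Aw].
    by rewrite nE // mulrDr.
  rewrite IH; last by apply: smoothD => //; exact: smooth_nabla.
  have D := apply_nablaDf (('X + 1) ^+ m) sg (smooth_nabla sg) Au.
  by congr (_ * _); rewrite [RHS]addrC; exact: D.
rewrite comp_polyE apply_nabla_sump /apply_nabla mulr_sumr; apply: eq_bigr => i _.
by rewrite mono // -/(apply_nabla _ _ _) apply_nablaZp mulrCA.
Qed.

Lemma apply_nabla_const P (f : CC R -> CC R) : {in A, forall u, f u = 1} ->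
  {in A, forall u, apply_nabla P f u = P`_0}.
Proof.
move=> f1 u Au; rewrite (apply_nabla_eq_on P (g := fun=> 1)) //.
rewrite (@apply_nabla_wide (size P).+1) // big_ord_recl /= mulr1.
have it k : iter k.+1 nabla (fun=> 1 : CC R) = (fun=> 0 : CC R).
  by elim: k => [|k IH]; [exact: (nabla_cst 1)|rewrite iterS IH nabla_cst].
rewrite big1 ?addr0 // => i _.
by rewrite -[X in _ * X]/(iter i.+1 nabla (fun=> 1) u) it mulr0.
Qed.

End NablaCalculus.

(** * The polynomials of the nabla operators *)

Section BinomialPolynomials.
Variable K : numFieldType.
Implicit Types (p : {poly K}) (k i j : nat).

(** The binomial coefficient X choose k as a polynomial in X; with E the nilpotent
    shift, [(1 + E)^X] is the sum of the [binp k * E^k]. *)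
Fixpoint binp k : {poly K} :=
  if k is i.+1 then (i.+1%:R)^-1 *: (binp i * ('X - (i%:R)%:P)) else 1.

Arguments binp : simpl never.

Lemma binpS k : binp k.+1 = (k.+1%:R)^-1 *: (binp k * ('X - (k%:R)%:P)).
Proof. by []. Qed.
Lemma binp0 : binp 0 = 1. Proof. by []. Qed.

Let natS_neq0 k : (k.+1%:R : K) != 0. Proof. by rewrite pnatr_eq0. Qed.

Lemma binp_comp_add1 k : binp k.+1 \Po ('X + 1) = (k.+1%:R)^-1 *: (binp k * ('X + 1)).
Proof.
elim: k => [|k IH].
  by rewrite binpS binp0 comp_polyZ comp_polyM comp_polyB comp_polyX !comp_polyC subr0.
rewrite (binpS k.+1) comp_polyZ comp_polyM IH comp_polyB comp_polyX comp_polyC.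
congr (_ *: _); rewrite (binpS k) -!scalerAl; congr (_ *: _).
by rewrite -natr1 polyCD; ring.
Qed.

Lemma binp_pascal k : binp k.+1 \Po ('X + 1) = binp k.+1 + binp k.
Proof.
rewrite binp_comp_add1 binpS.
transitivity ((k.+1%:R)^-1 *: (binp k * ('X - (k%:R)%:P) + k.+1%:R *: binp k)).
  by congr (_ *: _); rewrite -mul_polyC -natr1 polyCD; ring.
by rewrite scalerDr scalerA mulVf // scale1r.
Qed.

Lemma binp_at0 k : (binp k).[0] = (k == 0%N)%:R.
Proof.
elim: k => [|k IH]; first by rewrite binp0 hornerC.
rewrite binpS hornerZ hornerM IH hornerXsubC sub0r.
by case: k {IH} => [|k]; rewrite ?oppr0 ?mulr0 // mul0r mulr0.
Qed.

Lemma binp_deriv_at0 k : (binp k.+1)^`().[0] = - acoef k.+1.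
Proof.
elim: k => [|k IH].
  by rewrite binpS binp0 derivZ mul1r derivXsubC hornerZ hornerC invr1 mulr1 /acoef expr1 divr1 opprK.
rewrite (binpS k.+1) derivZ hornerZ derivM hornerD !hornerM IH derivXsubC hornerC hornerXsubC.
rewrite (binp_at0 k.+1) /= mul0r addr0 /acoef !exprS.
move: (k.+1%:R) (k.+2%:R) (natS_neq0 k) (natS_neq0 k.+1) => x y x0 y0.
by field; rewrite x0 y0.
Qed.

(** A polynomial with period one takes its value at 0 infinitely often. *)
Lemma shift_invariant_poly p : p \Po ('X + 1) = p -> p.[0] = 0 -> p = 0.
Proof.
move=> inv p0; have pn i : p.[i%:R] = 0.
  elim: i => [//|i IH]; rewrite -natr1 -[RHS]IH -[in RHS]inv horner_comp.
  by rewrite hornerD hornerX hornerC.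
apply/eqP/negPn/negP => pne0.
have : all (root p) [seq i%:R | i <- iota 0 (size p)].
  by apply/allP => _ /mapP[i _ ->]; rewrite /root pn.
move=> /(max_poly_roots pne0); rewrite size_map size_iota ltnn.
suff -> : uniq [seq i%:R : K | i <- iota 0 (size p)] by move=> /(_ isT).
by rewrite map_inj_uniq ?iota_uniq // => i j /eqP; rewrite eqr_nat => /eqP.
Qed.

(** The coefficients of d/dX (1 + t)^X = log (1 + t) (1 + t)^X. Both sides have the
    same forward difference, by Pascal's rule and induction, and the same value
    at 0. *)
Lemma binp_deriv k : (binp k)^`() = - \sum_(j < k) acoef (k - j) *: binp j.
Proof.
apply/eqP; rewrite -addr_eq0; apply/eqP.
elim: k => [|k IH]; first by rewrite big_ord0 addr0 binp0 derivC.
apply: shift_invariant_poly.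
  apply/eqP; rewrite -subr_eq0; apply/eqP.
  rewrite comp_polyD rmorph_sum /=.
  have -> : (binp k.+1)^`() \Po ('X + 1) = (binp k.+1)^`() + (binp k)^`().
    rewrite -derivD -binp_pascal deriv_comp derivD derivX derivC addr0 mulr1 //.
  have -> : \sum_(j < k.+1) ((acoef (k.+1 - j) *: binp j) \Po ('X + 1)) =
     \sum_(j < k.+1) acoef (k.+1 - j) *: binp j + \sum_(j < k) acoef (k - j) *: binp j.
    rewrite !big_ord_recl comp_polyZ [binp 0 \Po _]rmorph1 -addrA; congr (_ + _).
    rewrite -big_split; apply: eq_bigr => j _.
    by rewrite lift0 comp_polyZ binp_pascal scalerDr subSS.
  rewrite -[RHS]IH; ring.
rewrite hornerD binp_deriv_at0 horner_sum big_ord_recl big1 ?addr0; last first.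
  by move=> j _; rewrite hornerZ lift0 binp_at0 mulr0.
by rewrite hornerZ binp_at0 subn0 mulr1 addNr.
Qed.

(** The same for [(1 + E)^(- X)]. *)
Definition binm k : {poly K} := binp k \Po (- 'X).

Lemma binm_deriv k : (binm k)^`() = \sum_(j < k) acoef (k - j) *: binm j.
Proof.
rewrite /binm deriv_comp binp_deriv derivN derivX mulrN1 rmorphN opprK rmorph_sum /=.
by apply: eq_bigr => j _; rewrite comp_polyZ.
Qed.

Lemma binm_at0 k : (binm k).[0] = (k == 0%N)%:R.
Proof. by rewrite horner_comp hornerN hornerX oppr0 binp_at0. Qed.

Lemma binm0 : binm 0 = 1. Proof. by rewrite /binm rmorph1. Qed.

Lemma binm_pascal k : binm k.+1 = (binm k.+1 \Po ('X + 1)) + (binm k \Po ('X + 1)).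
Proof.
have e : - 'X \Po ('X + 1) = - 'X - 1 :> {poly K}.
  by rewrite rmorphN /= comp_polyX opprD.
rewrite /binm -!comp_polyA !e -comp_polyD -binp_pascal -comp_polyA.
congr (_ \Po _); rewrite comp_polyD comp_polyX rmorph1 subrK //.
Qed.

End BinomialPolynomials.

Section NablaPolynomials.
Variable K : numFieldType.
Variable n : nat.
Local Notation d := (\sum_(p < n) n)%N.
Implicit Types (s t : 'I_d) (k l : nat).

Lemma sum_tagnat (V : zmodType) (G : nat -> nat -> V) :
  \sum_(t < d) G (tagnat.sig1 t) (tagnat.sig2 t) = \sum_(q < n) \sum_(j < n) G q j.
Proof.
rewrite (reindex _ (@tagnat.rank_bij_on n (fun=> n))) /=.
rewrite sig_big_dep /=; apply: eq_bigr => -[q j] _ /=.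
by rewrite /tagnat.sig1 /tagnat.sig2 tagnat.rankK.
Qed.

Lemma tagnat_val s : s = (n * tagnat.sig1 s + tagnat.sig2 s)%N :> nat.
Proof.
rewrite [LHS]tagnat.rect; congr (_ + _)%N.
rewrite -(big_ord_widen n (fun=> n)); last exact: ltnW.
by rewrite sum_nat_const card_ord mulnC.
Qed.

(** The entries of [Nmx] with all indices natural numbers, which avoids dependent
    block indices. *)
Definition Nval (p i q j : nat) : K :=
  if (q == p) then (if (j < i)%N then acoef (i - j) else 0)
  else if (p < q)%N && (i == j) then - acoef (q - p) else 0.

Lemma NmxE s t : @Nmx K n s t =
  Nval (tagnat.sig1 s) (tagnat.sig2 s) (tagnat.sig1 t) (tagnat.sig2 t).
Proof.
rewrite mxE /Nval /Ablock; set p := tagnat.sig1 s; set q := tagnat.sig1 t.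
case: (ltngtP p q) => [pq|pq|pq].
- have -> : (q - p == 0)%N = false by rewrite subn_eq0 leqNgt pq.
  by rewrite !mxE -val_eqE /=; case: eqP => _; rewrite ?mulr1n // mulr0n oppr0.
- by rewrite mxE.
by rewrite pq subnn eqxx mxE.
Qed.

(** The component of [exp (X N) e_(n (n - 1) + 1)] in block [p] at inner index [i]
    (both counted from 0): on the block index [N] is log (1 + E), on the inner index
    it is minus the logarithm of 1 plus the lower shift, and the two commute. *)
Definition solpoly (p i : nat) : {poly K} := binp K (n - p.+1) * binm K i.

(** The vector of the [solpoly] solves V' = N V. *)
Lemma solpoly_deriv (p i : 'I_n) : (solpoly p i)^`() =
  \sum_(q < n) \sum_(j < n) Nval p i q j *: solpoly q j.
Proof.
rewrite /solpoly derivM binm_deriv binp_deriv.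
rewrite [RHS](bigD1 p) //= [LHS]addrC; congr (_ + _).
  rewrite mulr_sumr (big_ord_widen n (fun j => binp K (n - p.+1) * (acoef (i - j) *: binm K j))); last exact: ltnW.
  rewrite big_mkcond; apply: eq_bigr => j _; rewrite /Nval eqxx.
  by case: ifP => _; rewrite ?scale0r // scalerAr.
rewrite mulNr mulr_suml (big_ord_widen n (fun j => acoef (n - p.+1 - j) *: binp K j * binm K i)); last exact: leq_subr.
rewrite (reindex_inj rev_ord_inj) /= -sumrN big_mkcond [RHS]big_mkcond /=.
apply: eq_bigr => q _.
have -> : (\sum_(j < n) Nval p i q j *: (binp K (n - q.+1) * binm K j)) =
   Nval p i q i *: (binp K (n - q.+1) * binm K i) + (if q == p then
     \sum_(j < n | j != i) Nval p i q j *: (binp K (n - q.+1) * binm K j) else 0).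
  rewrite (bigD1 i) //=; congr (_ + _); case: eqP => // qp.
  apply: big1 => j ji; rewrite /Nval.
  have -> : (q == p :> nat) = false by apply/eqP => h; apply: qp; exact: val_inj.
  by rewrite [(i : nat) == j]eq_sym (negbTE (_ : (j : nat) != i)) ?andbF ?scale0r.
have [->|qp] := eqVneq q p.
  by rewrite ltnn.
rewrite addr0 /Nval.
have -> : (q == p :> nat) = false by apply: negbTE.
rewrite eqxx andbT.
have -> : (n - q.+1 < n - p.+1)%N = (p < q)%N.
  by have := ltn_ord q; have := ltn_ord p; case: (ltnP p q); lia.
case: ifP => pq; last by rewrite scale0r.
have -> : (n - p.+1 - (n - q.+1) = q - p)%N by have := ltn_ord q; lia.
by rewrite scaleNr scalerAl.
Qed.

(** The differential equation determines the coefficients recursively from the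
    constant term, which is the initial vector: a formal version of uniqueness. *)
Lemma solpoly_coef m s : (solpoly (tagnat.sig1 s) (tagnat.sig2 s))`_m =
  (@Nmx K n ^+ m *m basisv d (n * (n - 1) + 1)) s 0 / m`!%:R.
Proof.
elim: m s => [|m IH] s.
  rewrite expr0 fact0 divr1 -horner_coef0 hornerM binp_at0 binm_at0 mul1mx mxE.
  rewrite -natrM mulnb; congr (_%:R); rewrite tagnat_val addn1 eqSS.
  have p := ltn_ord (tagnat.sig1 s); have i := ltn_ord (tagnat.sig2 s).
  congr nat_of_bool; apply/idP/idP => [/andP[/eqP h1 /eqP h2]|/eqP h].
    by rewrite h2 addn0; have -> : (n - 1 = tagnat.sig1 s)%N by lia.
  have n0 : (0 < n)%N by lia.
  have e1 : (tagnat.sig1 s = (n - 1)%N :> nat).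
    by have := congr1 (divn^~ n) h; rewrite /= !(mulnC n) divnMDl // divn_small // addn0 mulnK.
  have e2 : (tagnat.sig2 s = 0%N :> nat) by move: h; rewrite e1; lia.
  by rewrite e1 e2 eqxx andbT; apply/eqP; lia.
have f0 : (m.+1`!%:R : K) != 0 by rewrite pnatr_eq0 -lt0n fact_gt0.
have m0 : (m.+1%:R : K) != 0 by rewrite pnatr_eq0.
have mf0 : (m`!%:R : K) != 0 by rewrite pnatr_eq0 -lt0n fact_gt0.
have h : (solpoly (tagnat.sig1 s) (tagnat.sig2 s))`_m.+1 * m.+1%:R =
  (@Nmx K n ^+ m.+1 *m basisv d (n * (n - 1) + 1)) s 0 / m`!%:R.
  rewrite mulr_natr -coef_deriv solpoly_deriv exprS -[Nmx n * _]/(Nmx n *m _) -mulmxA mxE mulr_suml.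
  rewrite -(sum_tagnat (fun q j => Nval (tagnat.sig1 s) (tagnat.sig2 s) q j *: solpoly q j)).
  rewrite coef_sum; apply: eq_bigr => t _.
  by rewrite coefZ IH NmxE mulrA.
apply: (mulIf m0); rewrite h factS natrM.
move: (m.+1%:R) (m`!%:R) m0 mf0 => x y x0 y0.
by field; rewrite x0 y0.
Qed.

(** Reads off [nabla_(k,l)] as (X choose k) (- X choose l), that is, the product of
    the coefficients of [J^X] and [J^(- X)]. *)
Lemma nabla_polyE k l : (k < n)%N -> (l < n)%N ->
  nabla_poly n k l = binp K k * binm K l.
Proof.
move=> kn ln.
have n0 : (0 < n)%N by lia.
have pn : (n - k.+1 < n)%N by lia.
pose s : 'I_d := @tagnat.Rank n (fun=> n) (Ordinal pn) (Ordinal ln).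
have s1 : tagnat.sig1 s = (n - k.+1)%N :> nat by rewrite /s tagnat.Rank1K.
have s2 : tagnat.sig2 s = l :> nat by rewrite /s tagnat.Rank2K.
have sv : s = (n * (n - k - 1) + l)%N :> nat.
  by rewrite tagnat_val s1 s2; congr (_ * _ + _)%N; lia.
have -> : binp K k * binm K l = solpoly (tagnat.sig1 s) (tagnat.sig2 s).
  by rewrite s1 s2 /solpoly; congr (binp K _ * _); lia.
have -> : nabla_poly n k l = (exp_nabla (@Nmx K n) *m basisv d (n * (n - 1) + 1)) s 0.
  rewrite /nabla_poly -mulmxA mxE (bigD1 s) //= [X in _ + X]big1 ?addr0.
    by rewrite !mxE sv addn1 eqxx mul1r.
  move=> t ts; rewrite !mxE.
  suff -> : (t.+1 == n * (n - k - 1) + l + 1)%N = false by rewrite mul0r.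
  by apply: negbTE; rewrite addn1 eqSS -sv.
apply/polyP => m; rewrite solpoly_coef /exp_nabla mulmx_suml summxE coef_sum.
have powE (i : nat) : (('X *: map_mx polyC (@Nmx K n)) ^+ i) = 'X^i *: map_mx polyC (@Nmx K n ^+ i).
  elim: i => [|i IH]; first by rewrite !expr0 scale1r map_mx1.
  rewrite !exprS IH -[_ * _]/(_ *m _) -[Nmx n * _]/(Nmx n *m _) map_mxM.
  by rewrite -scalemxAl -scalemxAr scalerA.
have term (i : nat) : (((i`!%:R)^-1)%:P *: ('X *: map_mx polyC (@Nmx K n)) ^+ i *m basisv d (n * (n - 1) + 1)) s 0 =
   ((@Nmx K n ^+ i *m basisv d (n * (n - 1) + 1)) s 0 / i`!%:R) *: 'X^i.
  rewrite powE scalerA -scalemxAl mxE.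
  have -> : basisv d (n * (n - 1) + 1) = map_mx polyC (basisv d (n * (n - 1) + 1)) :> 'cV[{poly K}]_d.
    by apply/matrixP => a b; rewrite !mxE; case: eqP => _; rewrite ?polyC1 ?polyC0.
  rewrite -map_mxM mxE -!mul_polyC polyCM; ring.
under eq_bigr do rewrite term coefZ coefXn.
have [md|dm] := ltnP m d.
  rewrite (bigD1 (Ordinal md)) //= eqxx mulr1 [X in _ + X]big1 ?addr0 // => i im.
  have -> : (m == i) = false.
    by apply/negbTE; apply: contra im => /eqP h; apply/eqP/val_inj; rewrite /= h.
  by rewrite mulr0.
rewrite [LHS]big1; last first.
  move=> i _; have -> : (m == i) = false by rewrite gtn_eqF // (leq_trans _ dm).
  by rewrite mulr0.
by rewrite -(subnK dm) exprD Nmx_nilpotent mulr0 mul0mx mxE mul0r.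
Qed.

End NablaPolynomials.

(** * The nabla operators on the scalar solution *)

Section ThetaSmooth.
Context {R : realType} (tau : CC R).
Hypothesis im_tau : 0 < imC tau.
Implicit Types (u v z : CC R) (P : {poly CC R}).

Definition theta_dom : set (CC R) := [set u | theta tau u != 0].

Lemma open_theta_dom : open theta_dom.
Proof.
rewrite openE => u u0; rewrite /interior.
have c : {for u, continuous (theta tau)}.
  by apply: derivable_continuousC; exact: derivable_theta.
have e0 : 0 < cabs (theta tau u) by rewrite cabs_gt0.
have hc := (@cvgCP _ _ (nbhs u) _ _ _).1 c _ e0.
near=> w; rewrite /theta_dom /=; apply/eqP => w0.
have : cabs (theta tau u - theta tau w) < cabs (theta tau u) by near: w; exact: hc.
by rewrite w0 subr0 ltxx.
Unshelve. all: by end_near. Qed.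

Local Notation Om := theta_dom.
Local Notation smth := (smooth Om).

Section Family.
Variable T : nat -> CC R -> CC R.
Hypothesis dT : forall e z, is_derive z 1 (T e) (T e.+1 z).

Lemma derive_shift_family e u z : is_derive u 1 (fun w => T e (w + z)) (T e.+1 (u + z)).
Proof.
exact: is_derive_shiftC (dT e (u + z)).
Qed.

Lemma smooth_family e z : smth (fun u => T e (u + z)).
Proof.
move=> m; elim: m e => [//|m IH] e; split.
  by move=> u _; case: (derive_shift_family e u z).
have -> : nabla (fun u => T e (u + z)) = (fun u => - (2 * pic * ic)^-1 * T e.+1 (u + z)).
  by apply/funext => u; rewrite (nablaE (derive_shift_family e u z)).
by apply: CkM; [exact: open_theta_dom|exact: Ck_cst|exact: IH].
Qed.

(** One derivative in [u] turns [T(u + z) r(u)] into a sum of two functions of the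
    same shape, which are holomorphic in [z]. *)
Lemma derivable_iter_nabla m e (r : CC R -> CC R) u z : smth r -> Om u ->
  derivable (fun z => iter m nabla (fun w => T e (w + z) * r w) u) z 1.
Proof.
have oO := open_theta_dom.
elim: m e r => [|m IH] e r sr Ou /=.
  apply: derivableM; last exact: derivable_cst.
  have -> : (fun z => T e (u + z)) = (fun z => T e (z + u)).
    by apply/funext => w; rewrite addrC.
  by case: (derive_shift_family e z u).
have sk : smth (fun w => - (2 * pic * ic)^-1 * r w) by exact: smoothZ.
have sn := smooth_nabla sr.
have -> : (fun z => nabla (iter m nabla (fun w => T e (w + z) * r w)) u) =
   (fun z => iter m nabla (fun w => T e.+1 (w + z) * (- (2 * pic * ic)^-1 * r w)) u +
             iter m nabla (fun w => T e (w + z) * nabla r w) u).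
  apply/funext => w; rewrite -iterS iterSr.
  have s1 := smoothM oO (smooth_family e.+1 w) sk.
  have s2 := smoothM oO (smooth_family e w) sn.
  have uO : u \in Om by rewrite inE.
  rewrite -(iter_nablaD oO m s1 s2 uO).
  apply: (iter_nabla_eq_on oO m _ uO) => x; rewrite inE => Ox.
  have dx := derive_shift_family e x w.
  rewrite nablaM; [|by case: dx|exact: smooth_derivable sr Ox].
  by rewrite (nablaE dx); ring.
by apply: derivableD; apply: IH.
Qed.

End Family.

Lemma smooth_inv_theta : smth (fun u => (theta tau u)^-1).
Proof.
have [T [T0 dT]] := theta_smooth im_tau.
apply: (smoothV open_theta_dom) => //.
have -> : theta tau = (fun u => T 0%N (u + 0)) by apply/funext => u; rewrite T0 addr0.
exact: smooth_family.
Qed.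

(** The part of the multiplier that depends on the parameter. *)
Definition twist u : CC R := expC (- (2 * pic * ic) * u).

Lemma nabla_twist u : nabla twist u = twist u.
Proof.
rewrite (nablaE (is_derive_expCM (- (2 * pic * ic)) u)) mulrA mulrNN mulVf ?mul1r //.
by rewrite -mulrA two_pi_i_neq0.
Qed.

Lemma smooth_twist : smth twist.
Proof.
move=> m; elim: m => [//|m IH]; split.
  by move=> u _; case: (is_derive_expCM (- (2 * pic * ic)) u).
by have -> : nabla twist = twist by apply/funext => u; exact: nabla_twist.
Qed.

Lemma phi_factor z : (fun u => phi tau u z) =
  (fun u => expC (- (pic * ic * z)) * (theta tau (u + z) * (theta tau u)^-1)).
Proof. by apply/funext => u; rewrite /phi (addrC z) mulrA. Qed.

Lemma smooth_theta_quot z : smth (fun u => theta tau (u + z) * (theta tau u)^-1).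
Proof.
have [T [T0 dT]] := theta_smooth im_tau.
apply: smoothM; [exact: open_theta_dom| |exact: smooth_inv_theta].
by rewrite -T0; exact: smooth_family.
Qed.

Lemma smooth_phi z : smth (fun u => phi tau u z).
Proof.
by rewrite phi_factor; apply: smoothZ; [exact: open_theta_dom|exact: smooth_theta_quot].
Qed.

(** Here nabla acts on the parameter of the scalar solution, and [z] is the variable
    of the solution. *)
Definition phi_nabla P v z : CC R := apply_nabla P (fun u => phi tau u z) v.

Lemma derivable_phi_nabla P v z : Om v -> derivable (phi_nabla P v) z 1.
Proof.
move=> Ov; have vO : v \in Om by rewrite inE.
have [T [T0 dT]] := theta_smooth im_tau.
have -> : phi_nabla P v = (fun z => expC (- (pic * ic) * z) *
   \sum_(m < size P) P`_m * iter m nabla (fun u => T 0%N (u + z) * (theta tau u)^-1) v).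
  apply/funext => w; rewrite /phi_nabla phi_factor T0 mulNr.
  by rewrite (apply_nablaZf open_theta_dom P _ (smooth_theta_quot w) vO).
apply: derivableM; first by case: (is_derive_expCM (- (pic * ic)) z).
have -> : (fun z => \sum_(m < size P) P`_m *
    iter m nabla (fun u => T 0%N (u + z) * (theta tau u)^-1) v) =
    (\sum_(m < size P) (fun z => P`_m *
    iter m nabla (fun u => T 0%N (u + z) * (theta tau u)^-1) v)).
  by apply/funext => w; rewrite fct_sumE.
apply: derivable_sum => m; apply: derivableM; first exact: derivable_cst.
exact: (@derivable_iter_nabla T dT m 0%N _ v z smooth_inv_theta Ov).
Qed.

Lemma phi_nabla_add1 P v z : phi_nabla P v (z + 1) = phi_nabla P v z.
Proof.
rewrite /phi_nabla; congr (apply_nabla _ _ _); apply/funext => u; exact: phi_add1.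
Qed.

Lemma phi_nabla_addtau P v z : Om v ->
  phi_nabla P v (z + tau) = efac tau v z * phi_nabla (P \Po ('X + 1)) v z.
Proof.
move=> Ov; have vO : v \in Om by rewrite inE.
have oO := open_theta_dom.
rewrite /phi_nabla.
have e u : efac tau u z = efac tau 0 z * twist u.
  rewrite /efac /twist mulNr -expCD; congr (- expC _); ring.
have -> : (fun u => phi tau u (z + tau)) = (fun u => efac tau 0 z * (twist u * phi tau u z)).
  by apply/funext => u; rewrite phi_addtau // e mulrA.
have sp := smooth_phi z; have st := smooth_twist.
rewrite (apply_nablaZf oO P _ (smoothM oO st sp) vO).
have nt : {in Om, nabla twist =1 twist} by move=> u _; exact: nabla_twist.
by rewrite (apply_nabla_twist oO P st sp nt vO) (e v) mulrA.
Qed.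

Lemma phi_nabla0 P v : Om v -> phi_nabla P v 0 = P`_0.
Proof.
move=> Ov; have vO : v \in Om by rewrite inE.
apply: (apply_nabla_const open_theta_dom P _ vO) => u; rewrite inE => Ou.
exact: phi0.
Qed.

End ThetaSmooth.

(** * Solutions for the Jordan block *)

Section Shift.
Variables (K : fieldType) (n : nat).
Implicit Types (k l : nat) (Z : 'M[K]_n).

Definition shiftmx : 'M[K]_n := \matrix_(i < n, j < n) (j == i.+1 :> nat)%:R.

Lemma jordan1E : jordan1 n = 1%:M + shiftmx.
Proof.
apply/matrixP => i j; rewrite !mxE [i == j]eq_sym -[j == i]val_eqE /=.
have [->|_] := eqVneq (j : nat) i; last by rewrite add0r.
by rewrite (ltn_eqF (ltnSn i)) addr0.
Qed.

Lemma shiftmxX k (i j : 'I_n) : (shiftmx ^+ k) i j = (j == (i + k)%N :> nat)%:R.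
Proof.
elim: k j => [|k IH] j; first by rewrite expr0 mxE addn0 -[i == j]val_eqE /= eq_sym.
rewrite exprSr mxE.
have [ik|ik] := ltnP (i + k) n.
  rewrite (bigD1 (Ordinal ik)) //= IH eqxx mul1r big1 ?addr0 ?mxE ?addnS //.
  move=> t tk; rewrite IH (negbTE (_ : (t : nat) != (i + k)%N)) ?mul0r //.
have -> : (j == (i + k.+1)%N :> nat) = false.
  by apply: ltn_eqF; apply: leq_trans (ltn_ord j) _; rewrite addnS leqW.
apply: big1 => t _; rewrite IH.
by rewrite (ltn_eqF (leq_trans (ltn_ord t) ik)) mul0r.
Qed.

Lemma shiftmx_nilp : shiftmx ^+ n = 0.
Proof.
apply/matrixP => i j; rewrite shiftmxX mxE.
by rewrite (ltn_eqF (leq_trans (ltn_ord j) (leq_addl _ _))).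
Qed.

Definition shift2 k l Z : 'M[K]_n := shiftmx ^+ k *m Z *m shiftmx ^+ l.

Lemma shift2_mull k l Z : shiftmx *m shift2 k l Z = shift2 k.+1 l Z.
Proof. by rewrite /shift2 !mulmxA exprS. Qed.
Lemma shift2_mulr k l Z : shift2 k l Z *m shiftmx = shift2 k l.+1 Z.
Proof. by rewrite /shift2 exprSr -!mulmxA. Qed.
Lemma shift2_00 Z : shift2 0 0 Z = Z.
Proof. by rewrite /shift2 !expr0 mul1mx mulmx1. Qed.
Lemma shift2_nl l Z : shift2 n l Z = 0.
Proof. by rewrite /shift2 shiftmx_nilp !mul0mx. Qed.
Lemma shift2_nr k Z : shift2 k n Z = 0.
Proof. by rewrite /shift2 shiftmx_nilp !mulmx0. Qed.

Lemma shift2_delta k l (r p q s : 'I_n) :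
  shift2 k l (delta_mx r p) q s = ((r == (q + k)%N :> nat) && (s == (p + l)%N :> nat))%:R.
Proof.
rewrite /shift2 mxE (bigD1 p) //= mxE (bigD1 r) //=.
rewrite [X in _ + X]big1 => [|t tp]; last first.
  rewrite mxE big1 ?mul0r // => u _.
  by rewrite mxE (negbTE tp) andbF mulr0.
rewrite [X in (_ + X) * _]big1 => [|t tr]; last by rewrite mxE (negbTE tr) mulr0.
by rewrite !addr0 mxE !eqxx mulr1 !shiftmxX -natrM mulnb.
Qed.

Lemma sum_shift_coef (V : lmodType K) (g : nat -> K) (W : nat -> V) : W n = 0 ->
  \sum_(l < n) g l *: (W l + W l.+1) =
  \sum_(l < n) (g l + (if (l : nat) is l'.+1 then g l' else 0)) *: W l.
Proof.
move=> Wn; under eq_bigr do rewrite scalerDr.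
under [RHS]eq_bigr do rewrite scalerDl.
rewrite !big_split; congr (_ + _) => /=.
case: (n) Wn => [|m] Wm; first by rewrite !big_ord0.
rewrite big_ord_recr big_ord_recl /= Wm scaler0 addr0 scale0r add0r.
by [].
Qed.

Lemma sum_delta00 (V : lmodType K) (W : nat -> nat -> V) : (0 < n)%N ->
  \sum_(k < n) \sum_(l < n) ((k == 0%N :> nat) && (l == 0%N :> nat))%:R *: W k l = W 0%N 0%N.
Proof.
case: n => [//|m] _; rewrite big_ord_recl big_ord_recl /= scale1r.
rewrite big1 => [|l _]; last by rewrite scale0r.
by rewrite addr0 big1 ?addr0 // => k _; rewrite big1 // => l _; rewrite scale0r.
Qed.

End Shift.

Section Solution.
Context {R : realType} (n : nat) (tau v : CC R).
Hypothesis im_tau : 0 < imC tau.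
Hypothesis v_dom : ~ lattice tau v.
Implicit Types (z : CC R) (Z : 'M[CC R]_n) (P Q : {poly CC R}).

Local Notation J := (@jordan1 (CC R) n).
Local Notation B P z := (phi_nabla tau P v z).
Local Notation b k := (binp (CC R) k).
Local Notation bm l := (binm (CC R) l).

Let theta_v : theta_dom tau v. Proof. exact: theta_neq0. Qed.

(** The solution with value [Z] at the origin. Formally it is
    [J^nabla Z J^(- nabla)] applied to the scalar solution, since conjugation by [J]
    amounts to replacing the parameter [v] by [v] minus a nilpotent operator. *)
Definition solmx Z z : 'M[CC R]_n :=
  \sum_(k < n) \sum_(l < n) B (b k * bm l) z *: shift2 k l Z.

Lemma B_add P Q z : B (P + Q) z = B P z + B Q z.
Proof. exact: apply_nablaDp. Qed.

(** [nabla] becomes [nabla + 1] under translation by [tau], and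
    [J^(nabla + 1) Z J^(- nabla - 1) J = J (J^nabla Z J^(- nabla))]; coefficientwise
    these are Pascal's rules for [binp] and [binm]. *)
Lemma solmx_addtau Z z : solmx Z (z + tau) *m J = efac tau v z *: (J *m solmx Z z).
Proof.
rewrite jordan1E mulmxDr mulmx1 mulmxDl mul1mx.
pose bs k : {poly CC R} := if k is k'.+1 then b k' else 0.
pose m l := bm l \Po ('X + 1).
have bshift k : b k \Po ('X + 1) = b k + bs k.
  by case: k => [|k]; [rewrite /bs rmorph1 addr0|rewrite binp_pascal].
have mshift l : m l + (if l is l'.+1 then m l' else 0) = bm l.
  by case: l => [|l]; rewrite /m; [rewrite addr0 binm0 rmorph1|rewrite -binm_pascal].
have L : solmx Z (z + tau) + solmx Z (z + tau) *m shiftmx (CC R) n =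
   efac tau v z *: \sum_(k < n) \sum_(l < n) B ((b k + bs k) * bm l) z *: shift2 k l Z.
  rewrite /solmx mulmx_suml -big_split /= scaler_sumr; apply: eq_bigr => k _.
  rewrite mulmx_suml -big_split /= scaler_sumr.
  under eq_bigr => l _ do rewrite -scalemxAl -scalerDr shift2_mulr.
  rewrite (sum_shift_coef (fun l => B (b k * bm l) (z + tau)) (W := fun l => shift2 k l Z));
    last exact: shift2_nr.
  apply: eq_bigr => l _; rewrite scalerA; congr (_ *: _).
  transitivity (efac tau v z * (B ((b k + bs k) * m l) z +
      B ((b k + bs k) * (if (l : nat) is l'.+1 then m l' else 0)) z)); last first.
    by rewrite -B_add -mulrDr mshift.
  rewrite mulrDr phi_nabla_addtau // comp_polyM bshift -/(m l); congr (_ + _).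
  case: (nat_of_ord l) => [|l'].
    by rewrite mulr0 /phi_nabla apply_nabla0p mulr0.
  by rewrite phi_nabla_addtau // comp_polyM bshift.
rewrite L; congr (_ *: _); rewrite /solmx mulmx_sumr -big_split /=.
rewrite exchange_big [RHS](eq_bigr (fun k : 'I_n => \sum_(l < n) B (b k * bm l) z *: (shift2 k l Z + shift2 k.+1 l Z))).
  rewrite [RHS]exchange_big; apply: eq_bigr => l _.
  rewrite (sum_shift_coef (fun k => B (b k * bm l) z) (W := fun k => shift2 k l Z));
    last exact: shift2_nl.
  apply: eq_bigr => k _; congr (_ *: _); rewrite mulrDl B_add; congr (_ + _).
  by rewrite /bs; case: (nat_of_ord k) => [|k'] //; rewrite mul0r /phi_nabla apply_nabla0p.
move=> k _; rewrite mulmx_sumr -big_split /=; apply: eq_bigr => l _.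
by rewrite -scalemxAr -scalerDr shift2_mull.
Qed.

Lemma solmx_add1 Z z : solmx Z (z + 1) = solmx Z z.
Proof.
apply: eq_bigr => k _; apply: eq_bigr => l _; by rewrite phi_nabla_add1.
Qed.

Lemma solmx0 Z : (0 < n)%N -> solmx Z 0 = Z.
Proof.
move=> n0.
have B0 k l : B (b k * bm l) 0 = ((k == 0%N) && (l == 0%N))%:R.
  by rewrite phi_nabla0 // -horner_coef0 hornerM binp_at0 binm_at0 -natrM mulnb.
transitivity (\sum_(k < n) \sum_(l < n)
   ((k == 0%N :> nat) && (l == 0%N :> nat))%:R *: shift2 k l Z).
  by apply: eq_bigr => k _; apply: eq_bigr => l _; rewrite B0.
by rewrite (sum_delta00 (fun k l => shift2 k l Z) n0) shift2_00.
Qed.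

Lemma solmx_Sol Z : Sol J v tau (solmx Z).
Proof.
split; [|exact: solmx_add1|exact: solmx_addtau].
move=> i j z.
have -> : (fun w => solmx Z w i j) = \sum_(k < n) \sum_(l < n)
   (fun w => B (b k * bm l) w * shift2 k l Z i j).
  apply/funext => w; rewrite /solmx summxE fct_sumE; apply: eq_bigr => k _.
  by rewrite summxE fct_sumE; apply: eq_bigr => l _; rewrite mxE.
apply: derivable_sum => k; apply: derivable_sum => l.
by apply: derivableM; [exact: derivable_phi_nabla|exact: derivable_cst].
Qed.

(** The equation couples the entry [(i, j)] only with [(i, j - 1)] and [(i + 1, j)].
    By induction on [j - i] these vanish, and what remains is the scalar equation
    with a zero at the origin. *)
Lemma Sol_zero (Phi : CC R -> 'M[CC R]_n) : Sol J v tau Phi -> Phi 0 = 0 ->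
  forall z, Phi z = 0.
Proof.
move=> [dPhi P1 Pt] P0.
have ent (i j : 'I_n) z : Phi (z + tau) i j + (Phi (z + tau) *m shiftmx (CC R) n) i j =
   efac tau v z * (Phi z i j + (shiftmx (CC R) n *m Phi z) i j).
  have := congr1 (fun M : 'M[CC R]_n => M i j) (Pt z).
  by rewrite jordan1E mulmxDr mulmx1 mulmxDl mul1mx !mxE.
have claim m : forall i j : 'I_n, (j + (n - i.+1) < m)%N -> forall z, Phi z i j = 0.
  elim: m => [//|m IH] i j ijm.
  have sr z : (Phi z *m shiftmx (CC R) n) i j = 0.
    rewrite mxE; apply: big1 => t _; rewrite mxE.
    case: eqP => jt; last by rewrite mulr0.
    by rewrite IH ?mul0r // -ltnS (leq_trans _ ijm) // jt.
  have sl z : (shiftmx (CC R) n *m Phi z) i j = 0.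
    rewrite mxE; apply: big1 => t _; rewrite mxE.
    case: eqP => ti; last by rewrite mul0r.
    rewrite IH ?mulr0 // -ltnS (leq_trans _ ijm) // ltnS ti -addnS.
    by have := ltn_ord t; rewrite ti; lia.
  apply: (scalar_sol_zero im_tau v_dom).
    split; [exact: dPhi|by move=> z; rewrite P1|].
    by move=> z; have := ent i j z; rewrite sr sl !addr0.
  by rewrite P0 mxE.
by move=> z; apply/matrixP => i j; rewrite mxE; exact: claim (ltnSn _) z.
Qed.

Lemma res0_inj : {in Sol J v tau &, injective (@res0 R n)}.
Proof.
move=> F G; rewrite !inE => -[dF F1 Ft] [dG G1 Gt] FG.
apply/funext => z; apply/eqP; rewrite -subr_eq0; apply/eqP.
apply: (@Sol_zero (fun z => F z - G z)) z.
  split.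
  - move=> i j z.
    have -> : (fun w => (F w - G w) i j) = (fun w => F w i j) - (fun w => G w i j).
      by apply/funext => w; rewrite !mxE.
    by apply: derivableB; [exact: dF|exact: dG].
  - by move=> z; rewrite F1 G1.
  - by move=> z; rewrite mulmxBl Ft Gt mulmxBr scalerBr.
by move: FG; rewrite /res0 => ->; rewrite subrr.
Qed.

Lemma res0_invE Z : (0 < n)%N -> res0_inv J v tau Z = solmx Z.
Proof.
move=> n0; rewrite -{1}(solmx0 Z n0) -/(res0 (solmx Z)) /res0_inv.
by rewrite (pinvKV _ res0_inj) // inE; exact: solmx_Sol.
Qed.

End Solution.

Lemma sum_elmx_entry (K : fieldType) n k l (p q r s : 'I_n) :
  (\sum_(1 <= i < (n - l).+1) \sum_(1 <= j < (n - k).+1)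
    (@elmx K n i (j + k) *t @elmx K n j (i + l)))
    (mxtens_index (p, q)) (mxtens_index (r, s)) =
  ((r == (q + k)%N :> nat) && (s == (p + l)%N :> nat))%:R.
Proof.
rewrite summxE.
have E (i j : nat) : (@elmx K n i (j + k) *t @elmx K n j (i + l))
   (mxtens_index (p, q)) (mxtens_index (r, s)) =
   ([&& i == p.+1, j == q.+1, r == (q + k)%N :> nat & s == (p + l)%N :> nat])%:R.
  rewrite tensmxE !mxE -natrM mulnb; congr (nat_of_bool _)%:R.
  apply/idP/idP => [/andP[/andP[/eqP ip /eqP rj] /andP[/eqP jq /eqP si]]|].
    by apply/and4P; split; apply/eqP; lia.
  by move=> /and4P[/eqP -> /eqP -> /eqP -> /eqP ->]; rewrite !addSn !eqxx.
under eq_bigr => i _ do rewrite summxE.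
under eq_bigr => i _ do under eq_bigr => j _ do rewrite E.
have [/andP[/eqP rq /eqP sp]|_] := boolP ((r == (q + k)%N :> nat) && (s == (p + l)%N :> nat)).
  have := ltn_ord r; have := ltn_ord s; rewrite rq sp => hs hr.
  rewrite (bigD1_seq p.+1) ?iota_uniq //=; last by rewrite mem_index_iota; lia.
  rewrite (bigD1_seq q.+1) ?iota_uniq //=; last by rewrite mem_index_iota; lia.
  rewrite !eqxx /= big1 => [|j jq]; last by rewrite (negbTE jq).
  by rewrite addr0 big1 ?addr0 // => i ip; rewrite big1 // => j _; rewrite (negbTE ip).
rewrite big1 // => i _; rewrite big1 // => j _.
by rewrite !andbF.
Qed.

Lemma tensor_of_entry (K : fieldType) n (F : 'M[K]_n -> 'M[K]_n) (p q r s : 'I_n) :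
  tensor_of F (mxtens_index (p, q)) (mxtens_index (r, s)) = F (delta_mx r p) q s.
Proof.
rewrite /tensor_of summxE (bigD1 p) //= [X in _ + X]big1 ?addr0.
  rewrite summxE (bigD1 r) //= [X in _ + X]big1 ?addr0.
    by rewrite tensmxE mxE !eqxx mul1r.
  by move=> j jr; rewrite tensmxE mxE eqxx /= eq_sym (negbTE jr) mul0r.
move=> i ip; rewrite summxE big1 // => j _.
by rewrite tensmxE mxE eq_sym (negbTE ip) mul0r.
Qed.

Lemma kronecker_phi (R : realType) (tau y : CC R) : 0 < imC tau -> theta tau y != 0 ->
  (fun u => kronecker tau u y) =
  (fun u => derive1 (theta tau) 0 * expC (pic * ic * y) / theta tau y * phi tau u y).
Proof.
move=> im_tau ty; apply/funext => u; rewrite /kronecker /phi expCN (addrC u).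
have [->|tu] := eqVneq (theta tau u) 0; first by rewrite mul0r invr0 !mulr0.
by field; rewrite ty tu expC_neq0.
Qed.

Unset Implicit Arguments.
Set Strict Implicit.
Set Printing Implicit Defensive.

Theorem theorem4p7 (R : realType) (n : nat) (tau : CC R)
    (n_ge1 : (1 <= n)%N) (im_tau : 0 < imC tau) :
  let c : CC R := expC (pic * ic * tau / 4) / (ic * derive1 (theta tau) 0) in
  c != 0 /\
  forall v y : CC R, ~ lattice tau v -> ~ lattice tau y ->
    rJ (jordan1 n) tau v y =
    c *: \sum_(0 <= k < n) \sum_(0 <= l < n)
           apply_nabla (nabla_poly n k l) (fun u => kronecker tau u y) v *:
           \sum_(1 <= i < (n - l).+1) \sum_(1 <= j < (n - k).+1)
             (elmx n i (j + k)%N *t elmx n j (i + l)%N).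
Proof.
set c := _ / _; have d0 := theta_deriv0_neq0 im_tau.
have c0 : c != 0.
  apply: mulf_neq0; first exact: expC_neq0.
  by rewrite invr_eq0; apply: mulf_neq0 => //; exact: ic_neq0.
split=> // v y vL yL.
have ty := theta_neq0 im_tau yL; have tv := theta_neq0 im_tau vL.
have vO : v \in theta_dom tau by rewrite inE.
(* c turns the normalisation of ev and res0 into that of the Kronecker function *)
have coef P : c * apply_nabla P (fun u => kronecker tau u y) v =
   (thetabar tau (y + (tau + 1) / 2))^-1 * phi_nabla tau P v y.
  rewrite kronecker_phi // (apply_nablaZf (open_theta_dom im_tau) P _ (smooth_phi im_tau y) vO).
  rewrite -/(phi_nabla tau P v y) thetabar_theta // expCN /c.
  move: (phi_nabla tau P v y) => F.
  by field; rewrite !expC_neq0 ic_neq0 ty d0.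
apply/matrixP => a b.
case: (mxtens_unindex a) (mxtens_unindexK a) => p q <-.
case: (mxtens_unindex b) (mxtens_unindexK b) => r s <-.
rewrite tensor_of_entry /rtilde /ev res0_invE // mxE /solmx summxE.
rewrite [RHS]mxE summxE big_mkord !mulr_sumr; apply: eq_bigr => k _.
rewrite !summxE big_mkord !mulr_sumr; apply: eq_bigr => l _.
rewrite mxE shift2_delta [in RHS]mxE sum_elmx_entry nabla_polyE //.
by rewrite !mulrA coef.
Qed.
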